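(* Let $s_1\ge s_2\ge1$ be coprime integers and let $X_0:\ \dot x=P(x,y),\ \dot y=Q(x,y)$ be a real polynomial $(s_1,s_2)$-quasi-homogeneous system of weight degree $m$ with a center at the origin. Consider the perturbation (analytic in $\epsilon$) $$\dot x=P(x,y)+\sum_{i=1}^\infty\epsilon^iP_i(x,y),\qquad \dot y=Q(x,y)+\sum_{i=1}^\infty\epsilon^iQ_i(x,y),$$ of degree $n$ (the $P_i,Q_i$ are real polynomials of degree at most $n$), with $n\ge m$. If the first non-vanishing Melnikov function is the one of order $k$, $M_k(h)$, then $M_k(h)$ has at most $K(k,n,s_1,s_2)$ positive zeros, where $$K(k,n,s_1,s_2)=\begin{cases}\dfrac{k((n+1)s_1-s_2)}2-1,&\text{if }n\text{ is even and } k,s_1,s_2\text{ are all odd; or } k\text{ is even and }s_1+s_2\text{ is odd; or } s_2\text{ is even and }k,s_1,n\text{ are all odd},\\[2mm] \dfrac{k((n+1)s_1-s_2)}2,&\text{if }k\text{ is even and }s_1,s_2\text{ are both odd},\\[2mm] \dfrac{k((n+1)s_1-s_2)-1}2,&\text{otherwise}.\end{cases}$$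
   Context: The system $\dot x=P,\dot y=Q$ is $(s_1,s_2)$-quasi-homogeneous of weight degree $m$ if $P(\lambda^{s_1}x,\lambda^{s_2}y)=\lambda^{s_1+m-1}P(x,y)$ and $Q(\lambda^{s_1}x,\lambda^{s_2}y)=\lambda^{s_2+m-1}Q(x,y)$ for all $\lambda>0$. When it has a center at the origin, $\mathbb R^2\setminus\{(0,0)\}$ is filled by closed orbits around the origin (the period annulus). Melnikov functions: let $L$ be the positive $x$-half-axis (which is transverse to $X_0$), parametrized by $h\in(0,+\infty)$ through $x=s_1^{-1/(2s_2)}h^{s_1}$. The first return map of the perturbed system on $L$, defined for $h$ in compact subsets of $(0,+\infty)$ and $|\epsilon|$ small, expands as $\mathcal P(h,\epsilon)=h+\epsilon M_1(h)+\epsilon^2M_2(h)+\cdots$. The first non-vanishing Melnikov function is $M_k$, where $M_1\equiv\dots\equiv M_{k-1}\equiv0$ and $M_k\not\equiv0$. (The number of positive zeros of $M_k$ does not depend on the choice of the section and its analytic parametrization.) *)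

(* Defs.v *)
From HB Require Import structures.
From mathcomp Require Import all_boot all_order all_algebra.
From mathcomp Require Import polyXY.
From mathcomp Require Import all_classical all_reals all_analysis.

Set Implicit Arguments.
Unset Strict Implicit.
Unset Printing Implicit Defensive.

Import Order.TTheory GRing.Theory Num.Theory.
Import numFieldNormedType.Exports.

Local Open Scope classical_set_scope.
Local Open Scope ring_scope.

(* A real polynomial in x and y is an element p of {poly {poly R}}, evaluated
   as p.[x, y] = p.[x%:P].[y]; p`_i`_j is the coefficient of x^i y^j. *)
Definition deg_le (R : realType) (n : nat) (p : {poly {poly R}}) : Prop :=
  forall i j : nat, p`_i`_j != 0 -> (i + j <= n)%N.

(* The natural-number exponents do not truncate when s1, s2 >= 1. *)
Definition quasi_homogeneous (R : realType) (s1 s2 m : nat)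
    (P Q : {poly {poly R}}) : Prop :=
  forall lam x y : R, 0 < lam ->
    P.[lam ^+ s1 * x, lam ^+ s2 * y] = lam ^+ (s1 + m - 1)%N * P.[x, y] /\
    Q.[lam ^+ s1 * x, lam ^+ s2 * y] = lam ^+ (s2 + m - 1)%N * Q.[x, y].

(* The derivatives are two-sided: a solution on `[0, T] extends beyond 0 and T. *)
Definition solution_on (R : realType) (D : set R) (F G : R -> R -> R)
    (x y : R -> R) : Prop :=
  forall t : R, D t ->
    is_derive t 1 x (F (x t) (y t)) /\ is_derive t 1 y (G (x t) (y t)).

(* The origin is a singular point having a neighbourhood which consists, besides
   the origin itself, of non-constant periodic orbits. *)
Definition center_at_origin (R : realType) (F G : R -> R -> R) : Prop :=
  [/\ F 0 0 = 0, G 0 0 = 0 &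
    exists2 U : set (R * R), open_nbhs (0, 0) U &
      forall a b : R, U (a, b) -> (a, b) <> (0, 0) ->
        exists x y : R -> R, exists2 T : R, 0 < T &
          [/\ solution_on setT F G x y,
              x 0 = a /\ y 0 = b,
              forall t, x (t + T) = x t /\ y (t + T) = y t,
              exists t, (x t, y t) <> (a, b) &
              forall t, U (x t, y t) /\ (x t, y t) <> (0, 0)]].

(* Only the terms p i with i >= 1 of the family p matter. *)
Definition analytic_perturbation (R : realType)
    (p : nat -> {poly {poly R}}) : Prop :=
  exists2 rho : R, 0 < rho &
    forall eps x y : R, `|eps| < rho ->
      cvgn (fun N => \sum_(1 <= i < N) eps ^+ i * (p i).[x, y]).

Definition perturbed (R : realType) (P : {poly {poly R}})
    (p : nat -> {poly {poly R}}) (eps : R) : R -> R -> R :=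
  fun x y =>
    P.[x, y] + limn (fun N => \sum_(1 <= i < N) eps ^+ i * (p i).[x, y]).

Definition section_x (R : realType) (s1 s2 : nat) (h : R) : R :=
  s1%:R `^ (- (2 * s2)%N%:R^-1) * h ^+ s1.

(* The point of parameter h of the positive x-half-axis returns to this half-axis
   for the first time in positive time, at the point of parameter h'. *)
Definition first_return (R : realType) (s1 s2 : nat) (F G : R -> R -> R)
    (h h' : R) : Prop :=
  0 < h' /\
  exists x y : R -> R, exists2 T : R, 0 < T &
    [/\ solution_on `[0, T] F G x y,
        x 0 = section_x s1 s2 h /\ y 0 = 0,
        x T = section_x s1 s2 h' /\ y T = 0 &
        forall t, 0 < t < T -> ~ (0 < x t /\ y t = 0)].

(* M i, for i >= 1, is the coefficient of eps^i in the expansion of the first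
   return map; the value of M at 0 plays no role. *)
Definition melnikov_functions (R : realType) (s1 s2 : nat)
    (P Q : {poly {poly R}}) (p q : nat -> {poly {poly R}})
    (M : nat -> R -> R) : Prop :=
  forall a b : R, 0 < a -> a <= b ->
    exists2 eps0 : R, 0 < eps0 &
      forall h eps : R, a <= h <= b -> `|eps| < eps0 ->
        exists2 h' : R,
          first_return s1 s2 (perturbed P p eps) (perturbed Q q eps) h h' &
          h + \sum_(1 <= i < N) eps ^+ i * M i h @[N --> \oo] --> h'.

Definition first_nonvanishing (R : realType) (M : nat -> R -> R) (k : nat)
    : Prop :=
  [/\ (0 < k)%N,
      forall (i : nat) (h : R), (0 < i < k)%N -> 0 < h -> M i h = 0 &
      exists2 h : R, 0 < h & M k h <> 0].

Definition Kbound (k n s1 s2 : nat) : rat :=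
  let w : rat := k%:R * ((n + 1)%N%:R * s1%:R - s2%:R) in
  if [|| [&& ~~ odd n, odd k, odd s1 & odd s2],
         ~~ odd k && odd (s1 + s2)%N
       | [&& ~~ odd s2, odd k, odd s1 & odd n]] then w / 2 - 1
  else if [&& ~~ odd k, odd s1 & odd s2] then w / 2
  else (w - 1) / 2.

(* Main.v *)
Require Import Defs.
From HB Require Import structures.
From mathcomp Require Import all_boot all_order all_algebra.
From mathcomp Require Import polyXY finmap.
From mathcomp Require Import all_classical all_reals all_analysis.
From mathcomp Require Import ring lra zify.

Set Implicit Arguments.
Unset Strict Implicit.
Unset Printing Implicit Defensive.

Import Order.TTheory GRing.Theory Num.Theory.
Import numFieldNormedType.Exports.

Local Open Scope classical_set_scope.
Local Open Scope ring_scope.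

(* In the weighted polar coordinates x = L^s1 cos t, y = L^s2 sin t the
   perturbed system is dL/dt = L A/B, where A and B are polynomials in L of
   degree at most W = (n+1) s1 - s2 at each positive order in eps and multiples
   of L^e, e = s1 + m - 1, at order 0; the center makes the angular part B
   nonvanishing at order 0. With eps = delta l^e and L = l r(t) u, r being the
   unperturbed orbit, a formal solution u in powers of delta is found by
   successive quadratures, the coefficient of delta^j being a polynomial in the
   initial value l of degree at most W j. By Gronwall the true orbit follows its
   truncation up to O(eps^(k+1)), so M_k is, up to constants, l^(1 - e k) f(l)
   with f of degree at most W k. The symmetry
   (L, (x, y)) -> (-L, ((-1)^s1 x, (-1)^s2 y)) of the equation forces the
   exponents of f to have one and the same parity, which halves the number of
   its positive zeros. *)

(** * Calculus on the line *)

(** The Melnikov functions are given only through some first return orbit for each small eps. So no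
    flow is constructed and no analytic dependence on eps is proved: each given orbit is compared
    directly with an explicit approximation, and coefficients are identified afterwards. The
    substitution eps = delta l^e keeps everything polynomial: up to powers of r and u, the term
    eps^i L^j becomes, after division by l^e, delta^i l^(e (i - 1) + j), and this exponent is at
    most W i because e <= W, which is where m <= n enters. A true orbit has a positive radius,
    whereas the symmetry exchanges L and -L; the parity is therefore proved on the approximate
    solutions, which make sense for both signs of l. The reflection may also move the initial angle
    and reverse the direction of rotation, so these solutions have to be controlled over two turns
    and not only one. *)

Section Calculus.
Variable R : realType.
Implicit Types (f g df : R -> R) (a b x t : R).

Lemma derive_cstf a x : is_derive x 1 (fun=> a) 0.
Proof. exact: is_derive_cst. Qed.

Lemma derive_idf x : is_derive x 1 (fun z : R => z) 1.
Proof. exact: is_derive_id. Qed.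

Lemma derive_eqf f a b x : is_derive x 1 f a -> a = b -> is_derive x 1 f b.
Proof. by move=> df <-. Qed.

Lemma derive_addf f g a b x : is_derive x 1 f a -> is_derive x 1 g b ->
  is_derive x 1 (fun z => f z + g z) (a + b).
Proof. by move=> df dg; exact: is_deriveD. Qed.

Lemma derive_oppf f a x : is_derive x 1 f a ->
  is_derive x 1 (fun z => - f z) (- a).
Proof. by move=> df; exact: is_deriveN. Qed.

Lemma derive_mulf f g a b x : is_derive x 1 f a -> is_derive x 1 g b ->
  is_derive x 1 (fun z => f z * g z) (f x * b + g x * a).
Proof. by move=> df dg; exact: is_deriveM. Qed.

Lemma derive_expf f a n x : is_derive x 1 f a ->
  is_derive x 1 (fun z => f z ^+ n) (n%:R * f x ^+ n.-1 * a).
Proof.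
move=> df.
elim: n => [|n IH].
  by apply: (derive_eqf (derive_cstf 1 x)); rewrite mul0r mul0r.
have -> : (fun z => f z ^+ n.+1) = (fun z => f z * f z ^+ n).
  by apply/funext => z; rewrite exprS.
apply: (derive_eqf (derive_mulf df IH)).
case: n {IH} => [|n] /=; first by rewrite expr0; ring.
by rewrite -[n.+2%:R]natr1 exprS; ring.
Qed.

Lemma derive_invf f a x : f x != 0 -> is_derive x 1 f a ->
  is_derive x 1 (fun z => (f z)^-1) (- (f x ^- 2 * a)).
Proof.
move=> f0 df; apply: (derive_eqf (is_deriveV f0 df)).
by rewrite scaleNr.
Qed.

Lemma derive_compf f g a b x : is_derive (g x) 1 f a -> is_derive x 1 g b ->
  is_derive x 1 (fun z => f (g z)) (a * b).
Proof. by move=> df dg; exact: is_derive1_comp. Qed.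

Lemma derive_sumf (I : eqType) (r : seq I) (f d : I -> R -> R) x :
  (forall i, is_derive x 1 (f i) (d i x)) ->
  is_derive x 1 (fun z => \sum_(i <- r) f i z) (\sum_(i <- r) d i x).
Proof.
move=> df; elim: r => [|i r IH].
  rewrite big_nil; under eq_fun do rewrite big_nil; exact: derive_cstf.
rewrite big_cons; under eq_fun do rewrite big_cons; exact: derive_addf.
Qed.

Lemma derive_continuous f a x : is_derive x 1 f a -> {for x, continuous f}.
Proof. by move=> [df _]; apply/differentiable_continuous/derivable1_diffP. Qed.

Lemma derive_segment_continuous f df a b :
  (forall t, a <= t <= b -> is_derive t 1 f (df t)) ->
  {within `[a, b], continuous f}.
Proof.
move=> H; apply: derivable_within_continuous => t; rewrite in_itv /= => tab.
by case: (H t tab).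
Qed.

Lemma derive_MVT f df a b : a <= b ->
  (forall t, a <= t <= b -> is_derive t 1 f (df t)) ->
  exists2 c, a <= c <= b & f b - f a = df c * (b - a).
Proof.
move=> ab H; have [||c] := @MVT_segment R f df a b ab.
- move=> t; rewrite in_itv /= => /andP[at_ tb]; apply: H.
  by rewrite !ltW.
- exact: derive_segment_continuous H.
by rewrite in_itv /= => cab ->; exists c.
Qed.

Lemma derive_ge0_le f df a b : a <= b ->
  (forall t, a <= t <= b -> is_derive t 1 f (df t)) ->
  (forall t, a <= t <= b -> 0 <= df t) -> f a <= f b.
Proof.
move=> ab H H0; have [c cab e] := derive_MVT ab H.
by rewrite -subr_ge0 e mulr_ge0 ?subr_ge0 // H0.
Qed.

Lemma derive_gt0_lt f df a b : a < b ->
  (forall t, a <= t <= b -> is_derive t 1 f (df t)) ->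
  (forall t, a <= t <= b -> 0 < df t) -> f a < f b.
Proof.
move=> ab H H0; have [c cab e] := derive_MVT (ltW ab) H.
by rewrite -subr_gt0 e mulr_gt0 ?subr_gt0 // H0.
Qed.

Lemma derive_eq0_cst f a b : a <= b ->
  (forall t, a <= t <= b -> is_derive t 1 f 0) -> f b = f a.
Proof.
move=> ab H; have [c cab e] := derive_MVT (df := fun=> 0) ab H.
by apply/eqP; rewrite -subr_eq0 e mul0r.
Qed.

Lemma continuous_segment_bounded f a b : continuous f ->
  exists2 C, 0 < C & forall t, a <= t <= b -> `|f t| <= C.
Proof.
move=> cf; have [ab|ba] := leP a b; last first.
  exists 1 => // t /andP[at_ tb]; have := le_trans at_ tb.
  by rewrite leNgt ba.
have [|c _ Hc] := @EVT_max R (fun t => `|f t|) a b ab.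
  apply: continuous_subspaceT => t; apply: continuous_comp; first exact: cf.
  exact: norm_continuous.
exists (`|f c| + 1) => [|t tab]; first by rewrite ltr_wpDl.
by rewrite (le_trans (Hc t _)) ?lerDl // in_itv.
Qed.

Lemma continuous_segment_gt0 f a b : continuous f ->
  (forall t, a <= t <= b -> 0 < f t) ->
  exists2 c, 0 < c & forall t, a <= t <= b -> c <= f t.
Proof.
move=> cf f0; have [ab|ba] := leP a b; last first.
  exists 1 => // t /andP[at_ tb]; have := le_trans at_ tb.
  by rewrite leNgt ba.
have [|c cab Hc] := @EVT_min R f a b ab; first exact: continuous_subspaceT.
exists (f c) => [|t tab]; first by apply: f0; rewrite in_itv /= in cab.
by apply: Hc; rewrite in_itv.
Qed.

Lemma primitive_right f a : continuous f ->
  exists F : R -> R, forall x, a < x -> is_derive x 1 F (f x).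
Proof.
move=> cf; exists (fun x => \int[@lebesgue_measure R]_(t in `[a, x]) f t)%R => x ax.
have [||| d e] := @continuous_FTC1_closed R f a x (x + 1) _ _ _ (cf x) => //.
- by rewrite ltrDl.
- apply: continuous_compact_integrable; first exact: segment_compact.
  exact: continuous_subspaceT.
by rewrite derive1E in e; rewrite -e; exact: derivableP.
Qed.

(** An integral over [[a, x]] serves only to the right of [a], so no single base point gives a
    primitive on the whole line. The base recedes with [x] instead; primitives from different bases
    agree once they are normalised to vanish at 0. *)
Lemma primitive_exists f : continuous f ->
  exists F : R -> R, F 0 = 0 /\ forall x, is_derive x 1 F (f x).
Proof.
move=> cf; have /choice[P HP] := fun a => @primitive_right f a cf.
pose Q M x := P M x - P M 0.
have QP M x : M < x -> is_derive x 1 (Q M) (f x).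
  move=> Mx.
  exact: (derive_eqf (derive_addf (HP M x Mx) (derive_cstf (- P M 0) x)) (addr0 _)).
have QQ M N x : M < 0 -> N < 0 -> M < x -> N < x -> Q M x = Q N x.
  move=> M0 N0 Mx Nx.
  have D t : M < t -> N < t -> is_derive t 1 (fun z => Q M z - Q N z) 0.
    move=> Mt Nt.
    exact: (derive_eqf (derive_addf (QP M t Mt) (derive_oppf (QP N t Nt))) (subrr _)).
  have E : Q M 0 - Q N 0 = 0 by rewrite /Q !subrr.
  apply/eqP; rewrite -subr_eq0 -E; apply/eqP.
  have [x0|x0] := leP 0 x.
    apply: (@derive_eq0_cst (fun z => Q M z - Q N z)) => // t /andP[t0 _].
    by apply: D; apply: lt_le_trans t0.
  symmetry; apply: (@derive_eq0_cst (fun z => Q M z - Q N z)) => [|t /andP[tx _]].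
    exact: ltW.
  by apply: D; apply: lt_le_trans tx.
exists (fun x => Q (- (`|x| + 1)) x); split; first by rewrite /Q subrr.
move=> x; have Hx : - (`|x| + 2) < x.
  by have := ler_norm (- x); rewrite normrN; lra.
apply: (near_eq_is_derive _ (QP _ x Hx)); rewrite ?oner_neq0 //.
near=> y.
have yx : `|y - x| < 1.
  near: y; apply/nbhs_ballP; exists 1 => //= y; rewrite -ball_normE /= distrC.
  by [].
have [y1 y2] : `|x| - 1 < `|y| /\ `|y| < `|x| + 1.
  have A1 := ler_normD (y - x) x; have A2 := ler_normD (x - y) y.
  rewrite subrK in A1; rewrite subrK distrC in A2; lra.
have := ler_norm (- y); have := ler_norm (- x); rewrite !normrN.
have := normr_ge0 x; have := normr_ge0 y => *.
apply: QQ; lra.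
Unshelve. all: by end_near. Qed.

Lemma cont_addf f g x : {for x, continuous f} -> {for x, continuous g} ->
  {for x, continuous (fun z => f z + g z)}.
Proof. by move=> cf cg; exact: continuousD. Qed.

Lemma cont_oppf f x : {for x, continuous f} -> {for x, continuous (fun z => - f z)}.
Proof. by move=> cf; exact: continuousN. Qed.

Lemma cont_mulf f g x : {for x, continuous f} -> {for x, continuous g} ->
  {for x, continuous (fun z => f z * g z)}.
Proof. by move=> cf cg; exact: continuousM. Qed.

Lemma cont_invf f x : f x != 0 -> {for x, continuous f} ->
  {for x, continuous (fun z => (f z)^-1)}.
Proof. by move=> f0 cf; exact: continuousV. Qed.

Lemma cont_cstf a x : {for x, continuous (fun=> a)}.
Proof. exact: cvg_cst. Qed.

Lemma cont_expf f n x : {for x, continuous f} -> {for x, continuous (fun z => f z ^+ n)}.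
Proof.
move=> cf; apply: (@continuous_comp _ _ _ f (fun z => z ^+ n)) => //.
exact: exprn_continuous.
Qed.

Lemma cont_compf f g x : {for x, continuous g} -> {for g x, continuous f} ->
  {for x, continuous (fun z => f (g z))}.
Proof. by move=> cg cf; exact: continuous_comp. Qed.

Lemma cont_sumf (I : Type) (r : seq I) (f : I -> R -> R) x :
  (forall i, {for x, continuous (f i)}) ->
  {for x, continuous (fun z => \sum_(i <- r) f i z)}.
Proof.
move=> cf; change (continuous_at x (fun z => \sum_(i <- r) f i z)).
elim: r => [|i r IH].
  by under eq_fun do rewrite big_nil; exact: cont_cstf.
by under eq_fun do rewrite big_cons; apply: cont_addf.
Qed.

End Calculus.

(** * First exit times and a Gronwall inequality with a variable clock *)

Section Gronwall.
Variable R : realType.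

Lemma continuous_near_gt (f : R -> R) (x c : R) : {for x, continuous f} ->
  c < f x -> exists2 e, 0 < e & forall y, `|y - x| < e -> c < f y.
Proof.
move=> cf cfx; have /cf : nbhs (f x) [set y | c < y] by exact: lt_nbhsr.
move=> /nbhs_ballP[e /= e0 He]; exists e => // y yx; apply: He.
by rewrite -ball_normE /= distrC.
Qed.

Lemma continuous_near_lt (f : R -> R) (x c : R) : {for x, continuous f} ->
  f x < c -> exists2 e, 0 < e & forall y, `|y - x| < e -> f y < c.
Proof.
move=> cf cfx; have /cf : nbhs (f x) [set y | y < c] by exact: lt_nbhsl.
move=> /nbhs_ballP[e /= e0 He]; exists e => // y yx; apply: He.
by rewrite -ball_normE /= distrC.
Qed.

Lemma near_dist_lt (x e : R) : 0 < e -> \forall y \near x, `|y - x| < e.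
Proof.
move=> e0; apply/nbhs_ballP; exists e => // y.
by rewrite -ball_normE /= distrC.
Qed.

(** The zero is the infimum of the times at which [f] is nonnegative; continuity there excludes both
    signs. This serves continuation arguments: [f] encodes a region, and its first zero is the exit
    time. *)
Lemma first_zero (f : R -> R) (T : R) :
  (forall t, 0 <= t <= T -> {for t, continuous f}) -> f 0 < 0 ->
  (forall t, 0 <= t <= T -> f t < 0) \/
  exists T1, [/\ 0 < T1, T1 <= T, f T1 = 0 & forall t, 0 <= t < T1 -> f t < 0].
Proof.
move=> cf f0.
have [H|] := pselect (forall t, 0 <= t <= T -> f t < 0); first by left.
move=> /existsNP[t0 /not_implyP[/andP[t00 t0T] /negP ft0]]; right.
rewrite -leNgt in ft0.
pose B := [set t | 0 <= t <= T /\ 0 <= f t].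
have B0 : B t0 by rewrite /B /= t00 t0T.
have Binf : has_inf B.
  by split; [exists t0 | exists 0 => t [/andP[]]].
have lB t : B t -> inf B <= t by apply: ge_inf; exists 0 => s [/andP[]].
have i0 : 0 <= inf B.
  by apply: lb_le_inf; [exists t0 | move=> s [/andP[]]].
have iT : inf B <= T by apply: le_trans (lB _ B0) t0T.
have ci := cf (inf B); rewrite i0 iT in ci; have {}ci := ci isT.
have Hlt t : 0 <= t < inf B -> f t < 0.
  move=> /andP[t1 t2]; rewrite ltNge; apply/negP => ft.
  have : B t by rewrite /B /= t1 (le_trans (ltW t2) iT).
  by move=> /lB; rewrite leNgt t2.
have fi : 0 <= f (inf B).
  rewrite leNgt; apply/negP => /(continuous_near_lt ci)[e e0 He].
  have [s Bs si] := inf_adherent e0 Binf.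
  have := He s; rewrite ger0_norm ?subr_ge0 ?lB // ltrBlDl => /(_ si).
  by case: Bs => _; rewrite leNgt => /negP.
have i0' : 0 < inf B.
  by rewrite lt_neqAle i0 andbT; apply/eqP => ie; rewrite -ie leNgt f0 in fi.
exists (inf B); split => //; apply/eqP; rewrite eq_le fi andbT leNgt.
apply/negP => /(continuous_near_gt ci)[e e0 He].
pose s := Num.max 0 (inf B - e / 2).
have s1 : 0 <= s by rewrite /s le_max lexx.
have s2 : s < inf B by rewrite /s gt_max i0' /=; lra.
have s3 : inf B - e / 2 <= s by rewrite /s le_max lexx orbT.
have := Hlt s; rewrite s1 s2 => /(_ isT) /ltW; rewrite leNgt He //.
by rewrite ltr_norml; apply/andP; split; lra.
Qed.

(** The quantity (E^2 + eta^2) exp(- c p) does not increase when c = 2 K + 1, because 2 |E| (K |E| +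
    eta) <= c (E^2 + eta^2); squares avoid differentiating |E|. The function [p] replaces time as
    the clock. The case [eta = 0] is allowed and gives uniqueness. *)
Lemma gronwall (E dE p dp : R -> R) (K eta T : R) :
  0 <= T -> 0 <= K -> 0 <= eta ->
  (forall t, 0 <= t <= T -> is_derive t 1 E (dE t)) ->
  (forall t, 0 <= t <= T -> is_derive t 1 p (dp t)) ->
  (forall t, 0 <= t <= T -> 0 <= dp t) ->
  (forall t, 0 <= t <= T -> `|dE t| <= dp t * (K * `|E t| + eta)) ->
  E 0 = 0 ->
  `|E T| <= eta * expR ((2 * K + 1) * (p T - p 0)).
Proof.
move=> T0 K0 eta0 HE Hp dp0 HdE E0; pose c := 2 * K + 1.
pose ex t := expR (- c * p t).
have Hex t : 0 <= t <= T -> is_derive t 1 ex (ex t * (- c * dp t)).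
  move=> tT; have H := derive_mulf (derive_cstf (- c) t) (Hp t tT).
  by apply: (derive_eqf (derive_compf (is_derive_expR _) H)); rewrite /ex; ring.
pose V t := - (E t * E t + eta ^+ 2) * ex t.
have HV : V 0 <= V T.
  apply: (@derive_ge0_le _ V (fun t => - (E t * E t + eta ^+ 2) * (ex t * (- c * dp t))
     + ex t * - (E t * dE t + E t * dE t + 0))) => // t tT.
    exact: (derive_mulf (derive_oppf (derive_addf
      (derive_mulf (HE t tT) (HE t tT)) (derive_cstf _ t))) (Hex t tT)).
  have ex0 : 0 <= ex t := expR_ge0 _.
  have -> : - (E t * E t + eta ^+ 2) * (ex t * (- c * dp t)) +
      ex t * - (E t * dE t + E t * dE t + 0) =
      ex t * (c * dp t * (E t * E t + eta ^+ 2) - 2 * (E t * dE t)) by ring.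
  rewrite mulr_ge0 // subr_ge0.
  have A1 : E t * dE t <= `|E t| * (dp t * (K * `|E t| + eta)).
    apply: le_trans (ler_norm _) _; rewrite normrM ler_wpM2l //; exact: HdE.
  have A2 : E t * E t = `|E t| * `|E t| by rewrite -normrM -expr2 ger0_norm ?sqr_ge0.
  have A3 := dp0 _ tT; rewrite A2.
  have A4 : 0 <= dp t * (2 * K * eta ^+ 2 + (`|E t| - eta) ^+ 2).
    by rewrite mulr_ge0 // addr_ge0 ?sqr_ge0 // mulr_ge0 ?sqr_ge0 // mulr_ge0.
  by rewrite /c; nra.
move: HV; rewrite /V E0 mul0r add0r !mulNr lerN2 => HV.
have D0 : 0 <= p T - p 0.
  by rewrite subr_ge0; apply: (derive_ge0_le T0 Hp).
set D := expR _.
have D1 : 1 <= D by rewrite /D -expR0 ler_expR mulr_ge0 // addr_ge0 ?mulr_ge0.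
have HD : ex 0 = D * ex T by rewrite /ex /D -expRD; congr expR; rewrite /c; ring.
rewrite HD mulrA ler_pM2r ?expR_gt0 // in HV.
rewrite -ler_sqr ?nnegrE ?mulr_ge0 // ?(le_trans ler01) //.
rewrite -normrX ger0_norm ?sqr_ge0 // exprMn.
apply: le_trans (_ : eta ^+ 2 * D <= _).
  by apply: le_trans HV; rewrite expr2 lerDl sqr_ge0.
by rewrite ler_wpM2l ?sqr_ge0 // expr2 ler_peMr // (le_trans ler01).
Qed.

(* [q] is the speed of the orbit; both a true orbit and an approximate solution
   parametrised by the angle itself are compared in this form. *)
Lemma orbit_compare (L p dL dp q X Y : R -> R) (Z dZ : R -> R) (K C c eta T : R) :
  0 <= T -> 0 <= K -> 0 <= C -> 0 < c -> 0 <= eta ->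
  (forall t, 0 <= t <= T -> is_derive t 1 L (dL t)) ->
  (forall t, 0 <= t <= T -> is_derive t 1 p (dp t)) ->
  (forall t, 0 <= t <= T -> is_derive (p t) 1 Z (dZ t)) ->
  (forall t, 0 <= t <= T -> `|dL t - q t * X t| <= `|q t| * eta) ->
  (forall t, 0 <= t <= T -> `|dp t - q t * Y t| <= `|q t| * eta) ->
  (forall t, 0 <= t <= T -> c * `|q t| <= dp t) ->
  (forall t, 0 <= t <= T -> `|dZ t| <= C) ->
  (forall t, 0 <= t <= T -> `|X t - dZ t * Y t| <= K * `|L t - Z (p t)| + eta) ->
  L 0 = Z (p 0) ->
  `|L T - Z (p T)| <= (2 + C) / c * eta * expR ((2 * (K / c) + 1) * (p T - p 0)).
Proof.
move=> T0 K0 C0 c0 eta0 HL Hp HZ dLX dpY cq dZC XY L0.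
apply: (@gronwall (fun t => L t - Z (p t)) (fun t => dL t - dZ t * dp t) p dp) => //.
- by rewrite divr_ge0 // ltW.
- by rewrite mulr_ge0 // divr_ge0 ?addr_ge0 // ltW.
- move=> t tT; 
  exact: (derive_addf (HL t tT) (derive_oppf (derive_compf (HZ t tT) (Hp t tT)))).
- by move=> t tT; apply: le_trans (cq t tT); rewrite mulr_ge0 // ltW.
- move=> t tT.
  have -> : dL t - dZ t * dp t =
    (dL t - q t * X t) - dZ t * (dp t - q t * Y t) + q t * (X t - dZ t * Y t) by ring.
  have B1 : `|dZ t * (dp t - q t * Y t)| <= C * (`|q t| * eta).
    by rewrite normrM ler_pM // ?dZC // dpY.
  have B2 : `|q t * (X t - dZ t * Y t)| <= `|q t| * (K * `|L t - Z (p t)| + eta).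
    by rewrite normrM ler_wpM2l // XY.
  apply: le_trans (ler_normD _ _) _.
  apply: le_trans (lerD (ler_normB _ _) (lexx _)) _.
  apply: le_trans (lerD (lerD (dLX t tT) B1) B2) _.
  have -> : `|q t| * eta + C * (`|q t| * eta) + `|q t| * (K * `|L t - Z (p t)| + eta)
     = c * `|q t| * (K / c * `|L t - Z (p t)| + (2 + C) / c * eta).
    by field; rewrite gt_eqF.
  rewrite ler_wpM2r ?cq // addr_ge0 // mulr_ge0 // ?divr_ge0 // ?addr_ge0 // ltW //.
by rewrite L0 subrr.
Qed.

End Gronwall.

(** * Polar lift of a plane curve *)

Section PolarLift.
Variable R : realType.

(** Here [a] stands for the inverse 1/L of the weighted radius, the number that puts (x a^s1, y
    a^s2) on the unit circle. Monotonicity makes it unique. *)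
Lemma weighted_circle_incr (s1 s2 : nat) (x y a b : R) :
  (0 < s1)%N -> (0 < s2)%N -> (x, y) <> (0, 0) -> 0 <= a -> a < b ->
  x ^+ 2 * a ^+ (2 * s1) + y ^+ 2 * a ^+ (2 * s2) <
  x ^+ 2 * b ^+ (2 * s1) + y ^+ 2 * b ^+ (2 * s2).
Proof.
move=> s1p s2p xy a0 ab.
have H n : (0 < n)%N -> a ^+ (2 * n) < b ^+ (2 * n).
  by move=> n0; rewrite ltrXn2r // ?nnegrE // ?(le_trans a0 (ltW ab)) // muln_eq0 -lt0n.
have [x0|x0] := eqVneq x 0.
  have y0 : y != 0 by apply/eqP => y0; apply: xy; rewrite x0 y0.
  by rewrite x0 expr0n /= !mul0r !add0r ltr_pM2l ?H // exprn_even_gt0.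
apply: ltr_leD; first by rewrite ltr_pM2l ?H // exprn_even_gt0.
by rewrite ler_wpM2l ?sqr_ge0 // ltW // H.
Qed.

Lemma weighted_circle_exists (s1 s2 : nat) (x y : R) :
  (0 < s1)%N -> (0 < s2)%N -> (x, y) <> (0, 0) ->
  exists2 a, 0 < a & x ^+ 2 * a ^+ (2 * s1) + y ^+ 2 * a ^+ (2 * s2) = 1.
Proof.
move=> s1p s2p xy.
pose f a := x ^+ 2 * a ^+ (2 * s1) + y ^+ 2 * a ^+ (2 * s2).
have cf : continuous f.
  move=> a; apply: (@cont_addf R (fun z => _ * z ^+ _) (fun z => _ * z ^+ _)).
    by apply: cont_mulf; [exact: cont_cstf|exact: exprn_continuous].
  by apply: cont_mulf; [exact: cont_cstf|exact: exprn_continuous].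
pose r := x ^+ 2 + y ^+ 2.
have r0 : 0 < r.
  have := sqr_ge0 x; have := sqr_ge0 y; rewrite /r => Hy Hx.
  rewrite lt_neqAle addr_ge0 // andbT eq_sym; apply/eqP => /eqP.
  rewrite paddr_eq0 // !sqrf_eq0 => /andP[/eqP x0 /eqP y0].
  by apply: xy; rewrite x0 y0.
(* As b >= 1, every power b^(2 s) is at least b, so [f b] is at least r b = r + 1 and the value 1 is
   crossed before [b]. *)
pose b := 1 + r^-1.
have b1 : 1 <= b by rewrite lerDl invr_ge0 ltW.
have f0 : f 0 = 0 by rewrite /f !expr0n !muln_eq0 /= !eqn0Ngt s1p s2p /= !mulr0 addr0.
have fb : 1 <= f b.
  have H n : (0 < n)%N -> b <= b ^+ (2 * n).
    by move=> n0; rewrite ler_eXnr // muln_gt0.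
  have : r * b <= f b.
    by rewrite /r /f mulrDl lerD // ler_wpM2l ?sqr_ge0 ?H.
  by apply: le_trans; rewrite /b mulrDr mulr1 divff ?gt_eqF // lerDr ltW.
have [||a a0b fa] := @IVT R f 0 b 1 (le_trans ler01 b1).
- exact: continuous_subspaceT.
- by rewrite f0 ge_min le_max ler01 fb orbT.
exists a; last exact: fa.
rewrite in_itv /= in a0b; case/andP: a0b => a0 _.
rewrite lt_neqAle a0 andbT; apply/eqP => a00.
by move: fa; rewrite -a00 f0 => /eqP; rewrite eq_sym oner_eq0.
Qed.

Lemma weighted_circle_inj (s1 s2 : nat) (x y a b : R) :
  (0 < s1)%N -> (0 < s2)%N -> (x, y) <> (0, 0) -> 0 < a -> 0 < b ->
  x ^+ 2 * a ^+ (2 * s1) + y ^+ 2 * a ^+ (2 * s2) =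
  x ^+ 2 * b ^+ (2 * s1) + y ^+ 2 * b ^+ (2 * s2) -> a = b.
Proof.
move=> s1p s2p xy a0 b0 e; case: (ltgtP a b) => // ab.
- by have := weighted_circle_incr s1p s2p xy (ltW a0) ab; rewrite e ltxx.
- by have := weighted_circle_incr s1p s2p xy (ltW b0) ab; rewrite e ltxx.
Qed.

Lemma pair_neq0_near (x y : R -> R) t :
  {for t, continuous x} -> {for t, continuous y} ->
  (x t, y t) <> (0, 0) -> \forall z \near t, (x z, y z) <> (0, 0).
Proof.
move=> cx cy xy.
have c : {for t, continuous (fun z => x z ^+ 2 + y z ^+ 2)}.
  by apply: cont_addf; apply: cont_expf.
have r0 : 0 < x t ^+ 2 + y t ^+ 2.
  rewrite lt_neqAle addr_ge0 ?sqr_ge0 // andbT eq_sym; apply/eqP => /eqP.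
  rewrite paddr_eq0 ?sqr_ge0 // !sqrf_eq0 => /andP[/eqP x0 /eqP y0].
  by apply: xy; rewrite x0 y0.
have [e e0 He] := continuous_near_gt c r0.
apply/nbhs_ballP; exists e => // z; rewrite /= -ball_normE /= distrC => /He.
by move=> H [x0 y0]; move: H; rewrite x0 y0 expr0n /= addr0 ltxx.
Qed.

(* Carathéodory's form of the derivative turns the implicit equation into an
   explicit formula for the slope of [nu]. *)
Lemma weighted_circle_derivable (s1 s2 : nat) (x y nu : R -> R) (t dx dy : R) :
  (0 < s1)%N -> (0 < s2)%N ->
  is_derive t 1 x dx -> is_derive t 1 y dy -> (x t, y t) <> (0, 0) ->
  (forall z, (x z, y z) <> (0, 0) -> 0 < nu z /\
     x z ^+ 2 * nu z ^+ (2 * s1) + y z ^+ 2 * nu z ^+ (2 * s2) = 1) ->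
  exists d, is_derive t 1 nu d.
Proof.
move=> s1p s2p Hx Hy xy Hnu.
have cx := derive_continuous Hx; have cy := derive_continuous Hy.
pose G z := x z ^+ 2 * nu t ^+ (2 * s1) + y z ^+ 2 * nu t ^+ (2 * s2).
have [nut Gt1] := Hnu t xy.
have /is_derive1_caratheodory[gG [HG cG _]] : is_derive t 1 G _ :=
  derive_addf (derive_mulf (derive_expf 2 Hx) (derive_cstf _ _))
              (derive_mulf (derive_expf 2 Hy) (derive_cstf _ _)).
pose S n z := \sum_(i < 2 * n) nu z ^+ ((2 * n).-1 - i) * nu t ^+ i.
pose K z := x z ^+ 2 * S s1 z + y z ^+ 2 * S s2 z.
(* [k] is a lower bound of [K] that does not involve [nu z]: it is continuous before anything is
   known about [nu], and so yields the continuity of [nu] at [t]. *)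
pose k z := x z ^+ 2 * nu t ^+ (2 * s1).-1 + y z ^+ 2 * nu t ^+ (2 * s2).-1.
have key z : (x z, y z) <> (0, 0) -> (nu z - nu t) * K z = - gG z * (z - t).
  move=> /Hnu[_ e]; rewrite mulNr -HG /K mulrDr.
  rewrite mulrCA -subrXX [(_ - _) * (_ ^+ 2 * _)]mulrCA -subrXX.
  rewrite /G in Gt1 *; rewrite Gt1 -{1}e; ring.
have SS n z : (0 < n)%N -> (x z, y z) <> (0, 0) -> nu t ^+ (2 * n).-1 <= S n z.
  move=> n0 /Hnu[nz _]; rewrite /S; have n2 : (0 < 2 * n)%N by rewrite muln_gt0.
  rewrite -(prednK n2) big_ord_recr /= subnn expr0 mul1r lerDr sumr_ge0 // => i _.
  by rewrite mulr_ge0 // exprn_ge0 // ltW.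
have kK z : (x z, y z) <> (0, 0) -> k z <= K z.
  by move=> xz; rewrite lerD // ler_wpM2l ?sqr_ge0 // SS.
have kt : 0 < k t.
  have H n : 0 < nu t ^+ (2 * n).-1 by rewrite exprn_gt0.
  have [x0|x0] := eqVneq (x t) 0.
    have y0 : y t != 0 by apply/eqP => y0; apply: xy; rewrite x0 y0.
    apply: ltr_wpDl; first by rewrite mulr_ge0 ?sqr_ge0 ?(ltW (H _)).
    by rewrite mulr_gt0 // exprn_even_gt0.
  apply: ltr_wpDr; first by rewrite mulr_ge0 ?sqr_ge0 ?(ltW (H _)).
  by rewrite mulr_gt0 // exprn_even_gt0.
have ck : {for t, continuous k}.
  by apply: cont_addf; apply: cont_mulf; try apply: cont_expf => //; apply: cont_cstf.
have near0 := pair_neq0_near cx cy xy.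
have cnu : {for t, continuous nu}.
  pose h z := `|gG z * (z - t) / k z|.
  have ch : {for t, continuous h}.
    apply: cont_compf; last exact: norm_continuous.
    apply: cont_mulf; last by apply: cont_invf => //; rewrite gt_eqF.
    apply: cont_mulf => //; apply: cont_addf; [exact: cvg_id|exact: cont_cstf].
  have ht : h t = 0 by rewrite /h subrr mulr0 mul0r normr0.
  have Hle : \forall z \near t, `|nu z - nu t| <= h z.
    have [e e0 He] := continuous_near_gt ck kt.
    near=> z.
    have xz : (x z, y z) <> (0, 0) by near: z.
    have kz : 0 < k z.
      by apply: He; near: z; exact: near_dist_lt.
    have Kz := kK z xz.
    rewrite /h normrM normfV (gtr0_norm kz) ler_pdivlMr //.
    have -> : `|gG z * (z - t)| = `|(nu z - nu t) * K z| by rewrite key // mulNr normrN.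
    by rewrite normrM ler_wpM2l // (le_trans Kz) // ler_norm.
  apply/(@cvgrPdist_lt _ R) => e e0.
  have hte : h t < e by rewrite ht.
  have [d d0 Hd] := continuous_near_lt ch hte.
  near=> z; rewrite distrC.
  have : `|nu z - nu t| <= h z by near: z.
  move/le_lt_trans; apply; apply: Hd; near: z.
  exact: near_dist_lt.
pose d := - gG t / K t.
exists d; apply/is_derive1_caratheodory.
pose g z := if z == t then d else (nu z - nu t) / (z - t).
have gt : g t = d by rewrite /g eqxx.
exists g; split => //.
- move=> z; rewrite /g; case: eqP => [->|/eqP]; first by rewrite !subrr mulr0.
  by rewrite -subr_eq0 => /divfK->.
- have Kt : 0 < K t := lt_le_trans kt (kK t xy).
  have ch : {for t, continuous (fun z => - gG z / K z)}.
    apply: cont_mulf; first exact: cont_oppf.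
    apply: cont_invf; first by rewrite gt_eqF.
    have cS n : {for t, continuous (S n)}.
      apply: cont_sumf => i; apply: cont_mulf; last exact: cont_cstf.
      exact: cont_expf.
    by apply: cont_addf; apply: cont_mulf => //; exact: cont_expf.
  change (g z @[z --> t] --> g t); rewrite gt; apply: cvg_trans ch; apply: near_eq_cvg.
  have cK : {for t, continuous K}.
    have cS n : {for t, continuous (S n)}.
      apply: cont_sumf => i; apply: cont_mulf; last exact: cont_cstf.
      exact: cont_expf.
    by apply: cont_addf; apply: cont_mulf => //; exact: cont_expf.
  have [e e0 He] := continuous_near_gt cK Kt.
  near=> z; rewrite /g; case: eqP => [->//|/eqP zt].
  have xz : (x z, y z) <> (0, 0) by near: z.
  have Kz : 0 < K z.
    by apply: He; near: z; exact: near_dist_lt.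
  apply: (mulIf (lt0r_neq0 Kz)); rewrite divfK ?lt0r_neq0 //.
  apply: (mulIf (_ : z - t != 0)); first by rewrite subr_eq0.
  by rewrite -key // mulrAC divfK // subr_eq0.
Unshelve. all: by end_near. Qed.

End PolarLift.

Section PolarLift2.
Variable R : realType.

(** Composition with [clamp T] extends a function known only on the segment from 0 to T to a
    continuous function on the line, as [primitive_exists] requires. *)
Definition clamp (T t : R) := Num.max 0 (Num.min t T).

Lemma clamp_in T t : 0 <= T -> 0 <= clamp T t <= T.
Proof. by move=> T0; rewrite /clamp le_max lexx ge_max T0 ge_min lexx orbT. Qed.

Lemma clamp_id T t : 0 <= t <= T -> clamp T t = t.
Proof. by case/andP=> t0 tT; rewrite /clamp (min_idPl tT) (max_idPr t0). Qed.

Lemma continuous_clamp T : continuous (clamp T).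
Proof.
move=> t; apply: (@continuous_max _ R (fun=> 0) (fun t => Num.min t T)).
  exact: cvg_cst.
by apply: (@continuous_min _ R id (fun=> T)); [exact: cvg_id|exact: cvg_cst].
Qed.

(** The angle is a primitive of the rotation speed [w]. In the frame turning with it, the point (c,
    s) has the components [u] and [v], whose derivatives vanish, so they keep their initial values 1
    and 0. *)
Lemma rotation_lift (c s w : R -> R) (T th0 : R) : 0 <= T ->
  (forall t, 0 <= t <= T -> {for t, continuous w}) ->
  (forall t, 0 <= t <= T -> is_derive t 1 c (- s t * w t)) ->
  (forall t, 0 <= t <= T -> is_derive t 1 s (c t * w t)) ->
  c 0 = cos th0 -> s 0 = sin th0 ->
  exists th : R -> R, th 0 = th0 /\ forall t, 0 <= t <= T ->
    [/\ is_derive t 1 th (w t), c t = cos (th t) & s t = sin (th t)].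
Proof.
move=> T0 cw dc ds c0 s0.
have cwc : continuous (fun t => w (clamp T t)).
  move=> t; apply: (@cont_compf R w (clamp T)); first exact: continuous_clamp.
  by apply: cw; exact: clamp_in.
have [F [F0 dF]] := primitive_exists cwc.
exists (fun t => F t + th0); split; first by rewrite F0 add0r.
set th := fun t => F t + th0.
have dth t : 0 <= t <= T -> is_derive t 1 th (w t).
  move=> tT; have := dF t; rewrite clamp_id // => dFt.
  exact: (derive_eqf (derive_addf dFt (derive_cstf _ t)) (addr0 _)).
have dcos t : 0 <= t <= T -> is_derive t 1 (fun t => cos (th t)) (- sin (th t) * w t).
  by move=> tT; exact: (derive_compf (is_derive_cos _) (dth t tT)).
have dsin t : 0 <= t <= T -> is_derive t 1 (fun t => sin (th t)) (cos (th t) * w t).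
  by move=> tT; exact: (derive_compf (is_derive_sin _) (dth t tT)).
pose u t := c t * cos (th t) + s t * sin (th t).
pose v t := s t * cos (th t) + - (c t * sin (th t)).
have th00 : th 0 = th0 by rewrite /th F0 add0r.
have u1 t : 0 <= t <= T -> u t = 1.
  move=> /andP[t0 tT].
  have -> : 1 = u 0 by rewrite /u th00 c0 s0 -!expr2 cos2Dsin2.
  apply: derive_eq0_cst => // r /andP[r0 rt].
  have rT : 0 <= r <= T by rewrite r0 (le_trans rt).
  apply: (derive_eqf (derive_addf (derive_mulf (dc r rT) (dcos r rT))
    (derive_mulf (ds r rT) (dsin r rT)))); ring.
have v0 t : 0 <= t <= T -> v t = 0.
  move=> /andP[t0 tT].
  have -> : 0 = v 0 by rewrite /v th00 c0 s0 mulrC subrr.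
  apply: derive_eq0_cst => // r /andP[r0 rt].
  have rT : 0 <= r <= T by rewrite r0 (le_trans rt).
  apply: (derive_eqf (derive_addf (derive_mulf (ds r rT) (dcos r rT))
    (derive_oppf (derive_mulf (dc r rT) (dsin r rT))))); ring.
move=> t tT; split; first exact: dth.
  have e : c t = u t * cos (th t) - v t * sin (th t) + c t * (1 - (cos (th t) ^+ 2 + sin (th t) ^+ 2)).
    by rewrite /u /v; ring.
  by rewrite e cos2Dsin2 u1 // v0 //; ring.
have e : s t = u t * sin (th t) + v t * cos (th t) + s t * (1 - (cos (th t) ^+ 2 + sin (th t) ^+ 2)).
  by rewrite /u /v; ring.
by rewrite e cos2Dsin2 u1 // v0 //; ring.
Qed.

Lemma weight_gt0 (s1 s2 : nat) (c s : R) : (0 < s1)%N -> (0 < s2)%N ->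
  c ^+ 2 + s ^+ 2 = 1 -> 0 < s1%:R * c ^+ 2 + s2%:R * s ^+ 2.
Proof.
move=> s1p s2p cs.
have h1 : 1 <= s1%:R :> R by rewrite ler1n.
have h2 : 1 <= s2%:R :> R by rewrite ler1n.
by have := sqr_ge0 c; have := sqr_ge0 s; nra.
Qed.

(** The two differential equations are stated multiplied by their denominators; [L ^+ (s1 - s2)] is
    a genuine power because [s2 <= s1], so no negative exponent of [L] appears. *)
Lemma polar_lift (s1 s2 : nat) (x y dx dy : R -> R) (T th0 L0 : R) :
  (0 < s2)%N -> (s2 <= s1)%N -> 0 <= T ->
  (forall t, 0 <= t <= T -> is_derive t 1 x (dx t) /\ is_derive t 1 y (dy t)) ->
  (forall t, 0 <= t <= T -> {for t, continuous dx} /\ {for t, continuous dy}) ->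
  (forall t, 0 <= t <= T -> (x t, y t) <> (0, 0)) ->
  0 < L0 -> x 0 = L0 ^+ s1 * cos th0 -> y 0 = L0 ^+ s2 * sin th0 ->
  exists L th dL dth : R -> R, [/\ L 0 = L0, th 0 = th0 &
    forall t, 0 <= t <= T ->
    [/\ 0 < L t, is_derive t 1 L (dL t) /\ is_derive t 1 th (dth t),
        x t = L t ^+ s1 * cos (th t) /\ y t = L t ^+ s2 * sin (th t),
        (s1%:R * cos (th t) ^+ 2 + s2%:R * sin (th t) ^+ 2) * L t ^+ s1 * dL t =
          L t * (cos (th t) * dx t + sin (th t) * (L t ^+ (s1 - s2) * dy t)) &
        (s1%:R * cos (th t) ^+ 2 + s2%:R * sin (th t) ^+ 2) * L t ^+ s1 * dth t =
          s1%:R * cos (th t) * (L t ^+ (s1 - s2) * dy t) - s2%:R * sin (th t) * dx t]].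
Proof.
move=> s2p s21 T0 Hd Hc Hn L00 x0 y0.
have s1p : (0 < s1)%N := leq_trans s2p s21.
pose P z nu := (x z, y z) <> (0, 0) -> 0 < nu /\
     x z ^+ 2 * nu ^+ (2 * s1) + y z ^+ 2 * nu ^+ (2 * s2) = 1.
have /choice[nu Hnu] : forall z, exists nu, P z nu.
  move=> z; have [xy|xy] := pselect ((x z, y z) <> (0, 0)); last by exists 0.
  by have [a a0 e] := weighted_circle_exists s1p s2p xy; exists a.
pose c t := x t * nu t ^+ s1; pose s t := y t * nu t ^+ s2.
pose kap t := s1%:R * c t ^+ 2 + s2%:R * s t ^+ 2.
(* This is the rotation speed c s' - s c' with the derivative of [nu] eliminated. That derivative is
   not known to be continuous, whereas the continuity of this formula is visible. *)
pose w t := (s1%:R * c t * (nu t ^+ s2 * dy t) - s2%:R * s t * (nu t ^+ s1 * dx t)) / kap t.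
have cs t : (x t, y t) <> (0, 0) -> c t ^+ 2 + s t ^+ 2 = 1.
  move=> /Hnu[_ <-]; rewrite /c /s !exprMn -!exprM; congr (_ * _ ^+ _ + _ * _ ^+ _); ring.
have kap0 t : 0 <= t <= T -> 0 < kap t.
  by move=> tT; apply: weight_gt0 => //; apply/cs/Hn.
have Dnu t : 0 <= t <= T -> is_derive t 1 nu ('D_1 nu t).
  move=> tT; have [Hx Hy] := Hd t tT.
  have [d [Hd' _]] := weighted_circle_derivable s1p s2p Hx Hy (Hn t tT) Hnu.
  exact: derivableP.
pose dnu t := 'D_1 nu t.
pose dc t := x t * (s1%:R * nu t ^+ s1.-1 * dnu t) + nu t ^+ s1 * dx t.
pose ds t := y t * (s2%:R * nu t ^+ s2.-1 * dnu t) + nu t ^+ s2 * dy t.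
have Dc t : 0 <= t <= T -> is_derive t 1 c (dc t).
  by move=> tT; exact: (derive_mulf (Hd t tT).1 (derive_expf s1 (Dnu t tT))).
have Ds t : 0 <= t <= T -> is_derive t 1 s (ds t).
  by move=> tT; exact: (derive_mulf (Hd t tT).2 (derive_expf s2 (Dnu t tT))).
have orth t : 0 <= t <= T -> c t * dc t + s t * ds t = 0.
  move=> tT.
  have H1 : is_derive t 1 (fun t => c t ^+ 2 + s t ^+ 2) _ :=
    derive_addf (derive_expf 2 (Dc t tT)) (derive_expf 2 (Ds t tT)).
  have H2 : is_derive t 1 (fun t => c t ^+ 2 + s t ^+ 2) 0.
    apply: (near_eq_is_derive _ (derive_cstf 1 t)); rewrite ?oner_neq0 //.
    have := pair_neq0_near (derive_continuous (Hd t tT).1) (derive_continuous (Hd t tT).2) (Hn t tT).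
    by apply: filterS => z /cs.
  have [_ E1] := H1; have [_ E2] := H2; rewrite E2 /= !expr1 in E1.
  by apply: (mulfI (_ : 2 != 0 :> R)); rewrite ?pnatr_eq0 // mulr0 E1; ring.
have nu0 t : 0 <= t <= T -> 0 < nu t by move=> /Hn /Hnu[].
have nuS t n : 0 <= t <= T -> (0 < n)%N -> nu t ^+ n.-1 = nu t ^+ n / nu t.
  by move=> tT n0; rewrite -{2}(prednK n0) exprSr mulfK // gt_eqF // nu0.
have dcE t : 0 <= t <= T -> dc t = s1%:R * c t * (dnu t / nu t) + nu t ^+ s1 * dx t.
  by move=> tT; rewrite /dc nuS // /c; ring.
have dsE t : 0 <= t <= T -> ds t = s2%:R * s t * (dnu t / nu t) + nu t ^+ s2 * dy t.
  by move=> tT; rewrite /ds nuS // /s; ring.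
have wE t : 0 <= t <= T -> w t = c t * ds t - s t * dc t.
  move=> tT; have kn := lt0r_neq0 (kap0 t tT).
  apply: (mulIf kn); rewrite /w divfK //.
  have H1 : nu t ^+ s2 * dy t = ds t - s2%:R * s t * (dnu t / nu t) by rewrite dsE //; ring.
  have H2 : nu t ^+ s1 * dx t = dc t - s1%:R * c t * (dnu t / nu t) by rewrite dcE //; ring.
  have Q1 := cs t (Hn t tT).
  rewrite H1 H2 /kap.
  transitivity (s1%:R * c t * ds t * (c t ^+ 2 + s t ^+ 2) - s2%:R * s t * dc t * (c t ^+ 2 + s t ^+ 2)).
    by rewrite Q1; ring.
  transitivity ((c t * ds t - s t * dc t) * (s1%:R * c t ^+ 2 + s2%:R * s t ^+ 2)
     + (c t * dc t + s t * ds t) * (s1%:R - s2%:R) * c t * s t).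
    by ring.
  by rewrite orth //; ring.
have dcw t : 0 <= t <= T -> dc t = - s t * w t.
  move=> tT; rewrite wE //.
  transitivity (dc t * (c t ^+ 2 + s t ^+ 2) - c t * (c t * dc t + s t * ds t)).
    by rewrite cs ?orth //; [ring | exact: Hn].
  ring.
have dsw t : 0 <= t <= T -> ds t = c t * w t.
  move=> tT; rewrite wE //.
  transitivity (ds t * (c t ^+ 2 + s t ^+ 2) - s t * (c t * dc t + s t * ds t)).
    by rewrite cs ?orth //; [ring | exact: Hn].
  ring.
have cnu t : 0 <= t <= T -> {for t, continuous nu}.
  by move=> tT; exact: derive_continuous (Dnu t tT).
have cw t : 0 <= t <= T -> {for t, continuous w}.
  move=> tT; have [cx cy] := Hc t tT.
  have cc := derive_continuous (Dc t tT); have css := derive_continuous (Ds t tT).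
  have cn := cnu t tT.
  apply: cont_mulf; last first.
    apply: cont_invf; first by rewrite lt0r_neq0 // kap0.
    by apply: cont_addf; apply: cont_mulf; first [exact: cont_cstf | exact: cont_expf].
  apply: cont_addf; last apply: cont_oppf; apply: cont_mulf; try apply: cont_mulf => //;
   first [exact: cont_cstf | exact: cont_expf].
have T0' : 0 <= (0 : R) <= T by rewrite lexx.
have nu00 : nu 0 = L0^-1.
  have n0 := Hn 0 T0'; have [np e] := Hnu 0 n0.
  apply: (weighted_circle_inj s1p s2p n0) => //; first by rewrite invr_gt0.
  have H n : L0 ^+ n * L0^-1 ^+ n = 1 by rewrite -exprMn divff ?expr1n // gt_eqF.
  rewrite e x0 y0 !exprMn -!exprM [(s1 * 2)%N]mulnC [(s2 * 2)%N]mulnC.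
  by rewrite mulrAC H mulrAC H !mul1r cos2Dsin2.
have c0 : c 0 = cos th0.
  by rewrite /c x0 nu00 mulrAC -exprMn divff ?expr1n ?mul1r // gt_eqF.
have s0 : s 0 = sin th0.
  by rewrite /s y0 nu00 mulrAC -exprMn divff ?expr1n ?mul1r // gt_eqF.
have [||th [th00 Hth]] := rotation_lift T0 cw _ _ c0 s0.
- by move=> t tT; rewrite -dcw //; exact: Dc.
- by move=> t tT; rewrite -dsw //; exact: Ds.
exists (fun t => (nu t)^-1), th, (fun t => - (nu t ^- 2 * dnu t)), w.
split => // [|t tT]; first by rewrite nu00 invrK.
have [dth ec es] := Hth t tT.
have np := nu0 t tT; have nn := lt0r_neq0 np.
have ne n : nu t ^+ n * (nu t)^-1 ^+ n = 1 by rewrite -exprMn divff ?expr1n.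
have kn := lt0r_neq0 (kap0 t tT).
split => //.
- by rewrite invr_gt0.
- by split=> //; exact: derive_invf (Dnu t tT).
- by rewrite -ec -es /c /s ![_^-1 ^+ _ * _]mulrC -!mulrA !ne !mulr1.
- rewrite -ec -es -/(kap t).
  have e1 : (nu t)^-1 ^+ (s1 - s2) * dy t = (nu t)^-1 ^+ s1 * (nu t ^+ s2 * dy t).
    by rewrite mulrA; congr (_ * _);
      rewrite -{2}(subnK s21) exprD -mulrA [_^-1 ^+ s2 * _]mulrC ne mulr1.
  have e2 : dx t = (nu t)^-1 ^+ s1 * (nu t ^+ s1 * dx t) by rewrite mulrA [_ * nu t ^+ _]mulrC ne mul1r.
  have H1 : nu t ^+ s2 * dy t = ds t - s2%:R * s t * (dnu t / nu t) by rewrite dsE //; ring.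
  have H2 : nu t ^+ s1 * dx t = dc t - s1%:R * c t * (dnu t / nu t) by rewrite dcE //; ring.
  rewrite e1 e2 H1 H2.
  transitivity ((nu t)^-1 * (nu t)^-1 ^+ s1 * ((c t * dc t + s t * ds t) - kap t * (dnu t / nu t))).
    by rewrite orth //; field.
  by rewrite /kap; ring.
- rewrite -ec -es -/(kap t).
  have e1 : (nu t)^-1 ^+ (s1 - s2) * dy t = (nu t)^-1 ^+ s1 * (nu t ^+ s2 * dy t).
    by rewrite mulrA; congr (_ * _);
      rewrite -{2}(subnK s21) exprD -mulrA [_^-1 ^+ s2 * _]mulrC ne mulr1.
  have e2 : dx t = (nu t)^-1 ^+ s1 * (nu t ^+ s1 * dx t) by rewrite mulrA [_ * nu t ^+ _]mulrC ne mul1r.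
  rewrite e1 [X in _ = _ - _ * X]e2 /w.
  by field.
Qed.

End PolarLift2.

(** * Formal solution of the radial equation *)

Section FormalSolution.
Variable R : realType.
Local Notation S := {poly {poly R}}.

(** The outer variable of [S] is delta and the inner one is the initial value l, so this is
    vanishing to order [r] in delta. *)
Definition divXn (r : nat) (p : S) := exists q, p = q * 'X^r.

Lemma divXnD r p q : divXn r p -> divXn r q -> divXn r (p + q).
Proof. by move=> [a ->] [b ->]; exists (a + b); rewrite mulrDl. Qed.

Lemma divXnN r p : divXn r p -> divXn r (- p).
Proof. by move=> [a ->]; exists (- a); rewrite mulNr. Qed.

Lemma divXnM r1 r2 p q : divXn r1 p -> divXn r2 q -> divXn (r1 + r2) (p * q).
Proof. by move=> [a ->] [b ->]; exists (a * b); rewrite exprD; ring. Qed.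

Lemma divXnMl r p q : divXn r p -> divXn r (q * p).
Proof. by move=> [a ->]; exists (q * a); rewrite mulrA. Qed.

Lemma divXn_sum r (I : Type) (s : seq I) (F : I -> S) :
  (forall i, divXn r (F i)) -> divXn r (\sum_(i <- s) F i).
Proof.
move=> H; elim: s => [|i s IH]; first by rewrite big_nil; exists 0; rewrite mul0r.
by rewrite big_cons; exact: divXnD.
Qed.

Lemma divXn_coef r p i : divXn r p -> (i < r)%N -> p`_i = 0.
Proof. by move=> [q ->] ir; rewrite coefMXn ir. Qed.

Lemma coef_divXn r (p : S) : (forall i, (i < r)%N -> p`_i = 0) -> divXn r p.
Proof.
move=> H; exists (drop_poly r p); rewrite -[LHS](poly_take_drop r).
rewrite [X in X + _](_ : _ = 0) ?add0r //.
by apply/polyP => i; rewrite coef_take_poly coef0; case: ifP => // /H.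
Qed.

Lemma divXnW r1 r2 p : (r1 <= r2)%N -> divXn r2 p -> divXn r1 p.
Proof.
move=> r12 H; apply: coef_divXn => i ir; apply: (divXn_coef H).
exact: leq_trans ir r12.
Qed.

Lemma divXn_subX r p q n : divXn r (p - q) -> divXn r (p ^+ n - q ^+ n).
Proof. by move=> H; rewrite subrXX mulrC; exact: divXnMl. Qed.

(* Inner degrees at most [W * i] in the coefficient of index [i] are what bounds
   the number of zeros in the end. *)
Variable W : nat.

Definition tame (F : R -> S) := [/\ forall i j, continuous (fun x => (F x)`_i`_j),
  forall x i j, (W * i < j)%N -> (F x)`_i`_j = 0 &
  exists n, forall x i, (n <= i)%N -> (F x)`_i = 0].

Lemma tameD F G : tame F -> tame G -> tame (fun x => F x + G x).
Proof.
move=> [cF gF [n bF]] [cG gG [m bG]]; split.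
- move=> i j; under eq_fun do rewrite !coefD.
  by move=> x; apply: cont_addf; [exact: cF|exact: cG].
- by move=> x i j ij; rewrite !coefD gF // gG // addr0.
- exists (maxn n m) => x i; rewrite geq_max => /andP[ni mi].
  by rewrite coefD bF // bG // addr0.
Qed.

Lemma tameM F G : tame F -> tame G -> tame (fun x => F x * G x).
Proof.
move=> [cF gF [n bF]] [cG gG [m bG]]; split.
- move=> i j.
  have -> : (fun x => (F x * G x)`_i`_j) = (fun x => \sum_(a < i.+1) \sum_(b < j.+1)
      (F x)`_a`_b * (G x)`_(i - a)`_(j - b)).
    by apply/funext => x; rewrite coefM coef_sum; apply: eq_bigr => a _; rewrite coefM.
  move=> x; apply: cont_sumf => a; apply: cont_sumf => b.
  by apply: cont_mulf; [exact: cF|exact: cG].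
- move=> x i j ij; rewrite coefM coef_sum big1 // => a _; rewrite coefM big1 // => b _.
  have [ab|ab] := ltnP (W * a) b; first by rewrite gF // mul0r.
  rewrite gG ?mulr0 //; have ai := ltn_ord a; have bj := ltn_ord b.
  rewrite mulnBr; have : (W * a <= W * i)%N by rewrite leq_mul2l -ltnS ltn_ord orbT.
  lia.
- exists (n + m)%N => x i nmi; rewrite coefM big1 // => a _.
  have [na|an] := leqP n a; first by rewrite bF // mul0r.
  by rewrite bG ?mulr0 //; have := ltn_ord a; lia.
Qed.

Lemma tame0 : tame (fun=> 0).
Proof.
split; [|by move=> x i j _; rewrite !coef0|by exists 0%N => x i _; rewrite coef0].
by move=> i j; under eq_fun do rewrite !coef0; move=> x; exact: cont_cstf.
Qed.

Lemma tame_sum (I : Type) (s : seq I) (F : I -> R -> S) :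
  (forall i, tame (F i)) -> tame (fun x => \sum_(i <- s) F i x).
Proof.
move=> H; elim: s => [|i s IH].
  by under eq_fun do rewrite big_nil; exact: tame0.
by under eq_fun do rewrite big_cons; exact: tameD.
Qed.

Lemma tame_mon (c : R -> R) (i e : nat) : continuous c -> (e <= W * i)%N ->
  tame (fun x => (c x)%:P%:P * (('X^e)%:P * 'X^i)).
Proof.
move=> cc ei.
have E x a b : ((c x)%:P%:P * (('X^e)%:P * 'X^i) : S)`_a`_b =
    c x * ((a == i) && (b == e))%:R.
  rewrite coefCM coefCM coefCM coefXn.
  by case: (a == i) => /=; rewrite ?mulr1 ?mulr0 ?coefXn ?coef0 // mulr0.
split.
- move=> a b; under eq_fun do rewrite E; move=> x.
  by apply: (@cont_mulf R c (fun=> _)); [exact: cc|exact: cont_cstf].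
- move=> x a b ab; rewrite E; case: eqP => [ai|_]; last by rewrite mulr0.
  by case: eqP => [be|]; rewrite ?mulr0 //; subst; lia.
- exists i.+1 => x a ia; apply/polyP => b; rewrite E coef0.
  by rewrite (gtn_eqF ia) mulr0.
Qed.

Lemma tameC (c : R -> R) : continuous c -> tame (fun x => (c x)%:P%:P).
Proof.
move=> cc; have := @tame_mon c 0 0 cc (leq0n _).
by under eq_fun do rewrite !expr0 mulr1 mulr1.
Qed.

Lemma tame1 : tame (fun=> 1).
Proof. by apply: (@tameC (fun=> 1)) => x; exact: cont_cstf. Qed.

Lemma tameN F : tame F -> tame (fun x => - F x).
Proof.
move=> gF; have := tameM (@tameC (fun=> -1) (fun x => @cont_cstf R (-1) x)) gF.
by under eq_fun do rewrite !polyCN mulN1r.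
Qed.

Lemma tameX F n : tame F -> tame (fun x => F x ^+ n).
Proof.
move=> gF; elim: n => [|n IH]; first by under eq_fun do rewrite expr0; exact: tame1.
by under eq_fun do rewrite exprS; exact: tameM.
Qed.

Variables (e0 K : nat) (b0 : R -> R) (bb nn : nat -> nat -> R -> R).
Hypothesis b0c : continuous b0.
Hypothesis b0n : forall x, b0 x != 0.
Hypothesis bbc : forall i e, continuous (bb i e).
Hypothesis nnc : forall i e, continuous (nn i e).
Hypothesis e0W : (e0 <= W)%N.

(** The exponent of l comes from putting eps = delta l^e0 and L = l r u into eps^(i+1) L^e and
    dividing by the common factor l^e0; the power of r is absorbed in the coefficient [a i e x]. *)
Definition pert (a : nat -> nat -> R -> R) (x : R) (u : S) : S :=
  \sum_(i < K) \sum_(e < W.+1)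
    (a i e x)%:P%:P * (('X^(e0 * i + e))%:P * 'X^(i.+1)) * u ^+ e.

Definition fden x u := (b0 x)%:P%:P * u ^+ e0 + pert bb x u.
Definition fnum x u := pert nn x u.
(** The defect in the equation u' [fden] = u [fnum], with [G] in the place of the angular derivative
    of u = [F]. It is kept undivided since a quotient by [fden] would leave the polynomials. *)
Definition resid x (F G : S) := G * fden x F - F * fnum x F.

Lemma tame_pert a F : (forall i e, continuous (a i e)) -> tame F ->
  tame (fun x => pert a x (F x)).
Proof.
move=> ac gF; apply: tame_sum => i; apply: tame_sum => e; apply: tameM.
  apply: tame_mon; first exact: ac.
  (* The bound e0 i + e <= W (i + 1) rests on [e0W], and through it on m <= n. *)
  by rewrite mulnS addnC leq_add ?leq_mul2r ?e0W ?orbT // -ltnS.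
exact: tameX.
Qed.

Lemma tame_resid F G : tame F -> tame G -> tame (fun x => resid x (F x) (G x)).
Proof.
move=> gF gG; apply: tameD; last apply: tameN; apply: tameM => //.
  by apply: tameD; [apply: tameM; [exact: tameC|exact: tameX]|exact: tame_pert].
exact: tame_pert.
Qed.

Lemma divXn_pert a x u : divXn 1 (pert a x u).
Proof.
apply: divXn_sum => i; apply: divXn_sum => e.
rewrite mulrC; apply: divXnMl; rewrite mulrA; apply: divXnMl.
by exists 'X^i; rewrite -exprD addn1.
Qed.

(** Every term of [pert] carries a factor delta. The gain of one order is what lets the successive
    approximations settle one coefficient at a time. *)
Lemma divXn_pertB a r x u v : divXn r (u - v) -> divXn r.+1 (pert a x u - pert a x v).
Proof.
move=> H; rewrite /pert -sumrB; apply: divXn_sum => i; rewrite -sumrB.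
apply: divXn_sum => e; rewrite -mulrBr -add1n; apply: divXnM; last exact: divXn_subX.
by rewrite mulrA; apply: divXnMl; exists 'X^i; rewrite -exprD addn1.
Qed.

Definition coef_derive (F G : R -> S) := forall (i j : nat) (x : R),
  is_derive x 1 (fun x => (F x)`_i`_j) ((G x)`_i`_j).

(** A correction [U] of order delta^(k+1), with angular derivative [V], changes the residual by [b0]
    [V] modulo delta^(k+2). So [V] must be minus the leading coefficient of the residual divided by
    [b0], and [U] is its primitive vanishing at 0, which keeps [F 0 = 1]. *)
Lemma formal_solution k : exists F G, [/\ tame F /\ tame G, coef_derive F G,
  F 0 = 1, (forall x, divXn 1 (F x - 1)) /\ (forall x, divXn 1 (G x)) &
  (forall x, divXn k.+1 (resid x (F x) (G x))) /\
  (forall x i, (k < i)%N -> (F x)`_i = 0)].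
Proof.
elim: k => [|k [F [G [[gF gG] FG F0 [F1 G1] [Hr Hs]]]]].
  exists (fun=> 1), (fun=> 0); split => //.
  - by split; [exact: tame1|exact: tame0].
  - by move=> i j x; rewrite !coef0; exact: derive_cstf.
  - split=> x; first by rewrite subrr; exists 0; rewrite mul0r.
    by exists 0; rewrite mul0r.
  - split=> x; last by move=> i; rewrite coef1; case: i.
    rewrite /resid mul0r sub0r mul1r; apply: divXnN; exact: divXn_pert.
have gres := tame_resid gF gG; have [cr grr _] := gres.
pose rho l x := (resid x (F x) (G x))`_k.+1`_l.
pose v l x := - (rho l x / b0 x).
have cv l : continuous (v l).
  move=> x; apply: (@cont_oppf R (fun x => rho l x / b0 x)).
  apply: (@cont_mulf R (rho l) (fun x => (b0 x)^-1)); first exact: cr.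
  by apply: cont_invf; [exact: b0n|exact: b0c].
have /choice[u Hu] := fun l => primitive_exists (cv l).
(* The coefficient of delta^(k+1) in the residual has degree at most W (k + 1) in l, so these many
   quadratures suffice. *)
pose N := (W * k.+1).+1.
pose mon l : S := ('X^l)%:P * 'X^(k.+1).
pose U x : S := \sum_(l < N) (u l x)%:P%:P * mon l.
pose V x : S := \sum_(l < N) (v l x)%:P%:P * mon l.
have cu l : continuous (u l) by move=> x; exact: derive_continuous ((Hu l).2 x).
have tU : tame U.
  by apply: tame_sum => l; apply: tame_mon; [exact: cu | rewrite -ltnS].
have tV : tame V.
  by apply: tame_sum => l; apply: tame_mon; [exact: cv | rewrite -ltnS].
have coefU (w : nat -> R -> R) x i j : (\sum_(l < N) (w l x)%:P%:P * mon l : S)`_i`_j =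
    \sum_(l < N) w l x * ((i == k.+1) && (j == l))%:R.
  rewrite !coef_sum; apply: eq_bigr => l _; rewrite coefCM coefCM coefCM coefXn.
  by case: (i == k.+1) => /=; rewrite ?mulr1 ?mulr0 ?coefXn ?coef0 // mulr0.
have dU x : divXn k.+1 (U x).
  by apply: divXn_sum => l; apply: divXnMl; apply: divXnMl; exists 1; rewrite mul1r.
have dV x : divXn k.+1 (V x).
  by apply: divXn_sum => l; apply: divXnMl; apply: divXnMl; exists 1; rewrite mul1r.
have F21 x : divXn 1 (F x + U x - 1).
  by rewrite addrAC; apply: divXnD => //; exact: divXnW (dU x).
exists (fun x => F x + U x), (fun x => G x + V x); split.
- by split; exact: tameD.
- move=> i j x; rewrite !coefD; under eq_fun do rewrite !coefD.
  apply: derive_addf; first exact: FG.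
  rewrite coefU; under eq_fun do rewrite coefU.
  apply: (@derive_sumf R _ _ (fun (l : 'I_N) x => u l x * ((i == k.+1) && (j == l))%:R)
    (fun (l : 'I_N) x => v l x * ((i == k.+1) && (j == l))%:R) x) => l.
  apply: (derive_eqf (derive_mulf ((Hu l).2 x) (derive_cstf _ x))).
  by rewrite mulr0 add0r mulrC.
- rewrite F0 /U big1 ?addr0 // => l _; by rewrite (Hu l).1 !polyC0 mul0r.
- split=> // x; apply: divXnD => //; exact: divXnW (dV x).
- split=> [x|x i ki]; last first.
    rewrite coefD Hs ?(ltnW ki) // add0r; apply/polyP => j; rewrite coefU coef0.
    by rewrite big1 // => l _; rewrite (gtn_eqF ki) mulr0.
  have F1' : divXn k.+1 (F x + U x - F x) by rewrite addrAC subrr add0r.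
  (* Only the first bracket has terms of order k + 1, and they cancel by the choice of [v]. Every
     other product gains an order from [V] or [G], from a difference of [fden] or [fnum], or from
     the factor delta in [fnum]. *)
  have E : resid x (F x + U x) (G x + V x) =
     (resid x (F x) (G x) + V x * (b0 x)%:P%:P)
     + V x * (fden x (F x + U x) - (b0 x)%:P%:P)
     + G x * (fden x (F x + U x) - fden x (F x))
     - ((F x + U x - F x) * fnum x (F x + U x)
        + F x * (fnum x (F x + U x) - fnum x (F x))).
    by rewrite /resid; ring.
  rewrite E; apply: divXnD; last apply: divXnN; apply: divXnD.
  + apply: divXnD.
      apply: coef_divXn => i; rewrite ltnS leq_eqVlt => /orP[/eqP ->|ik]; last first.
        rewrite coefD (divXn_coef (Hr x)) // add0r mulrC coefCM.
        by rewrite (divXn_coef (dV x)) // mulr0.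
      apply/polyP => j; rewrite coefD mulrC coefCM coefD coefCM coefU coef0.
      have [jN|Nj] := ltnP j N; last first.
        rewrite big1 ?mulr0 ?addr0 => [|l _]; last first.
          by rewrite (gtn_eqF (leq_trans (ltn_ord l) Nj)) andbF mulr0.
        exact: grr.
      rewrite (bigD1 (Ordinal jN)) //= !eqxx mulr1 big1 ?addr0 => [|l lj]; last first.
        case: eqP => [jl|]; rewrite ?andbF ?mulr0 //.
        by move: lj; rewrite -val_eqE /= jl eqxx.
      by rewrite /v mulrN mulrCA divff // mulr1 subrr.
    rewrite -addn1; apply: divXnM => //.
    rewrite /fden addrAC; apply: divXnD; last exact: divXn_pert.
    rewrite -{2}[_%:P%:P]mulr1 -mulrBr; apply: divXnMl.
    by rewrite -[X in _ - X](expr1n _ e0); exact: divXn_subX.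
  + rewrite -add1n; apply: divXnM => //.
    rewrite /fden opprD addrACA; apply: divXnD; last first.
      exact: divXnW (divXn_pertB _ _ F1').
    by rewrite -mulrBr; apply: divXnMl; exact: divXn_subX.
  + by rewrite -addn1; apply: divXnM => //; exact: divXn_pert.
  + by apply: divXnMl; exact: divXn_pertB.
Qed.

End FormalSolution.

(** * Evaluation of double polynomials and bounds for the polar field *)

Section Numeric.
Variable R : realType.
Local Notation S := {poly {poly R}}.

Lemma continuous2_segment_bounded (a : nat -> nat -> R -> R) (x0 x1 : R) :
  (forall i j, continuous (a i j)) ->
  exists C : nat -> nat -> R, forall i j, 0 < C i j /\
    forall x, x0 <= x <= x1 -> `|a i j x| <= C i j.
Proof.
move=> ca.
have /choice[C HC] : forall p : nat * nat, exists c : R, 0 < c /\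
    forall x, x0 <= x <= x1 -> `|a p.1 p.2 x| <= c.
  by move=> p; have [c c0 Hc] := continuous_segment_bounded x0 x1 (ca p.1 p.2); exists c.
by exists (fun i j => C (i, j)) => i j; exact: (HC (i, j)).
Qed.

Lemma exprn_lipschitz (n : nat) (M u v : R) : `|u| <= M -> `|v| <= M ->
  `|u ^+ n - v ^+ n| <= n%:R * M ^+ n.-1 * `|u - v|.
Proof.
move=> uM vM; rewrite subrXX normrM mulrC ler_wpM2r //.
have -> : n%:R * M ^+ n.-1 = \sum_(i < n) M ^+ n.-1.
  by rewrite sumr_const card_ord mulr_natl.
apply: le_trans (ler_norm_sum _ _ _) _; apply: ler_sum => i _.
have -> : M ^+ n.-1 = M ^+ (n.-1 - i) * M ^+ i.
  by rewrite -exprD subnK //; have := ltn_ord i; lia.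
by rewrite normrM !normrX ler_pM // ?exprn_ge0 // lerXn2r // ?nnegrE // (le_trans _ uM).
Qed.

Lemma hornerXY_coef (p : S) (n m : nat) (d l : R) :
  (forall i, (n <= i)%N -> p`_i = 0) -> (forall i j, (i < n)%N -> (m <= j)%N -> p`_i`_j = 0) ->
  p.[d, l] = \sum_(i < n) \sum_(j < m) p`_i`_j * d ^+ i * l ^+ j.
Proof.
move=> pn pm.
rewrite (@horner_coef_wide _ n p); last by apply/leq_sizeP.
rewrite horner_sum; apply: eq_bigr => i _.
rewrite -polyC_exp mulrC hornerCM (@horner_coef_wide _ m); last first.
  by apply/leq_sizeP => j mj; exact: pm.
by rewrite mulr_sumr; apply: eq_bigr => j _; rewrite mulrA [_ ^+ i * _]mulrC.
Qed.

Variable W : nat.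

Lemma tame_hornerXY (F : R -> S) : tame W F -> exists n, forall x d l,
  (F x).[d, l] = \sum_(i < n) \sum_(j < (W * n).+1) (F x)`_i`_j * d ^+ i * l ^+ j.
Proof.
move=> [_ gF [n bF]]; exists n => x d l; apply: hornerXY_coef => [i ni|i j ij nj].
  exact: bF.
by apply: gF; apply: leq_ltn_trans nj; rewrite leq_mul2l (ltnW ij) orbT.
Qed.

Lemma tame_eval_bound (F : R -> S) (r : nat) (x0 x1 b : R) : tame W F ->
  (forall x, divXn r (F x)) ->
  exists2 C, 0 < C & forall x d l, x0 <= x <= x1 -> `|d| <= 1 -> `|l| <= b ->
    `|(F x).[d, l]| <= C * `|d| ^+ r.
Proof.
move=> tF rF; have [n Hn] := tame_hornerXY tF; have [cF _ _] := tF.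
have [C HC] := continuous2_segment_bounded x0 x1 cF.
exists (1 + \sum_(i < n) \sum_(j < (W * n).+1) C i j * `|b| ^+ j).
  rewrite ltr_pwDl // sumr_ge0 // => i _; rewrite sumr_ge0 // => j _.
  by rewrite mulr_ge0 ?exprn_ge0 // ltW // (HC i j).1.
move=> x d l xx d1 lb; rewrite Hn mulrDl mul1r.
apply: ler_wpDl; first by rewrite exprn_ge0.
apply: le_trans (ler_norm_sum _ _ _) _; rewrite mulr_suml; apply: ler_sum => i _.
apply: le_trans (ler_norm_sum _ _ _) _; rewrite mulr_suml; apply: ler_sum => j _.
have [ir|ri] := ltnP i r.
  rewrite (divXn_coef (rF x) ir) coef0 !mul0r normr0 !mulr_ge0 ?exprn_ge0 //.
  by rewrite ltW // (HC i j).1.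
rewrite !normrM !normrX mulrAC ler_pM ?exprn_ge0 // ?mulr_ge0 ?exprn_ge0 //.
  rewrite ler_pM ?exprn_ge0 // ?(HC i j).2 // lerXn2r ?nnegrE //.
  exact: le_trans lb (ler_norm _).
by rewrite ler_wiXn2l.
Qed.

Lemma coef_derive_eval (F G : R -> S) (x d l : R) : tame W F -> tame W G ->
  coef_derive F G -> is_derive x 1 (fun x => (F x).[d, l]) (G x).[d, l].
Proof.
move=> [_ gF [n bF]] [_ gG [m bG]] FG.
pose N := maxn n m.
have H (H : R -> S) p : (forall x i j, (W * i < j)%N -> (H x)`_i`_j = 0) ->
   (forall x i, (p <= i)%N -> (H x)`_i = 0) -> (p <= N)%N -> forall x,
   (H x).[d, l] = \sum_(i < N) \sum_(j < (W * N).+1) (H x)`_i`_j * d ^+ i * l ^+ j.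
  move=> gH bH pN z; apply: hornerXY_coef => [i ni|i j ij nj].
    by apply: bH; apply: leq_trans ni.
  by apply: gH; apply: leq_ltn_trans nj; rewrite leq_mul2l (ltnW ij) orbT.
rewrite (H G m) ?leq_maxr //.
have -> : (fun x => (F x).[d, l]) = (fun x => \sum_(i < N) \sum_(j < (W * N).+1)
    (F x)`_i`_j * d ^+ i * l ^+ j).
  by apply/funext => z; rewrite (H F n) ?leq_maxl.
apply: (@derive_sumf R _ _ (fun (i : 'I_N) x => \sum_(j < (W * N).+1) (F x)`_i`_j * d ^+ i * l ^+ j)
   (fun (i : 'I_N) x => \sum_(j < (W * N).+1) (G x)`_i`_j * d ^+ i * l ^+ j)) => i.
apply: (@derive_sumf R _ _ (fun (j : 'I_(W * N).+1) x => (F x)`_i`_j * d ^+ i * l ^+ j)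
   (fun (j : 'I_(W * N).+1) x => (G x)`_i`_j * d ^+ i * l ^+ j)) => j.
apply: (derive_eqf (derive_mulf (derive_mulf (FG i j x) (derive_cstf (d ^+ i) x))
  (derive_cstf (l ^+ j) x))).
ring.
Qed.

Variables (e0 K : nat).

Lemma pert_eval a x u (d l : R) : (@pert R W e0 K a x u).[d, l] =
  \sum_(i < K) \sum_(e < W.+1) a i e x * (l ^+ (e0 * i + e) * d ^+ i.+1) * u.[d, l] ^+ e.
Proof.
rewrite /pert !horner_sum; apply: eq_bigr => i _; rewrite !horner_sum; apply: eq_bigr => e _.
by rewrite !hornerE.
Qed.

(** The common shape of the radial and the angular field, truncated at order [K] in eps. The index
    [i] of [a] belongs to the power i + 1 of eps, so that order 0 is the single monomial with
    coefficient [a0]. *)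
Definition fieldv (a0 : R -> R) (a : nat -> nat -> R -> R) (eps x L : R) :=
  a0 x * L ^+ e0 + \sum_(i < K) \sum_(e < W.+1) eps ^+ i.+1 * a i e x * L ^+ e.

Lemma fieldv_estimates (a0 : R -> R) (a : nat -> nat -> R -> R) (x0 x1 M : R) :
  continuous a0 -> (forall i e, continuous (a i e)) ->
  exists2 C, 0 < C & forall eps x L, x0 <= x <= x1 -> `|eps| <= 1 -> `|L| <= M ->
    [/\ `|fieldv a0 a eps x L| <= C,
        `|fieldv a0 a eps x L - a0 x * L ^+ e0| <= C * `|eps| &
        forall L', `|L'| <= M -> `|fieldv a0 a eps x L - fieldv a0 a eps x L'| <= C * `|L - L'|].
Proof.
move=> ca0 ca.
have [C0 C00 HC0] := continuous_segment_bounded x0 x1 ca0.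
have [C HC] := continuous2_segment_bounded x0 x1 ca.
pose m := `|M|.
pose D1 := \sum_(i < K) \sum_(e < W.+1) C i e * m ^+ e.
pose D2 := \sum_(i < K) \sum_(e < W.+1) C i e * (e%:R * m ^+ e.-1).
have Cge i e : 0 <= C i e by rewrite ltW // (HC i e).1.
have m0 : 0 <= m by exact: normr_ge0.
have D10 : 0 <= D1.
  by rewrite sumr_ge0 // => i _; rewrite sumr_ge0 // => e _; rewrite mulr_ge0 ?exprn_ge0.
have D20 : 0 <= D2.
  by rewrite sumr_ge0 // => i _; rewrite sumr_ge0 // => e _; rewrite !mulr_ge0 ?exprn_ge0.
have P1 : 0 <= C0 * m ^+ e0 by rewrite mulr_ge0 ?exprn_ge0 // ltW.
have P2 : 0 <= C0 * (e0%:R * m ^+ e0.-1) by rewrite !mulr_ge0 ?exprn_ge0 // ltW.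
exists (1 + C0 * m ^+ e0 + C0 * (e0%:R * m ^+ e0.-1) + D1 + D2); first lra.
move=> eps x L xx eps1 LM'.
have LM : `|L| <= m := le_trans LM' (ler_norm _).
have a0L : `|a0 x * L ^+ e0| <= C0 * m ^+ e0.
  by rewrite normrM normrX ler_pM ?exprn_ge0 ?HC0 // lerXn2r ?nnegrE.
have epsX n : `|eps| ^+ n.+1 <= `|eps|.
  by rewrite exprS ler_piMr // exprn_ile1.
have dif : `|fieldv a0 a eps x L - a0 x * L ^+ e0| <= D1 * `|eps|.
  rewrite /fieldv addrAC subrr add0r.
  apply: le_trans (ler_norm_sum _ _ _) _; rewrite mulr_suml; apply: ler_sum => i _.
  apply: le_trans (ler_norm_sum _ _ _) _; rewrite mulr_suml; apply: ler_sum => e _.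
  rewrite !normrM !normrX mulrC [_ * `|a i e x|]mulrC mulrA ler_pM ?mulr_ge0 ?exprn_ge0 //.
  by rewrite mulrC ler_pM ?exprn_ge0 ?(HC i e).2 // lerXn2r ?nnegrE.
split.
- rewrite -[fieldv _ _ _ _ _](subrK (a0 x * L ^+ e0)).
  apply: le_trans (ler_normD _ _) _.
  have : D1 * `|eps| <= D1 by rewrite ler_piMr.
  lra.
- apply: le_trans dif _; rewrite ler_wpM2r //; lra.
- move=> L' LM''; have {}LM'' : `|L'| <= m := le_trans LM'' (ler_norm _).
  have -> : fieldv a0 a eps x L - fieldv a0 a eps x L' =
     a0 x * (L ^+ e0 - L' ^+ e0) +
     \sum_(i < K) \sum_(e < W.+1) eps ^+ i.+1 * a i e x * (L ^+ e - L' ^+ e).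
    rewrite /fieldv opprD addrACA -mulrBr -sumrB; congr (_ + _).
    apply: eq_bigr => i _; rewrite -sumrB; apply: eq_bigr => e _; by rewrite mulrBr.
  apply: le_trans (ler_normD _ _) _.
  have Q1 : `|a0 x * (L ^+ e0 - L' ^+ e0)| <= C0 * (e0%:R * m ^+ e0.-1) * `|L - L'|.
    by rewrite normrM -mulrA ler_pM ?HC0 // exprn_lipschitz.
  have Q2 : `|\sum_(i < K) \sum_(e < W.+1) eps ^+ i.+1 * a i e x * (L ^+ e - L' ^+ e)|
     <= D2 * `|L - L'|.
    apply: le_trans (ler_norm_sum _ _ _) _; rewrite mulr_suml; apply: ler_sum => i _.
    apply: le_trans (ler_norm_sum _ _ _) _; rewrite mulr_suml; apply: ler_sum => e _.
    rewrite normrM -mulrA; apply: ler_pM => //; last exact: exprn_lipschitz.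
    rewrite normrM normrX.
    rewrite mulrC; apply: le_trans (_ : C i e * 1 <= _); last by rewrite mulr1.
    by rewrite ler_pM ?exprn_ge0 ?(HC i e).2 // exprn_ile1.
  have LL := normr_ge0 (L - L').
  have Q3 : 0 <= (1 + C0 * m ^+ e0 + D1) * `|L - L'| by rewrite mulr_ge0 //; lra.
  lra.
Qed.

End Numeric.

(** * Approximate orbits *)

Section ApproxSolution.
Variable R : realType.
Local Notation S := {poly {poly R}}.
Variables (W e0 k : nat) (al0 be0 r0 : R -> R) (al be : nat -> nat -> R -> R).
Hypothesis al0c : continuous al0.
Hypothesis be0c : continuous be0.
Hypothesis alc : forall i e, continuous (al i e).
Hypothesis bec : forall i e, continuous (be i e).
Hypothesis be0_gt0 : forall x, 0 < be0 x.
Hypothesis e0W : (e0 <= W)%N.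

Local Notation A := (fieldv W e0 k al0 al).
Local Notation B := (fieldv W e0 k be0 be).

(** The logarithmic derivative in the angle of an unperturbed orbit; it is free of L because both
    fields carry the same power L^e0 at order 0. *)
Definition radial_rate x := al0 x / be0 x.

Lemma radial_rate_continuous : continuous radial_rate.
Proof.
move=> x; apply: (@cont_mulf R al0 (fun x => (be0 x)^-1)); first exact: al0c.
by apply: cont_invf; [rewrite gt_eqF|exact: be0c].
Qed.

Lemma integrating_factor_exists : exists r : R -> R, [/\ r 0 = 1, forall x, 0 < r x &
  forall x : R, is_derive x 1 r (r x * radial_rate x)].
Proof.
have [P [P0 dP]] := primitive_exists radial_rate_continuous.
exists (fun x => expR (P x)); split=> [|x|x]; first by rewrite P0 expR0.
  exact: expR_gt0.
exact: (derive_compf (is_derive_expR _) (dP x)).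
Qed.

Hypothesis r0_0 : r0 0 = 1.
Hypothesis r0_gt0 : forall x, 0 < r0 x.
Hypothesis r0_derive : forall x : R, is_derive x 1 r0 (r0 x * radial_rate x).

Definition den0 x := be0 x * r0 x ^+ e0.
Definition den_coef i e x := r0 x ^+ e * be i e x.
(** From L'/L = r'/r + u'/u comes u' B = u (A - [radial_rate] B). The subtraction cancels order 0,
    so that [fnum] starts at order 1 in delta. *)
Definition num_coef i e x := r0 x ^+ e * (al i e x - radial_rate x * be i e x).

Lemma r0_continuous : continuous r0.
Proof. by move=> x; exact: derive_continuous (r0_derive x). Qed.

Lemma den0_continuous : continuous den0.
Proof.
move=> x; apply: (@cont_mulf R be0 (fun x => r0 x ^+ e0)); first exact: be0c.
by apply: cont_expf; exact: r0_continuous.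
Qed.

Lemma den0_neq0 x : den0 x != 0.
Proof. by rewrite mulf_neq0 // ?expf_neq0 // gt_eqF. Qed.

Lemma den_coef_continuous i e : continuous (den_coef i e).
Proof.
move=> x; apply: (@cont_mulf R (fun x => r0 x ^+ e) (be i e)); last exact: bec.
by apply: cont_expf; exact: r0_continuous.
Qed.

Lemma num_coef_continuous i e : continuous (num_coef i e).
Proof.
move=> x; apply: (@cont_mulf R (fun x => r0 x ^+ e) (fun x => al i e x - radial_rate x * be i e x)).
  by apply: cont_expf; exact: r0_continuous.
apply: (@cont_addf R (al i e) (fun x => - (radial_rate x * be i e x))); first exact: alc.
apply: (@cont_oppf R (fun x => radial_rate x * be i e x)).
by apply: (@cont_mulf R radial_rate (be i e)); [exact: radial_rate_continuous|exact: bec].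
Qed.

Definition approx_resid := (@resid R W e0 k den0 den_coef num_coef).

Variables F G : R -> S.
Hypothesis tF : tame W F.
Hypothesis tG : tame W G.
Hypothesis FG : coef_derive F G.
Hypothesis F0 : F 0 = 1.
Hypothesis F1 : forall x, divXn 1 (F x - 1).
Hypothesis FGres : forall x, divXn k.+1 (approx_resid x (F x) (G x)).

(** The formula also has a meaning for negative [l], where no true orbit corresponds to it; the
    symmetry argument uses that half. *)
Definition approx_orbit (x l eps : R) := l * r0 x * (F x).[eps / l ^+ e0, l].
Definition approx_orbit' (x l eps : R) := l * r0 x *
  (radial_rate x * (F x).[eps / l ^+ e0, l] + (G x).[eps / l ^+ e0, l]).

Local Notation Z := approx_orbit.
Local Notation dZ := approx_orbit'.

Lemma approx_orbit_is_derive (l eps x : R) : is_derive x 1 (fun x => Z x l eps) (dZ x l eps).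
Proof.
have H := coef_derive_eval x (eps / l ^+ e0) l tF tG FG.
apply: (derive_eqf (derive_mulf (derive_mulf (derive_cstf l x) (r0_derive x)) H)).
rewrite /dZ; ring.
Qed.

Lemma approx_orbit_at0 l eps : Z 0 l eps = l.
Proof. by rewrite /approx_orbit F0 r0_0 !hornerC !mulr1. Qed.

Lemma fieldv_scale (a0 : R -> R) (a : nat -> nat -> R -> R) x l u eps : l != 0 ->
  fieldv W e0 k a0 a eps x (l * r0 x * u) =
  l ^+ e0 * (a0 x * r0 x ^+ e0 * u ^+ e0 + \sum_(i < k) \sum_(e < W.+1)
    r0 x ^+ e * a i e x * (l ^+ (e0 * i + e) * (eps / l ^+ e0) ^+ i.+1) * u ^+ e).
Proof.
move=> l0; rewrite /fieldv mulrDr; congr (_ + _); first by rewrite !exprMn; ring.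
rewrite mulr_sumr; apply: eq_bigr => i _; rewrite mulr_sumr; apply: eq_bigr => e _.
rewrite !exprMn exprVn -exprM exprD.
have -> : l ^+ (e0 * i.+1) = l ^+ (e0 * i) * l ^+ e0 by rewrite -exprD mulnS addnC.
by field; rewrite !expf_neq0.
Qed.

(** The factor l r0 comes from the orbit and l^e0 from the field. The terms with [radial_rate]
    cancel, which leaves the formal residual evaluated at delta = eps / l^e0. *)
Lemma approx_orbit_residual l eps x : l != 0 ->
  dZ x l eps * B eps x (Z x l eps) - Z x l eps * A eps x (Z x l eps) =
  l ^+ e0.+1 * r0 x * (approx_resid x (F x) (G x)).[eps / l ^+ e0, l].
Proof.
move=> l0; rewrite /approx_orbit !fieldv_scale // /approx_orbit' /approx_resid /resid /fden /fnum.
set d := eps / l ^+ e0; set u := (F x).[d, l]; set v := (G x).[d, l].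
have -> : (G x * ((den0 x)%:P%:P * F x ^+ e0 + pert W e0 k den_coef x (F x)) -
    F x * pert W e0 k num_coef x (F x)).[d, l] =
  v * (den0 x * u ^+ e0 + (pert W e0 k den_coef x (F x)).[d, l]) - u * (pert W e0 k num_coef x (F x)).[d, l].
  by rewrite !hornerE.
rewrite !pert_eval -/u.
set SB := \sum_(i < k) \sum_(e < W.+1) den_coef _ _ _ * _ * _.
set SN := \sum_(i < k) \sum_(e < W.+1) num_coef _ _ _ * _ * _.
have -> : \sum_(i < k) \sum_(e < W.+1) r0 x ^+ e * al i e x *
    (l ^+ (e0 * i + e) * d ^+ i.+1) * u ^+ e = SN + radial_rate x * SB.
  rewrite /SN /SB mulr_sumr -big_split; apply: eq_bigr => i _ /=.
  rewrite mulr_sumr -big_split; apply: eq_bigr => e _ /=.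
  by rewrite /num_coef /den_coef; ring.
have -> : al0 x = radial_rate x * be0 x by rewrite /radial_rate divfK // gt_eqF.
rewrite /den0 exprS; ring.
Qed.

Lemma approx_orbit_estimates (x0 x1 a b : R) : 0 < a -> exists2 C, 0 < C & exists2 eps1, 0 < eps1 &
  forall x l eps, x0 <= x <= x1 -> a <= `|l| <= b -> `|eps| < eps1 ->
  [/\ `|dZ x l eps * B eps x (Z x l eps) - Z x l eps * A eps x (Z x l eps)| <= C * `|eps| ^+ k.+1,
      `|dZ x l eps| <= C & `|Z x l eps - l * r0 x| <= C * `|eps|].
Proof.
move=> a0.
have div0 (p : S) : divXn 0 p by exists p; rewrite expr0 mulr1.
have tF1 : tame W (fun x => F x - 1) by apply: tameD => //; apply: tameN; exact: tame1.
have tRes : tame W (fun x => approx_resid x (F x) (G x)).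
  apply: tame_resid => //; [exact: den0_continuous|exact: den_coef_continuous|exact: num_coef_continuous].
have [c1 c10 H1] := tame_eval_bound x0 x1 b tF (fun x => div0 (F x)).
have [c2 c20 H2] := tame_eval_bound x0 x1 b tG (fun x => div0 (G x)).
have [c3 c30 H3] := tame_eval_bound x0 x1 b tF1 F1.
have [c4 c40 H4] := tame_eval_bound x0 x1 b tRes FGres.
have [c5 c50 H5] := continuous_segment_bounded x0 x1 r0_continuous.
have [c6 c60 H6] := continuous_segment_bounded x0 x1 radial_rate_continuous.
have ae : 0 < a ^+ e0 by rewrite exprn_gt0.
pose m := `|b|.
have m0 : 0 <= m := normr_ge0 _.
pose D1 := m ^+ e0.+1 * c5 * (c4 * (a ^+ e0)^-1 ^+ k.+1).
pose D2 := m * c5 * (c6 * c1 + c2).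
pose D3 := m * c5 * (c3 * (a ^+ e0)^-1).
have D10 : 0 <= D1.
  by rewrite /D1 !mulr_ge0 ?exprn_ge0 ?invr_ge0 ?exprn_ge0 // ltW.
have D20 : 0 <= D2 by rewrite /D2 !mulr_ge0 ?addr_ge0 ?mulr_ge0 // ltW.
have D30 : 0 <= D3 by rewrite /D3 !mulr_ge0 ?invr_ge0 ?exprn_ge0 // ltW.
exists (1 + D1 + D2 + D3); first lra.
(* This threshold keeps delta = eps / l^e0 at absolute value at most 1, as [tame_eval_bound]
   demands. *)
exists (a ^+ e0) => // x l eps xx /andP[al_ lb] epsa.
have lm : `|l| <= m := le_trans lb (ler_norm _).
have l0 : l != 0 by rewrite -normr_gt0 (lt_le_trans a0).
have dle : `|eps / l ^+ e0| <= `|eps| / a ^+ e0.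
  rewrite normrM normfV normrX ler_wpM2l // lef_pV2 ?posrE ?exprn_gt0 ?normr_gt0 //.
  by rewrite lerXn2r ?nnegrE // ltW.
have d1 : `|eps / l ^+ e0| <= 1.
  by apply: le_trans dle _; rewrite ler_pdivrMr // mul1r ltW.
have lr : `|l * r0 x| <= m * c5 by rewrite normrM ler_pM ?H5.
split.
- rewrite approx_orbit_residual // normrM.
  apply: le_trans (_ : D1 * `|eps| ^+ k.+1 <= _); last by rewrite ler_wpM2r ?exprn_ge0 //; lra.
  rewrite /D1 -!mulrA mulrA ler_pM //.
    rewrite normrM normrX ler_pM ?exprn_ge0 ?H5 // lerXn2r ?nnegrE //.
  apply: le_trans (H4 _ _ _ xx d1 lb) _; rewrite ler_wpM2l ?(ltW c40) //.
  rewrite [leRHS]mulrC -exprMn lerXn2r ?nnegrE // mulr_ge0 // invr_ge0.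
  exact: ltW.
- apply: le_trans (_ : D2 <= _); last lra.
  rewrite /approx_orbit' normrM ler_pM //.
  apply: le_trans (ler_normD _ _) _; rewrite lerD //.
    rewrite normrM ler_pM ?H6 //.
    by have := H1 _ _ _ xx d1 lb; rewrite expr0 mulr1.
  by have := H2 _ _ _ xx d1 lb; rewrite expr0 mulr1.
- have -> : Z x l eps - l * r0 x = l * r0 x * (F x - 1).[eps / l ^+ e0, l].
    by rewrite /approx_orbit !hornerE; ring.
  apply: le_trans (_ : D3 * `|eps| <= _); last by rewrite ler_wpM2r //; lra.
  rewrite normrM /D3 -mulrA ler_pM //.
  apply: le_trans (H3 _ _ _ xx d1 lb) _; rewrite expr1 -mulrA ler_wpM2l ?(ltW c30) //.
  by rewrite [leRHS]mulrC.
Qed.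

(* On the region [lam <= |L| <= Lam] the angular component keeps the sign of its
   unperturbed part, so the angle can serve as the independent variable. *)
Lemma angular_lower_bound (x0 x1 lam Lam : R) : 0 < lam ->
  exists2 c, 0 < c & exists2 eps1, 0 < eps1 & forall x L eps,
   x0 <= x <= x1 -> lam <= `|L| <= Lam -> `|eps| < eps1 ->
   c <= `|B eps x L| /\ (0 < L -> 0 < B eps x L).
Proof.
move=> lam0.
have [c c0 Hc] : exists2 c, 0 < c & forall x, x0 <= x <= x1 -> c <= be0 x.
  by apply: continuous_segment_gt0 => // x _; exact: be0_gt0.
have [C C0 HC] := fieldv_estimates W e0 k x0 x1 Lam be0c bec.
have le : 0 < lam ^+ e0 by rewrite exprn_gt0.
have D0 : 0 < c * lam ^+ e0 / 2 by rewrite divr_gt0 // mulr_gt0.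
exists (c * lam ^+ e0 / 2) => //; exists (Num.min 1 (c * lam ^+ e0 / 2 / C)).
  by rewrite lt_min ltr01 divr_gt0.
move=> x L eps xx /andP[L1 L2]; rewrite lt_min => /andP[e1 e2].
have [_ H _] := HC eps x L xx (ltW e1) L2.
rewrite ltr_pdivlMr // in e2; rewrite [C * _]mulrC in H.
have H2 : c * lam ^+ e0 <= `|be0 x * L ^+ e0|.
  rewrite normrM normrX ler_pM ?(ltW c0) ?(ltW le) //.
    by apply: le_trans (Hc x xx) (ler_norm _).
  by rewrite lerXn2r ?nnegrE // ltW.
have H3 := le_lt_trans H e2.
split.
  have := ler_normB (B eps x L) (B eps x L - be0 x * L ^+ e0).
  rewrite opprB addrCA subrr addr0; lra.
move=> Lp; have H4 : `|be0 x * L ^+ e0| = be0 x * L ^+ e0.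
  by rewrite gtr0_norm // mulr_gt0 ?exprn_gt0.
rewrite H4 in H2; move: H3; rewrite ltr_norml => /andP[]; lra.
Qed.

(** When [eta] is below half of the lower bound [c] of the angular field, the angle [p] grows at
    least at the rate c / 2 times |q|. It can then be the clock of the Gronwall estimate, and the
    second conclusion follows as well. *)
Lemma approx_orbit_compare (x0 x1 a b lam Lam : R) : 0 < a -> 0 < lam ->
  exists2 C, 0 < C & exists2 eps1, 0 < eps1 &
  forall (l eps eta T : R) (L p dL dp q : R -> R), a <= `|l| <= b -> `|eps| < eps1 ->
  0 <= T -> 0 <= eta < eps1 ->
  (forall t : R, 0 <= t <= T -> is_derive t 1 L (dL t)) ->
  (forall t : R, 0 <= t <= T -> is_derive t 1 p (dp t)) ->
  (forall t : R, 0 <= t <= T -> x0 <= p t <= x1 /\ lam <= `|L t| <= Lam) ->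
  (forall t : R, 0 <= t <= T -> `|dL t - q t * (L t * A eps (p t) (L t))| <= `|q t| * eta) ->
  (forall t : R, 0 <= t <= T -> `|dp t - q t * B eps (p t) (L t)| <= `|q t| * eta) ->
  (forall t : R, 0 <= t <= T -> 0 <= q t * B eps (p t) (L t)) ->
  L 0 = Z (p 0) l eps ->
  `|L T - Z (p T) l eps| <= C * (eta + `|eps| ^+ k.+1) /\
  (forall t : R, 0 <= t <= T -> q t != 0 -> 0 < dp t).
Proof.
move=> a0 lam0.
have ar1 (u v w x y z : R) : - u <= v - w -> x = w -> y <= x -> u <= z -> y = 2 * z -> z <= v.
  by move=> *; lra.
have ar2 (u v w x y z : R) : u <= x -> x <= y -> v <= w -> 0 <= z -> u + v <= z + w + y.
  by move=> *; lra.
have ar3 (u v w x y z E1 M2 C13 d r s : R) : z <= w + x -> w <= u + v -> u <= E1 * d ->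
    v <= M2 * d -> x <= C13 * d -> y <= r -> 0 <= s -> z + y <= (E1 + M2 + C13) * d + s + r.
  by rewrite !mulrDl => *; lra.
have ar4 (u v w : R) : 0 <= w * u -> 0 <= v -> u + w * v <= (1 + w) * (u + v).
  by move=> *; lra.
have [C1 C10 [e1 e10 H1]] := approx_orbit_estimates x0 x1 b a0.
have [c c0 [e2 e20 H2]] := angular_lower_bound x0 x1 Lam lam0.
have [c5 c50 H5] := continuous_segment_bounded x0 x1 r0_continuous.
(* A common bound for the given radius, at most [Lam], and for the approximate one, which is within
   C1 of l r0; the Lipschitz constants of the field are taken on this range. *)
pose M := `|Lam| + `|b| * c5 + C1.
have P1 := normr_ge0 Lam; have P2 : 0 <= `|b| * c5 by rewrite mulr_ge0 // ltW.
have [C2 C20 H6] := fieldv_estimates W e0 k x0 x1 M al0c alc.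
have [C3 C30 H7] := fieldv_estimates W e0 k x0 x1 M be0c bec.
pose KK := C2 + M * C2 + C1 * C3.
have M0 : 0 <= M by rewrite /M; lra.
have P3 : 0 <= M * C2 by rewrite mulr_ge0 // ltW.
have P4 : 0 <= C1 * C3 by rewrite mulr_ge0 // ltW.
have KK0 : 0 <= KK by rewrite /KK !addr_ge0 // ltW.
have c20 : 0 < c / 2 by rewrite divr_gt0.
pose DD := (2 + C1) / (c / 2) * expR ((2 * (KK / (c / 2)) + 1) * (x1 - x0)).
have DD0 : 0 < DD.
  by rewrite mulr_gt0 ?expR_gt0 // divr_gt0 // addr_gt0.
exists (DD * (1 + C1)); first by rewrite mulr_gt0 // addr_gt0.
exists (Num.min (Num.min e1 e2) (Num.min 1 (c / 2))).
  by rewrite !lt_min e10 e20 ltr01 c20.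
move=> l eps eta T L p dL dp q /andP[al_ lb]; rewrite !lt_min.
move=> /andP[/andP[ee1 ee2] /andP[ee3 ee4]] T0.
move=> /andP[eta0 /andP[/andP[eta1 eta2] /andP[eta3 eta4]]].
move=> HL Hp Hr HdL Hdp Hq L0.
have lb' : a <= `|l| <= b by rewrite al_ lb.
have cq t : 0 <= t <= T -> c / 2 * `|q t| <= dp t.
  move=> tT; have [px Lx] := Hr t tT.
  have [cB _] := H2 _ _ _ px Lx ee2.
  have := Hdp t tT; rewrite ler_norml => /andP[D1 D2].
  have := Hq t tT => /ger0_norm; rewrite normrM => qB.
  have := normr_ge0 (q t) => q0.
  have N1 : `|q t| * c <= `|q t| * `|B eps (p t) (L t)| by rewrite ler_wpM2l.
  have N2 : `|q t| * eta <= `|q t| * (c / 2) by rewrite ler_wpM2l // ltW.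
  have N3 : `|q t| * c = 2 * (`|q t| * (c / 2)) by field.
  rewrite [c / 2 * _]mulrC; exact: ar1 D1 qB N1 N2 N3.
split; last first.
  by move=> t tT q0; apply: lt_le_trans (cq t tT); rewrite mulr_gt0 // normr_gt0.
have LE : `|L T - Z (p T) l eps| <= (2 + C1) / (c / 2) * (eta + C1 * `|eps| ^+ k.+1) *
   expR ((2 * (KK / (c / 2)) + 1) * (p T - p 0)).
  apply: (@orbit_compare R L p dL dp q (fun t => L t * A eps (p t) (L t))
    (fun t => B eps (p t) (L t)) (fun x => Z x l eps) (fun t => dZ (p t) l eps)) => //.
  - exact: ltW.
  - by rewrite addr_ge0 // mulr_ge0 ?exprn_ge0 // ltW.
  - by move=> t tT; exact: approx_orbit_is_derive.
  - move=> t tT; apply: le_trans (HdL t tT) _; rewrite ler_wpM2l // lerDl.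
    by rewrite mulr_ge0 ?exprn_ge0 // ltW.
  - move=> t tT; apply: le_trans (Hdp t tT) _; rewrite ler_wpM2l // lerDl.
    by rewrite mulr_ge0 ?exprn_ge0 // ltW.
  - by move=> t tT; have [px _] := Hr t tT; have [] := H1 _ _ _ px lb' ee1.
  - move=> t tT; have [px /andP[Lx1 Lx2]] := Hr t tT.
    have [Q1 Q2 Q3] := H1 _ _ _ px lb' ee1.
    set z := Z (p t) l eps in Q1 Q2 Q3 *; set dz := dZ (p t) l eps in Q1 Q2 *.
    have Lt : `|L t| <= M by apply: le_trans Lx2 _; apply: le_trans (ler_norm _) _;
      rewrite /M -addrA lerDl addr_ge0 // ltW.
    have zM : `|z| <= M.
      rewrite -[z](subrK (l * r0 (p t))); apply: le_trans (ler_normD _ _) _.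
      have : `|l * r0 (p t)| <= `|b| * c5.
        by rewrite normrM ler_pM ?H5 // (le_trans lb (ler_norm _)).
      have : C1 * `|eps| <= C1 by rewrite ler_piMr ?ltW.
      by move=> T1 T2; exact: ar2 Q3 T1 T2 P1.
    have [A1 _ /(_ _ Lt) A2] := H6 eps (p t) z px (ltW ee3) zM.
    have [_ _ /(_ _ Lt) A3] := H7 eps (p t) z px (ltW ee3) zM.
    (* The first three terms are linear in the deviation [L t - z] up to bounded factors, and the
       last one is the residual of the approximate orbit. *)
    have -> : L t * A eps (p t) (L t) - dz * B eps (p t) (L t) =
      (L t - z) * A eps (p t) z - L t * (A eps (p t) z - A eps (p t) (L t))
      + dz * (B eps (p t) z - B eps (p t) (L t)) - (dz * B eps (p t) z - z * A eps (p t) z) by ring.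
    rewrite (distrC z (L t)) in A2 A3.
    have B1 : `|(L t - z) * A eps (p t) z| <= C2 * `|L t - z|.
      by rewrite normrM mulrC ler_wpM2r.
    have B2 : `|L t * (A eps (p t) z - A eps (p t) (L t))| <= M * C2 * `|L t - z|.
      by rewrite normrM -mulrA ler_pM.
    have B3 : `|dz * (B eps (p t) z - B eps (p t) (L t))| <= C1 * C3 * `|L t - z|.
      by rewrite normrM -mulrA ler_pM.
    apply: le_trans (ler_normB _ _) _; rewrite addrA.
    have E1 := ler_normD ((L t - z) * A eps (p t) z - L t * (A eps (p t) z - A eps (p t) (L t)))
       (dz * (B eps (p t) z - B eps (p t) (L t))).
    have E2 := ler_normB ((L t - z) * A eps (p t) z) (L t * (A eps (p t) z - A eps (p t) (L t))).
    rewrite /KK; exact: ar3 E1 E2 B1 B2 B3 Q1 eta0.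
apply: le_trans LE _.
have TT : 0 <= T <= T by rewrite T0 lexx.
have T00 : 0 <= (0 : R) <= T by rewrite T0 lexx.
have [/andP[p1 p2] _] := Hr _ TT; have [/andP[p3 p4] _] := Hr _ T00.
have X1 : expR ((2 * (KK / (c / 2)) + 1) * (p T - p 0)) <=
          expR ((2 * (KK / (c / 2)) + 1) * (x1 - x0)).
  rewrite ler_expR ler_wpM2l //; last by rewrite lerB.
  by rewrite addr_ge0 // mulr_ge0 // divr_ge0 // ltW.
have X2 : eta + C1 * `|eps| ^+ k.+1 <= (1 + C1) * (eta + `|eps| ^+ k.+1).
  by apply: ar4; rewrite ?exprn_ge0 // mulr_ge0 // ltW.
have X3 : 0 <= eta + C1 * `|eps| ^+ k.+1 by rewrite addr_ge0 // mulr_ge0 ?exprn_ge0 // ltW.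
have C12 : 0 <= 2 + C1 by rewrite addr_ge0 // ltW.
have X4 : 0 <= (2 + C1) / (c / 2) by rewrite divr_ge0 ?(ltW c20).
rewrite /DD -!mulrA ler_wpM2l //.
rewrite -?mulrA.
have X5 : 0 < (c / 2)^-1 by rewrite invr_gt0.
rewrite ler_wpM2l ?(ltW X5) //.
rewrite mulrC; apply: le_trans (ler_pM (expR_ge0 _) X3 X1 X2) _.
by rewrite !mulrA.
Qed.

End ApproxSolution.

(** * Elementary facts on small quantities, norms and angle ranges *)

Section Aux.
Variable R : realType.

Lemma poly_eq0_pos (p : {poly R}) : (forall l, 0 < l -> p.[l] = 0) -> p = 0.
Proof.
move=> H; apply/eqP; apply: contraT => p0.
have := max_poly_roots p0 (rs := mkseq (fun i => i.+1%:R) (size p)).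
rewrite size_mkseq ltnn; apply.
  by apply/allP => x /mapP[i _ ->]; rewrite rootE H.
rewrite mkseq_uniq // => i j /eqP; rewrite eqr_nat => /eqP[]; exact.
Qed.

Lemma derive_locally_lipschitz (f : R -> R) (x d : R) : is_derive x 1 f d ->
  exists2 C, 0 < C & exists2 r, 0 < r & forall y, `|y - x| < r -> `|f y - f x| <= C * `|y - x|.
Proof.
move=> /is_derive1_caratheodory[h [fE ch hx]].
have cn : {for x, continuous (fun z => `|h z|)}.
  by apply: cont_compf => //; exact: norm_continuous.
have [|r r0 Hr] := continuous_near_lt cn (c := `|h x| + 1); first by rewrite ltrDl.
exists (`|h x| + 1); first by rewrite ltr_wpDl.
by exists r => // y yx; rewrite fE normrM ler_wpM2r // ltW // Hr.
Qed.

Lemma small_le_eq0 (v C eps1 : R) : 0 < eps1 ->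
  (forall eps, 0 < eps < eps1 -> `|v| <= C * eps) -> v = 0.
Proof.
move=> e0 H; apply/eqP; apply: contraT; rewrite -normr_gt0 => v0.
have C0 : 0 < C.
  have := H (eps1 / 2); rewrite divr_gt0 //= => /(_ _) Hc.
  have e2 : eps1 / 2 < eps1 by lra.
  have := lt_le_trans v0 (Hc e2); rewrite pmulr_lgt0 // divr_gt0 //.
pose e := Num.min (eps1 / 2) (`|v| / (2 * C)).
have ep : 0 < e by rewrite lt_min !divr_gt0 // mulr_gt0.
have el : e < eps1 by rewrite gt_min; apply/orP; left; lra.
have := H e; rewrite ep el => /(_ isT).
have : C * e <= `|v| / 2.
  apply: le_trans (_ : C * (`|v| / (2 * C)) <= _).
    by rewrite ler_wpM2l ?(ltW C0) // ge_min lexx orbT.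
  rewrite le_eqVlt; apply/orP; left; apply/eqP; field; rewrite gt_eqF //.
lra.
Qed.
Lemma norm_near_range (z w e lo hi : R) : `|z - w| <= e -> e + lo <= `|w| -> `|w| <= hi ->
  lo <= `|z| <= hi + e.
Proof.
move=> H1 H2 H3.
have N1 := ler_normB z (z - w); have N2 := ler_normD (z - w) w.
rewrite opprB addrCA subrr addr0 in N1; rewrite subrK in N2.
by apply/andP; split; lra.
Qed.

Lemma norm_near_half (z w : R) : `|z - w| <= `|w| / 2 -> `|w| / 2 <= `|z| <= 2 * `|w|.
Proof.
move=> H; have Hw : `|w| / 2 + `|w| / 2 <= `|w| by rewrite -splitr.
have /andP[-> H2] := norm_near_range H Hw (lexx _).
by apply: le_trans H2 _; have := normr_ge0 w; lra.
Qed.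

Lemma shift_in_range (x t p : R) : 0 <= p -> 0 <= t <= x -> x <= p -> -1 <= t + p <= p + p.
Proof. by move=> p0 /andP[t0 tx] xp; apply/andP; split; lra. Qed.

Lemma reflect_in_range (a b x t p : R) : 0 <= p -> 0 <= x <= p ->
  (b = 1 /\ a = x) \/ (b = -1 /\ a = x + p) -> 0 <= t <= p -> -1 <= a + b * t <= p + p.
Proof.
move=> p0 /andP[x0 xp] ab /andP[t0 tp].
by apply/andP; case: ab => [[-> ->]|[-> ->]]; split; lra.
Qed.
End Aux.

(** * The displacement after one turn and its parity *)

Section Symmetry.
Variable R : realType.
Local Notation S := {poly {poly R}}.
Variables (W e0 k : nat) (al0 be0 r0 : R -> R) (al be : nat -> nat -> R -> R).
Hypothesis al0c : continuous al0.
Hypothesis be0c : continuous be0.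
Hypothesis alc : forall i e, continuous (al i e).
Hypothesis bec : forall i e, continuous (be i e).
Hypothesis be0_gt0 : forall x, 0 < be0 x.
Hypothesis e0W : (e0 <= W)%N.
Hypothesis k0 : (0 < k)%N.
Local Notation A := (fieldv W e0 k al0 al).
Local Notation B := (fieldv W e0 k be0 be).
Hypothesis r0_0 : r0 0 = 1.
Hypothesis r0_gt0 : forall x, 0 < r0 x.
Hypothesis r0_derive : forall x : R, is_derive x 1 r0 (r0 x * radial_rate al0 be0 x).
Variables F G : R -> S.
Hypothesis tF : tame W F.
Hypothesis tG : tame W G.
Hypothesis FG : coef_derive F G.
Hypothesis F0 : F 0 = 1.
Hypothesis F1 : forall x, divXn 1 (F x - 1).
Hypothesis FGres : forall x, divXn k.+1 (approx_resid W e0 k al0 be0 r0 al be x (F x) (G x)).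
Hypothesis Fk : forall x i, (k < i)%N -> (F x)`_i = 0.
Local Notation Z := (approx_orbit e0 r0 F).
Local Notation dZ := (approx_orbit' e0 al0 be0 r0 F G).

Lemma F_coef0 x : (F x)`_0 = 1.
Proof.
by have := divXn_coef (F1 x) (ltn0Sn 0); rewrite coefB coef1 /= => /subr0_eq.
Qed.

Lemma approx_orbit_expansion x l eps : Z x l eps =
  r0 x * l + \sum_(i < k) eps ^+ i.+1 * (r0 x * (l * (l ^+ e0)^-1 ^+ i.+1 * ((F x)`_i.+1).[l])).
Proof.
rewrite /approx_orbit.
have -> : (F x).[eps / l ^+ e0, l] = \sum_(i < k.+1) (eps / l ^+ e0) ^+ i * ((F x)`_i).[l].
  rewrite (@horner_coef_wide _ k.+1 (F x)); last by apply/leq_sizeP => i; exact: Fk.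
  rewrite horner_sum; apply: eq_bigr => i _; rewrite -polyC_exp mulrC hornerCM.
  by rewrite mulrC.
rewrite big_ord_recl F_coef0 hornerC expr0 mulr1 mulrDr mulr1 mulr_sumr [r0 x * l]mulrC.
congr (_ + _); apply: eq_bigr => i _; rewrite exprMn; ring.
Qed.

(** At eps = 0 the orbit is exactly linear in its initial value, so the nonlinear part of the
    increment carries a factor eps. With l' - l of size eps^k the error has order k + 1. *)
Lemma approx_orbit_near_lipschitz x l : l != 0 ->
  exists2 C, 0 < C & exists2 r, 0 < r & forall l' eps, `|l' - l| < r -> `|eps| <= 1 ->
    `|Z x l' eps - Z x l eps - r0 x * (l' - l)| <= C * `|eps| * `|l' - l|.
Proof.
move=> l0.
pose rho i l := r0 x * (l * (l ^+ e0)^-1 ^+ i.+1 * ((F x)`_i.+1).[l]).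
have /choice[C HC] : forall i, exists C, 0 < C /\ exists r, 0 < r /\
   forall l', `|l' - l| < r -> `|rho i l' - rho i l| <= C * `|l' - l|.
  move=> i.
  have H1 := @derive_invf R (fun z => z ^+ e0) _ l (expf_neq0 e0 l0) (derive_expf e0 (derive_idf l)).
  have H2 := derive_mulf (derive_idf l) (derive_expf i.+1 H1).
  have H3 := derive_mulf (derive_cstf (r0 x) l) (derive_mulf H2 (is_derive_poly (F x)`_i.+1 l)).
  have [C C0 [r rp Hr]] := derive_locally_lipschitz H3.
  by exists C; split => //; exists r.
have /choice[r Hr] : forall i, exists r, 0 < r /\
   forall l', `|l' - l| < r -> `|rho i l' - rho i l| <= C i * `|l' - l|.
  by move=> i; have [_ [r]] := HC i; exists r.
have [r' r'0 r'le] : exists2 r', 0 < r' & forall i, (i < k)%N -> r' <= r i.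
  elim: (k) => [|n [r' r'0 H]]; first by exists 1.
  exists (Num.min r' (r n)); first by rewrite lt_min r'0 (Hr n).1.
  move=> i; rewrite ltnS leq_eqVlt => /orP[/eqP ->|/H]; rewrite ge_min.
    by rewrite lexx orbT.
  by move=> ->.
exists (1 + \sum_(i < k) C i).
  by rewrite ltr_pwDl // sumr_ge0 // => i _; rewrite ltW // (HC i).1.
exists r' => // l' eps ll eps1.
have -> : Z x l' eps - Z x l eps - r0 x * (l' - l) =
  \sum_(i < k) eps ^+ i.+1 * (rho i l' - rho i l).
  have -> : \sum_(i < k) eps ^+ i.+1 * (rho i l' - rho i l) =
      \sum_(i < k) eps ^+ i.+1 * rho i l' - \sum_(i < k) eps ^+ i.+1 * rho i l.
    by rewrite -sumrB; apply: eq_bigr => i _; rewrite mulrBr.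
  by rewrite !approx_orbit_expansion /rho; ring.
apply: le_trans (ler_norm_sum _ _ _) _.
rewrite -mulrA mulrDl mul1r; apply: ler_wpDl; first by rewrite mulr_ge0.
rewrite mulr_suml; apply: ler_sum => i _; rewrite normrM normrX mulrCA.
apply: ler_pM => //.
  by rewrite exprS ler_piMr // exprn_ile1.
by apply: (Hr i).2; apply: lt_le_trans ll (r'le i _).
Qed.

Lemma approx_orbit_range (x1 b : R) (l : R) : l != 0 ->
  exists lam Lam eps1, [/\ 0 < lam, 0 < eps1 &
   forall x eps, -1 <= x <= x1 -> `|eps| < eps1 -> lam <= `|Z x l eps| <= Lam].
Proof.
move=> l0; have lp : 0 < `|l| by rewrite normr_gt0.
have [C C0 [e1 e10 H]] := approx_orbit_estimates al0c be0c alc bec be0_gt0 e0W r0_derive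
  tF tG F1 FGres (-1) x1 `|l| lp.
have cr := r0_continuous r0_derive.
have [c c0 Hc] : exists2 c, 0 < c & forall x, -1 <= x <= x1 -> c <= r0 x.
  by apply: continuous_segment_gt0.
have [D D0 HD] := continuous_segment_bounded (-1) x1 cr.
exists (`|l| * c / 2), (`|l| * D + `|l| * c / 2), (Num.min e1 (`|l| * c / 2 / C)).
have P : 0 < `|l| * c / 2 by rewrite divr_gt0 // mulr_gt0.
split => //; first by rewrite lt_min e10 divr_gt0.
move=> x eps xx; rewrite lt_min => /andP[ee]; rewrite ltr_pdivlMr // => ee2.
have ll : `|l| <= `|l| <= `|l| by rewrite lexx.
have [_ _ H1] := H x l eps xx ll ee.
have H2 : `|l| * c <= `|l * r0 x| by rewrite normrM ler_wpM2l // (le_trans (Hc x xx)) // ler_norm.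
have H3 : `|l * r0 x| <= `|l| * D by rewrite normrM ler_wpM2l // HD.
apply: (norm_near_range (le_trans H1 _) _ H3); first by rewrite mulrC ltW.
by rewrite -splitr.
Qed.

Lemma approx_orbit_compare_angle (x1 a b lam Lam : R) : 0 < a -> 0 < lam ->
  exists2 C, 0 < C & exists2 eps1, 0 < eps1 &
  forall (l eps eta T : R) (L dL : R -> R), a <= `|l| <= b -> `|eps| < eps1 ->
  0 <= T <= x1 -> 0 <= eta < eps1 ->
  (forall t : R, 0 <= t <= T -> is_derive t 1 L (dL t)) ->
  (forall t : R, 0 <= t <= T -> lam <= `|L t| <= Lam) ->
  (forall t : R, 0 <= t <= T -> `|dL t * B eps t (L t) - L t * A eps t (L t)| <= eta) ->
  L 0 = l ->
  `|L T - Z T l eps| <= C * (eta + `|eps| ^+ k.+1).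
Proof.
move=> a0 lam0.
have [C C0 [e1 e10 H1]] := approx_orbit_compare al0c be0c alc bec be0_gt0 e0W r0_derive
  tF tG FG F1 FGres 0 x1 b Lam a0 lam0.
have [c c0 [e2 e20 H2]] := angular_lower_bound W e0 k be0c bec be0_gt0 0 x1 Lam lam0.
exists C => //; exists (Num.min e1 e2); first by rewrite lt_min e10.
move=> l eps eta T L dL lb; rewrite !lt_min => /andP[ee1 ee2] /andP[T0 T1].
move=> /andP[eta0 /andP[eta1 eta2]] HL Hr HLL L0.
(* With the angle itself as parameter, this choice makes the angular error vanish identically and
   turns the defect into the radial error. *)
pose q t := (B eps t (L t))^-1.
have Bn t : 0 <= t <= T -> B eps t (L t) != 0.
  move=> tT; have /andP[t0 tT'] := tT.
  have tx : 0 <= t <= x1 by rewrite t0 (le_trans tT').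
  have [Hc _] := H2 _ _ _ tx (Hr t tT) ee2.
  by rewrite -normr_gt0 (lt_le_trans c0).
suff [] : `|L T - Z (id T) l eps| <= C * (eta + `|eps| ^+ k.+1) /\
  (forall t : R, 0 <= t <= T -> q t != 0 -> 0 < (1 : R)) by [].
apply: (H1 l eps eta T L id dL (fun=> 1) q) => //.
- by rewrite eta0.
- by move=> t tT; split; [|exact: Hr]; case/andP: tT => t0 tT; rewrite t0 (le_trans tT).
- move=> t tT; have -> : dL t - q t * (L t * A eps t (L t)) =
     q t * (dL t * B eps t (L t) - L t * A eps t (L t)).
    by rewrite /q; field; exact: Bn.
  by rewrite normrM ler_wpM2l // HLL.
- by move=> t tT; rewrite /q mulVf ?Bn // subrr normr0 mulr_ge0.
- by move=> t tT; rewrite /q mulVf ?Bn.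
- by rewrite /= approx_orbit_at0.
Qed.

Hypothesis A_periodic : forall eps x L, A eps (x + 2 * pi) L = A eps x L.
Hypothesis B_periodic : forall eps x L, B eps (x + 2 * pi) L = B eps x L.
Hypothesis r0_2pi : r0 (2 * pi) = 1.
Hypothesis F_2pi : forall i, (0 < i < k)%N -> (F (2 * pi))`_i = 0.

(** The coefficient of eps^k in the displacement after one turn: the Melnikov function in terms of
    the weighted radius, continued to negative [l]. *)
Definition jump (l : R) := l * (l ^+ e0)^-1 ^+ k * ((F (2 * pi))`_k).[l].

Lemma approx_orbit_2pi l eps : Z (2 * pi) l eps = l + eps ^+ k * jump l.
Proof.
have [n kn] : exists n, k = n.+1 by case: (k) k0 => [//|n] _; exists n.
rewrite approx_orbit_expansion r0_2pi mul1r /jump kn big_ord_recr big1 /= => [|i _]; last first.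
  rewrite F_2pi; last by rewrite kn /= ltnS ltn_ord.
  by rewrite horner0 !mulr0.
by rewrite add0r mul1r.
Qed.

Lemma jump_derivable (l : R) : l != 0 -> exists d, is_derive l 1 jump d.
Proof.
move=> l0; eexists.
have H1 := @derive_invf R (fun z => z ^+ e0) _ l (expf_neq0 e0 l0) (derive_expf e0 (derive_idf l)).
have H2 := derive_mulf (derive_idf l) (derive_expf k H1).
exact: (derive_mulf H2 (is_derive_poly (F (2 * pi))`_k l)).
Qed.

Lemma twopi_gt0 : 0 < 2 * pi :> R. Proof. by rewrite mulr_gt0 ?pi_gt0. Qed.

(** By periodicity, the second turn of the approximate orbit nearly follows the one that starts at
    l' = l + eps^k [jump l]. Moving the initial value from l to l' shifts that orbit at angle x by
    [r0 x] (l' - l) to leading order. *)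
Lemma jump_at x l : 0 <= x <= 2 * pi -> l != 0 ->
  exists2 C, 0 < C & exists2 eps1, 0 < eps1 & forall eps, `|eps| < eps1 ->
    `|Z (x + 2 * pi) l eps - Z x l eps - r0 x * (eps ^+ k * jump l)| <= C * `|eps| ^+ k.+1.
Proof.
move=> /andP[x0 x2] l0; have lp : 0 < `|l| by rewrite normr_gt0.
have pp := twopi_gt0.
pose X : R := 4 * pi.
have XE : X = 2 * pi + 2 * pi by rewrite /X; ring.
have [C1 C10 [e1 e10 H1]] := approx_orbit_estimates al0c be0c alc bec be0_gt0 e0W r0_derive
  tF tG F1 FGres (-1) X `|l| lp.
have [lam [Lam [e2 [lam0 e20 H2]]]] := approx_orbit_range X 0 l0.
have l20 : 0 < `|l| / 2 by rewrite divr_gt0.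
have [C3 C30 [e3 e30 H3]] := approx_orbit_compare_angle X (2 * `|l|) Lam l20 lam0.
have [C4 C40 [r4 r40 H4]] := approx_orbit_near_lipschitz x l0.
pose J := `|jump l| + 1.
have J0 : 0 < J by rewrite ltr_wpDl.
pose e5 := Num.min (`|l| / 2) r4 / J.
have e50 : 0 < e5 by rewrite divr_gt0 // lt_min l20.
pose e6 := e3 / C1.
have e60 : 0 < e6 by rewrite divr_gt0.
exists (C3 * (C1 + 1) + C4 * J).
  by rewrite addr_gt0 // mulr_gt0 // addr_gt0.
exists (Num.min (Num.min e1 e2) (Num.min (Num.min e3 1) (Num.min e5 e6))).
  by rewrite !lt_min e10 e20 e30 e50 e60 ltr01.
move=> eps; rewrite !lt_min => /andP[/andP[E1 E2] /andP[/andP[E3 E4] /andP[E5 E6]]].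
have epsX n : `|eps| ^+ n.+1 <= `|eps| by rewrite exprS ler_piMr // exprn_ile1 // ltW.
pose l' := l + eps ^+ k * jump l.
have ll' : l' - l = eps ^+ k * jump l by rewrite /l' addrAC subrr add0r.
have ll : `|l' - l| <= `|eps| ^+ k * J.
  by rewrite ll' normrM normrX ler_wpM2l ?exprn_ge0 // lerDl.
have ll2 : `|l' - l| < Num.min (`|l| / 2) r4.
  apply: le_lt_trans ll _; rewrite -ltr_pdivlMr //.
  by apply: le_lt_trans E5; case: (k) k0 => // n _; exact: epsX.
rewrite lt_min in ll2; case/andP: ll2 => ll2 ll3.
have l'b : `|l| / 2 <= `|l'| <= 2 * `|l|.
  exact: norm_near_half (ltW ll2).
have lb : `|l| <= `|l| <= `|l| by rewrite lexx.
have shiftd (t : R) : is_derive t 1 (fun t : R => t + 2 * pi) 1.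
  exact: (derive_eqf (derive_addf (derive_idf t) (derive_cstf (2 * pi) t)) (addr0 _)).
have M1 : `|Z (x + 2 * pi) l eps - Z x l' eps| <= C3 * (C1 * `|eps| ^+ k.+1 + `|eps| ^+ k.+1).
  apply: (H3 l' eps _ x (fun t => Z (t + 2 * pi) l eps)
     (fun t => dZ (t + 2 * pi) l eps)).
  - exact: l'b.
  - exact: E3.
  - by rewrite x0 XE (le_trans x2) // lerDl ltW.
  - rewrite mulr_ge0 ?exprn_ge0 ?(ltW C10) //= mulrC -ltr_pdivlMr //.
    exact: le_lt_trans (epsX _) E6.
  - move=> t tT; have HZ := approx_orbit_is_derive e0 r0_derive tF tG FG l eps (t + 2 * pi).
    exact: (derive_eqf (@derive_compf R (fun x => Z x l eps) (fun t => t + 2 * pi) _ _ t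
      HZ (shiftd t)) (mulr1 _)).
  - move=> t /andP[t0 tx]; apply: H2 E2.
    by rewrite XE; apply: (shift_in_range (ltW pp) _ x2); rewrite t0.
  - move=> t /andP[t0 tx]; rewrite -(A_periodic _ t) -(B_periodic _ t).
    have tX : -1 <= t + 2 * pi <= X.
      by rewrite XE; apply: (shift_in_range (ltW pp) _ x2); rewrite t0.
    by have [] := H1 _ _ _ tX lb E1.
  - by rewrite add0r approx_orbit_2pi.
have M2 := H4 l' eps ll3 (ltW E4).
have M3 : C4 * `|eps| * `|l' - l| <= C4 * J * `|eps| ^+ k.+1.
  have -> : C4 * J * `|eps| ^+ k.+1 = C4 * `|eps| * (`|eps| ^+ k * J) by rewrite exprS; ring.
  by rewrite ler_wpM2l // mulr_ge0 // ltW.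
rewrite -ll'.
have -> : Z (x + 2 * pi) l eps - Z x l eps - r0 x * (l' - l) =
   (Z (x + 2 * pi) l eps - Z x l' eps) + (Z x l' eps - Z x l eps - r0 x * (l' - l)) by ring.
apply: le_trans (ler_normD _ _) _.
have -> : (C3 * (C1 + 1) + C4 * J) * `|eps| ^+ k.+1 =
  C3 * (C1 * `|eps| ^+ k.+1 + `|eps| ^+ k.+1) + C4 * J * `|eps| ^+ k.+1 by ring.
exact: lerD M1 (le_trans M2 M3).
Qed.

Variables (a b x1 sA sB : R).
Hypothesis x1_in : 0 <= x1 <= 2 * pi.
Hypothesis ab : (b = 1 /\ a = x1) \/ (b = -1 /\ a = x1 + 2 * pi).
Hypothesis sAB : sA = b * sB.
Hypothesis sA1 : `|sA| = 1.
Hypothesis A_sym : forall eps x L, A eps x (- L) = sA * A eps (a + b * x) L.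
Hypothesis B_sym : forall eps x L, B eps x (- L) = sB * B eps (a + b * x) L.

(** The reflected curve t -> - Z (a + b t) (- l) solves the equation up to the same residual and
    starts near [r0 a * l]. Its displacement after one turn is, up to sign, that of Z (- l) between
    x1 and x1 + 2 pi, run backwards when b = -1; both evaluations of the eps^k term must agree. *)
Lemma jump_symmetric l : 0 < l -> jump (r0 a * l) = - b * r0 x1 * jump (- l).
Proof.
move=> lp.
have pp := twopi_gt0.
have [x10 x12] := andP x1_in.
have l0 : - l != 0 by rewrite oppr_eq0 gt_eqF.
have nl : `|- l| = l by rewrite normrN gtr0_norm.
have lp' : 0 < `|- l| by rewrite nl.
pose X : R := 4 * pi.
have XE : X = 2 * pi + 2 * pi by rewrite /X; ring.
have arange t : 0 <= t <= 2 * pi -> -1 <= a + b * t <= X.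
  by rewrite XE; apply: (reflect_in_range (ltW pp) x1_in ab).
have ra0 : 0 < r0 a * l by rewrite mulr_gt0.
have [C1 C10 [e1 e10 H1]] := approx_orbit_estimates al0c be0c alc bec be0_gt0 e0W r0_derive
  tF tG F1 FGres (-1) X `|- l| lp'.
have [lam [Lam [e2 [lam0 e20 H2]]]] := approx_orbit_range X 0 l0.
have l20 : 0 < r0 a * l / 2 by rewrite divr_gt0.
have [C3 C30 [e3 e30 H3]] := approx_orbit_compare_angle X (2 * (r0 a * l)) Lam l20 lam0.
have [C4 C40 [e4 e40 H4]] := jump_at x1_in l0.
have [d dj] := jump_derivable (lt0r_neq0 ra0).
have [C5 C50 [r5 r50 H5]] := derive_locally_lipschitz dj.
pose e5 := Num.min (r0 a * l / 2) r5 / C1.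
have e50 : 0 < e5 by rewrite divr_gt0 // lt_min l20.
pose e6 := e3 / C1.
have e60 : 0 < e6 by rewrite divr_gt0.
have b1 : `|b| = 1 by case: ab => [[-> _]|[-> _]]; rewrite ?normrN normr1.
have bb1 : b * b = 1 by case: ab => [[-> _]|[-> _]]; ring.
apply/eqP; rewrite -subr_eq0; apply/eqP.
pose eM := Num.min (Num.min e1 e2) (Num.min (Num.min e3 e4) (Num.min 1 (Num.min e5 e6))).
apply: (@small_le_eq0 R _ (C3 * (C1 + 1) + C4 + C5 * C1) eM).
  by rewrite !lt_min e10 e20 e30 e40 e50 e60 ltr01.
move=> eps /andP[ep]; rewrite !lt_min.
rewrite -{1 2 3 4 5 6 7}(gtr0_norm ep).
move=> /andP[/andP[E1 E2] /andP[/andP[E3 E4] /andP[E5 /andP[E6 E7]]]].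
have epsX n : `|eps| ^+ n.+1 <= `|eps| by rewrite exprS ler_piMr // exprn_ile1 // ltW.
have lb : `|- l| <= `|- l| <= `|- l| by rewrite lexx.
(* The initial value of the reflected curve. It equals [r0 a * l] only up to O(eps), which is
   harmless because [jump] is locally Lipschitz and multiplied by eps^k. *)
pose l' := - Z a (- l) eps.
have a_in : -1 <= a <= X.
  by have := arange 0; rewrite mulr0 addr0; apply; rewrite lexx ltW.
have ll : `|l' - r0 a * l| <= C1 * `|eps|.
  have [_ _] := H1 _ _ _ a_in lb E1.
  by rewrite -normrN; congr (`|_| <= _); rewrite /l'; ring.
have ll2 : `|l' - r0 a * l| < Num.min (r0 a * l / 2) r5.
  by apply: le_lt_trans ll _; rewrite mulrC -ltr_pdivlMr.
rewrite lt_min in ll2; case/andP: ll2 => ll2 ll3.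
have l'b : r0 a * l / 2 <= `|l'| <= 2 * (r0 a * l).
  by have := norm_near_half (z := l') (w := r0 a * l); rewrite (gtr0_norm ra0); apply; exact: ltW.
have shiftd (t : R) : is_derive t 1 (fun t : R => a + b * t) b.
  apply: (derive_eqf (derive_addf (derive_cstf a t) (derive_mulf (derive_cstf b t) (derive_idf t)))).
  by ring.
have M1 : `|- Z (a + b * (2 * pi)) (- l) eps - Z (2 * pi) l' eps| <=
    C3 * (C1 * `|eps| ^+ k.+1 + `|eps| ^+ k.+1).
  apply: (H3 l' eps _ (2 * pi) (fun t => - Z (a + b * t) (- l) eps)
     (fun t => - (dZ (a + b * t) (- l) eps * b))).
  - exact: l'b.
  - exact: E3.
  - by rewrite XE (ltW pp) lerDl ltW.
  - rewrite mulr_ge0 ?exprn_ge0 ?(ltW C10) //= mulrC -ltr_pdivlMr //.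
    exact: le_lt_trans (epsX _) E7.
  - move=> t tT; have HZ := approx_orbit_is_derive e0 r0_derive tF tG FG (- l) eps (a + b * t).
    exact: (derive_oppf (@derive_compf R (fun x => Z x (- l) eps) (fun t => a + b * t) _ _ t
      HZ (shiftd t))).
  - by move=> t tT; rewrite normrN; exact: H2 (arange t tT) E2.
  - move=> t tT; rewrite A_sym B_sym sAB.
    have [Q _ _] := H1 _ _ _ (arange t tT) lb E1.
    apply: le_trans Q; rewrite le_eqVlt; apply/orP; left; apply/eqP.
    set z := Z _ _ _; set dz := dZ _ _ _.
    (* The derivative contributes b, the angular field sB and the radial field sA = b sB, so the
       residual is only multiplied by a number of absolute value 1. *)
    have -> : - (dz * b) * (sB * B eps (a + b * t) z) - - z * (b * sB * A eps (a + b * t) z) =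
       - (b * sB) * (dz * B eps (a + b * t) z - z * A eps (a + b * t) z) by ring.
    by rewrite normrM normrN -sAB sA1 mul1r.
  - by rewrite mulr0 addr0.
rewrite approx_orbit_2pi in M1.
have M2 := H4 eps E4.
have M3 := H5 l' ll3.
have key : - Z (a + b * (2 * pi)) (- l) eps - l' = - b * (Z (x1 + 2 * pi) (- l) eps - Z x1 (- l) eps).
  by rewrite /l'; case: ab => [[-> ->]|[-> ->]];
    [ rewrite mul1r; ring | rewrite mulN1r -addrA subrr addr0; ring].
have ek : 0 < `|eps| ^+ k by rewrite exprn_gt0 // normr_gt0 gt_eqF.
rewrite -(ler_pM2l ek).
set v := jump _ - _; have -> : `|eps| ^+ k * `|v| = `|eps ^+ k * v| by rewrite normrM normrX.
rewrite /v.
pose D1 := - Z (a + b * (2 * pi)) (- l) eps - (l' + eps ^+ k * jump l').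
pose D2 := Z (x1 + 2 * pi) (- l) eps - Z x1 (- l) eps - r0 x1 * (eps ^+ k * jump (- l)).
pose D3 := jump l' - jump (r0 a * l).
have -> : eps ^+ k * (jump (r0 a * l) - - b * r0 x1 * jump (- l)) =
   - D1 - b * D2 - eps ^+ k * D3.
  have -> : D1 = - b * (Z (x1 + 2 * pi) (- l) eps - Z x1 (- l) eps) - eps ^+ k * jump l'.
    by rewrite -key /D1; ring.
  by rewrite /D2 /D3; ring.
have N1 : `|D1| <= C3 * (C1 + 1) * `|eps| ^+ k.+1.
  by apply: le_trans M1 _; rewrite le_eqVlt; apply/orP; left; apply/eqP; ring.
have N2 : `|b * D2| <= C4 * `|eps| ^+ k.+1 by rewrite normrM b1 mul1r.
have N3 : `|eps ^+ k * D3| <= C5 * C1 * `|eps| ^+ k.+1.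
  have -> : C5 * C1 * `|eps| ^+ k.+1 = `|eps| ^+ k * (C5 * (C1 * `|eps|)) by rewrite exprS; ring.
  rewrite normrM normrX ler_wpM2l ?exprn_ge0 //.
  by apply: le_trans M3 _; rewrite ler_wpM2l // ltW.
have -> : `|eps| ^+ k * ((C3 * (C1 + 1) + C4 + C5 * C1) * eps) =
   C3 * (C1 + 1) * `|eps| ^+ k.+1 + C4 * `|eps| ^+ k.+1 + C5 * C1 * `|eps| ^+ k.+1.
  by rewrite -{2}(gtr0_norm ep) exprS; ring.
have T1 := ler_normB (- D1 - b * D2) (eps ^+ k * D3).
have T2 := ler_normB (- D1) (b * D2).
rewrite normrN in T2; apply: le_trans T1 _.
by apply: lerD N3; apply: le_trans T2 _; exact: lerD.
Qed.

(** After removal of the monomial prefactor, [jump_symmetric] says c1 f(r0(a) l) = c2 f(- l) for all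
    l > 0, hence as polynomials. In degree e the left factor c1 r0(a)^e is positive, so b (-1)^(e +
    e0 k) is positive too. *)
Lemma jump_coef_parity e : ((F (2 * pi))`_k)`_e != 0 -> b = (-1) ^+ (e + e0 * k).
Proof.
set f := (F (2 * pi))`_k => fe.
pose c1 := r0 a * (r0 a ^+ e0)^-1 ^+ k.
pose c2 := b * r0 x1 * (-1) ^+ (e0 * k).
pose P := c1 *: (f \Po ((r0 a) *: 'X)) - c2 *: (f \Po (- 'X)).
have P0 : P = 0.
  apply: poly_eq0_pos => l lp.
  rewrite /P !hornerE /= !horner_comp !hornerE.
  have := jump_symmetric lp; rewrite /jump -/f.
  have r0n : r0 a != 0 by rewrite gt_eqF.
  have l0n : l != 0 by rewrite gt_eqF.
  pose m := l * (l ^+ e0)^-1 ^+ k.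
  have m0 : m != 0 by rewrite mulf_neq0 // expf_neq0 // invr_neq0 // expf_neq0.
  have -> : r0 a * l * ((r0 a * l) ^+ e0)^-1 ^+ k * f.[r0 a * l] = m * (c1 * f.[r0 a * l]).
    by rewrite /m /c1 -!exprVn !invfM !exprMn; ring.
  have -> : - b * r0 x1 * (- l * ((- l) ^+ e0)^-1 ^+ k * f.[- l]) = m * (c2 * f.[- l]).
    by rewrite /m /c2 -!exprVn invrN [(- l^-1) ^+ _]exprNn exprMn -!exprM; ring.
  move=> /(mulfI m0) ->; exact: subrr.
have compZ (c : R) : (f \Po (c *: 'X))`_e = c ^+ e * f`_e.
  rewrite comp_polyE coef_sum.
  have [ef|fe'] := ltnP e (size f); last by rewrite nth_default ?eqxx in fe.
  rewrite (bigD1 (Ordinal ef)) //= big1 => [|i ie].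
    by rewrite addr0 exprZn scalerA coefZ coefXn eqxx mulr1 mulrC.
  rewrite exprZn scalerA coefZ coefXn; case: eqP => [ei|]; last by rewrite mulr0.
  by move: ie; rewrite -val_eqE /= ei eqxx.
have := congr1 (fun p : {poly R} => p`_e) P0.
rewrite coefB !coefZ compZ -[(- 'X)]scaleN1r compZ coef0 !mulrA -mulrBl => /eqP.
rewrite mulf_eq0 (negbTE fe) orbF subr_eq0 => /eqP E.
have c1p : 0 < c1 * r0 a ^+ e by rewrite !mulr_gt0 ?exprn_gt0 ?invr_gt0 ?exprn_gt0.
rewrite E /c2 mulrAC -mulrA -exprD [b * _ * _]mulrAC pmulr_lgt0 // in c1p.
move: c1p; rewrite addnC.
have [od|od] := boolP (odd (e0 * k + e)); rewrite -signr_odd ?od ?(negbTE od) /= ?expr0 ?expr1.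
  by case: ab => [[-> _]|[-> _]] //; lra.
by case: ab => [[-> _]|[-> _]] //; lra.
Qed.

End Symmetry.

(** * The weighted polar form of a polynomial field *)

Section PolynomialField.
Variable R : realType.
Local Notation S := {poly {poly R}}.

Lemma hornerXY_exists_coef (p : S) : exists N, forall x y,
  p.[x, y] = \sum_(i < N) \sum_(j < N) p`_i`_j * x ^+ i * y ^+ j.
Proof.
exists (maxn (size p) (sizeY p)) => x y; apply: hornerXY_coef => [i|i j _].
  by rewrite geq_max => /andP[/leq_sizeP ip _]; exact: ip.
rewrite geq_max => /andP[_ jp]; apply: nth_default.
by apply: leq_trans jp; exact: max_size_coefXY.
Qed.

Lemma hornerXY_continuous (p : S) (f g : R -> R) x : {for x, continuous f} ->
  {for x, continuous g} -> {for x, continuous (fun t => p.[f t, g t])}.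
Proof.
move=> cf cg; have [N HN] := hornerXY_exists_coef p.
have -> : (fun t => p.[f t, g t]) = (fun t => \sum_(i < N) \sum_(j < N) p`_i`_j * f t ^+ i * g t ^+ j).
  by apply/funext => t; exact: HN.
apply: (@cont_sumf R _ _ (fun (i : 'I_N) t => \sum_(j < N) p`_i`_j * f t ^+ i * g t ^+ j)) => i.
apply: (@cont_sumf R _ _ (fun (j : 'I_N) t => p`_i`_j * f t ^+ i * g t ^+ j)) => j.
by apply: cont_mulf; [apply: cont_mulf; [exact: cont_cstf|exact: cont_expf]|exact: cont_expf].
Qed.

(** Both sides are polynomials in l that agree for l > 0. The negative values of l are the ones that
    the reflection L -> - L needs. *)
Lemma quasi_homogeneous_all (p : S) (s1 s2 d : nat) (c s : R) :
  (forall l, 0 < l -> p.[l ^+ s1 * c, l ^+ s2 * s] = l ^+ d * p.[c, s]) ->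
  forall l, p.[l ^+ s1 * c, l ^+ s2 * s] = l ^+ d * p.[c, s].
Proof.
move=> H l; have [N HN] := hornerXY_exists_coef p.
pose P : {poly R} := \sum_(i < N) \sum_(j < N)
  (p`_i`_j * c ^+ i * s ^+ j) *: 'X^(s1 * i + s2 * j).
have PE z : P.[z] = p.[z ^+ s1 * c, z ^+ s2 * s].
  rewrite HN horner_sum; apply: eq_bigr => i _; rewrite horner_sum; apply: eq_bigr => j _.
  rewrite hornerZ hornerXn !exprMn -!exprM exprD; ring.
have : P - p.[c, s] *: 'X^d = 0.
  by apply: poly_eq0_pos => z z0; rewrite !hornerE PE H // mulrC subrr.
move=> /(congr1 (fun q => q.[l])); rewrite !hornerE PE => /eqP.
by rewrite subr_eq0 => /eqP ->; rewrite mulrC.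
Qed.

Variables (s1 s2 m n k : nat) (P Q : S) (p q : nat -> S) (sg : R).
Hypothesis s2_gt0 : (0 < s2)%N.
Hypothesis s21 : (s2 <= s1)%N.
Hypothesis hqh : quasi_homogeneous s1 s2 m P Q.
Hypothesis pdeg : forall i, deg_le n (p i.+1).
Hypothesis qdeg : forall i, deg_le n (q i.+1).

(** This is (n + 1) s1 - s2: a monomial of degree at most n has weight at most n s1, and the second
    component of the field is multiplied by L^(s1 - s2). *)
Definition weight_bound := (n * s1 + (s1 - s2))%N.
Definition base_weight := (s1 + m - 1)%N.
Definition polar_cos (x : R) := cos x.
(** The sign [sg] is the orientation of the center. The angle used is [sg] times the usual one,
    which makes it increase along the orbits. *)
Definition polar_sin (x : R) := sg * sin x.

Lemma polar_cos_continuous x : {for x, continuous polar_cos}. Proof. exact: continuous_cos. Qed.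
Lemma polar_sin_continuous x : {for x, continuous polar_sin}.
Proof. by apply: (@cont_mulf R (fun=> sg) (@sin R)); [exact: cont_cstf|exact: continuous_sin]. Qed.

(** The coefficient of L^e in the polar form of [u] multiplied by L^d f, the monomials of [u] being
    collected by weight. *)
Definition weight_coef (u : S) (d : nat) (f : R -> R) (e : nat) (x : R) :=
  \sum_(i < n.+1) \sum_(j < n.+1)
    u`_i`_j * polar_cos x ^+ i * polar_sin x ^+ j * f x * (d + s1 * i + s2 * j == e)%N%:R.

Lemma weight_coef_continuous u d f e : continuous f -> continuous (weight_coef u d f e).
Proof.
move=> cf x.
apply: (@cont_sumf R _ _ (fun (i : 'I_n.+1) x => \sum_(j < n.+1)
    u`_i`_j * polar_cos x ^+ i * polar_sin x ^+ j * f x * (d + s1 * i + s2 * j == e)%N%:R)) => i.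
apply: (@cont_sumf R _ _ (fun (j : 'I_n.+1) x =>
    u`_i`_j * polar_cos x ^+ i * polar_sin x ^+ j * f x * (d + s1 * i + s2 * j == e)%N%:R)) => j.
apply: cont_mulf; last exact: cont_cstf.
apply: cont_mulf; last exact: cf.
apply: cont_mulf; last by apply: cont_expf; exact: polar_sin_continuous.
by apply: cont_mulf; [exact: cont_cstf|apply: cont_expf; exact: polar_cos_continuous].
Qed.

Lemma weight_coef_sum u d f x L : deg_le n u -> (d <= s1 - s2)%N ->
  \sum_(e < weight_bound.+1) weight_coef u d f e x * L ^+ e =
  f x * (L ^+ d * u.[L ^+ s1 * polar_cos x, L ^+ s2 * polar_sin x]).
Proof.
move=> du dW.
rewrite (@hornerXY_coef R u n.+1 n.+1); last first.
- move=> i j _ nj; apply/eqP; apply: contraT => /du ij.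
  by move: nj; rewrite ltnNge (leq_trans _ ij) // leq_addl.
- move=> i ni; apply/polyP => j; rewrite coef0; apply/eqP; apply: contraT => /du ij.
  by move: ni; rewrite ltnNge (leq_trans _ ij) // leq_addr.
under eq_bigr do rewrite /weight_coef mulr_suml.
rewrite exchange_big /= mulrA mulr_sumr; apply: eq_bigr => i _.
under eq_bigr do rewrite mulr_suml.
rewrite exchange_big /= mulr_sumr; apply: eq_bigr => j _.
have [->|un] := eqVneq (u`_i`_j) 0.
  rewrite !mul0r mulr0 big1 // => e _; by rewrite !mul0r.
have ij := du _ _ un.
have dW' : (d + s1 * i + s2 * j < weight_bound.+1)%N.
  rewrite ltnS /weight_bound.
  have : (s1 * i + s2 * j <= n * s1)%N.
    apply: leq_trans (_ : s1 * i + s1 * j <= _)%N; first by rewrite leq_add2l leq_mul2r s21 orbT.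
    by rewrite -mulnDr mulnC leq_mul2r ij orbT.
  lia.
rewrite (bigD1 (Ordinal dW')) //= eqxx mulr1 big1 ?addr0 => [|e ne]; last first.
  case: eqP => [ee|]; last by rewrite mulr0 mul0r.
  by move: ne; rewrite -val_eqE /= ee eqxx.
rewrite !exprMn -!exprM !exprD; ring.
Qed.

Definition radial0 x := polar_cos x * P.[polar_cos x, polar_sin x] + polar_sin x * Q.[polar_cos x, polar_sin x].
Definition angular0 x := sg * (s1%:R * polar_cos x * Q.[polar_cos x, polar_sin x] - s2%:R * polar_sin x * P.[polar_cos x, polar_sin x]).
Definition radial_coef i e x := weight_coef (p i.+1) 0 polar_cos e x + weight_coef (q i.+1) (s1 - s2) polar_sin e x.
Definition angular_coef i e x := sg * (s1%:R * weight_coef (q i.+1) (s1 - s2) polar_cos e x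
  - s2%:R * weight_coef (p i.+1) 0 polar_sin e x).

Lemma radial0_continuous : continuous radial0.
Proof.
move=> x; have c : {for x, continuous polar_cos} := @polar_cos_continuous x; have s : {for x, continuous polar_sin} := @polar_sin_continuous x.
apply: (@cont_addf R (fun x => polar_cos x * P.[polar_cos x, polar_sin x]) (fun x => polar_sin x * Q.[polar_cos x, polar_sin x]));
  by apply: cont_mulf => //; exact: hornerXY_continuous.
Qed.

Lemma angular0_continuous : continuous angular0.
Proof.
move=> x; have c : {for x, continuous polar_cos} := @polar_cos_continuous x; have s : {for x, continuous polar_sin} := @polar_sin_continuous x.
apply: (@cont_mulf R (fun=> sg) (fun x => s1%:R * polar_cos x * Q.[polar_cos x, polar_sin x] - s2%:R * polar_sin x * P.[polar_cos x, polar_sin x])).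
  exact: cont_cstf.
apply: (@cont_addf R (fun x => s1%:R * polar_cos x * Q.[polar_cos x, polar_sin x]) (fun x => - (s2%:R * polar_sin x * P.[polar_cos x, polar_sin x]))).
  by apply: cont_mulf; [apply: cont_mulf => //; exact: cont_cstf|exact: hornerXY_continuous].
apply: (@cont_oppf R (fun x => s2%:R * polar_sin x * P.[polar_cos x, polar_sin x])).
by apply: cont_mulf; [apply: cont_mulf => //; exact: cont_cstf|exact: hornerXY_continuous].
Qed.

Lemma radial_coef_continuous i e : continuous (radial_coef i e).
Proof.
move=> x; apply: (@cont_addf R (weight_coef _ _ _ e) (weight_coef _ _ _ e));
  apply: weight_coef_continuous => ?; [exact: polar_cos_continuous|exact: polar_sin_continuous].
Qed.

Lemma angular_coef_continuous i e : continuous (angular_coef i e).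
Proof.
move=> x.
have cs : continuous polar_sin by move=> y; exact: polar_sin_continuous.
have cpc' : continuous polar_cos by move=> y; exact: polar_cos_continuous.
have c1 := @weight_coef_continuous (q i.+1) (s1 - s2) polar_cos e cpc'.
have c2 := @weight_coef_continuous (p i.+1) 0 polar_sin e cs.
apply: (@cont_mulf R (fun=> sg) (fun x => s1%:R * weight_coef (q i.+1) (s1 - s2) polar_cos e x
  - s2%:R * weight_coef (p i.+1) 0 polar_sin e x)); first exact: cont_cstf.
apply: (@cont_addf R (fun x => s1%:R * weight_coef (q i.+1) (s1 - s2) polar_cos e x)
  (fun x => - (s2%:R * weight_coef (p i.+1) 0 polar_sin e x))).
  by apply: (@cont_mulf R (fun=> s1%:R)); [exact: cont_cstf|exact: c1].
apply: (@cont_oppf R (fun x => s2%:R * weight_coef (p i.+1) 0 polar_sin e x)).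
by apply: (@cont_mulf R (fun=> s2%:R)); [exact: cont_cstf|exact: c2].
Qed.

Definition trunc_field (u : S) (v : nat -> S) (eps x y : R) :=
  u.[x, y] + \sum_(i < k) eps ^+ i.+1 * (v i.+1).[x, y].

Lemma scale_P L x : P.[L ^+ s1 * polar_cos x, L ^+ s2 * polar_sin x] = L ^+ base_weight * P.[polar_cos x, polar_sin x].
Proof.
apply: (@quasi_homogeneous_all P s1 s2 base_weight) => l l0.
exact: (hqh _ _ l0).1.
Qed.

Lemma scale_Q L x : L ^+ (s1 - s2) * Q.[L ^+ s1 * polar_cos x, L ^+ s2 * polar_sin x] = L ^+ base_weight * Q.[polar_cos x, polar_sin x].
Proof.
rewrite (@quasi_homogeneous_all Q s1 s2 (s2 + m - 1)) => [|l l0]; last exact: (hqh _ _ l0).2.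
rewrite mulrA -exprD; congr (_ ^+ _ * _); rewrite /base_weight; lia.
Qed.

Lemma radial_field_eval eps x L : fieldv weight_bound base_weight k radial0 radial_coef eps x L =
  polar_cos x * trunc_field P p eps (L ^+ s1 * polar_cos x) (L ^+ s2 * polar_sin x) +
  polar_sin x * (L ^+ (s1 - s2) * trunc_field Q q eps (L ^+ s1 * polar_cos x) (L ^+ s2 * polar_sin x)).
Proof.
rewrite /trunc_field mulrDr scale_P [X in polar_sin x * X]mulrDr scale_Q [polar_sin x * _]mulrDr.
rewrite addrACA /fieldv /radial0; congr (_ + _); first by ring.
rewrite !mulr_sumr -big_split; apply: eq_bigr => i _ /=.
have := weight_coef_sum polar_cos x L (@pdeg i) (leq0n _).
have := weight_coef_sum polar_sin x L (@qdeg i) (leqnn _).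
rewrite expr0 mul1r => H1 H2.
transitivity (eps ^+ i.+1 * (\sum_(e < weight_bound.+1) weight_coef (p i.+1) 0 polar_cos e x * L ^+ e +
  \sum_(e < weight_bound.+1) weight_coef (q i.+1) (s1 - s2) polar_sin e x * L ^+ e)).
  rewrite -big_split /= mulr_sumr; apply: eq_bigr => e _; rewrite /radial_coef; ring.
rewrite H1 H2; ring.
Qed.

Lemma angular_field_eval eps x L : fieldv weight_bound base_weight k angular0 angular_coef eps x L =
  sg * (s1%:R * polar_cos x * (L ^+ (s1 - s2) * trunc_field Q q eps (L ^+ s1 * polar_cos x) (L ^+ s2 * polar_sin x)) -
        s2%:R * polar_sin x * trunc_field P p eps (L ^+ s1 * polar_cos x) (L ^+ s2 * polar_sin x)).
Proof.
rewrite /trunc_field; set SQ := \sum_(i < k) _ * (q _).[_, _]; set SP := \sum_(i < k) _ * (p _).[_, _].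
transitivity (angular0 x * L ^+ base_weight + sg * (s1%:R * polar_cos x * (L ^+ (s1 - s2) * SQ) - s2%:R * polar_sin x * SP)); last first.
  by rewrite [L ^+ (s1 - s2) * (_ + SQ)]mulrDr scale_Q scale_P /angular0; ring.
rewrite /fieldv; congr (_ + _); rewrite /SP /SQ.
rewrite !mulr_sumr -sumrN -big_split mulr_sumr; apply: eq_bigr => i _ /=.
have := weight_coef_sum polar_sin x L (@pdeg i) (leq0n _).
have := weight_coef_sum polar_cos x L (@qdeg i) (leqnn _).
rewrite expr0 mul1r => H1 H2.
transitivity (eps ^+ i.+1 * (sg * (s1%:R * (\sum_(e < weight_bound.+1) weight_coef (q i.+1) (s1 - s2) polar_cos e x * L ^+ e) -
  s2%:R * \sum_(e < weight_bound.+1) weight_coef (p i.+1) 0 polar_sin e x * L ^+ e))).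
  rewrite !mulr_sumr -sumrN -big_split /= !mulr_sumr; apply: eq_bigr => e _; rewrite /angular_coef; ring.
rewrite H1 H2; ring.
Qed.

Lemma polar_cos_periodic x : polar_cos (x + 2 * pi) = polar_cos x.
Proof. by rewrite /polar_cos [2 * pi]mulr_natl cosD2pi. Qed.

Lemma polar_sin_periodic x : polar_sin (x + 2 * pi) = polar_sin x.
Proof. by rewrite /polar_sin [2 * pi]mulr_natl sinD2pi. Qed.

Lemma radial_field_periodic eps x L :
  fieldv weight_bound base_weight k radial0 radial_coef eps (x + 2 * pi) L = fieldv weight_bound base_weight k radial0 radial_coef eps x L.
Proof. by rewrite !radial_field_eval polar_cos_periodic polar_sin_periodic. Qed.

Lemma angular_field_periodic eps x L :
  fieldv weight_bound base_weight k angular0 angular_coef eps (x + 2 * pi) L = fieldv weight_bound base_weight k angular0 angular_coef eps x L.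
Proof. by rewrite !angular_field_eval polar_cos_periodic polar_sin_periodic. Qed.

Section Reflection.
Variables a b : R.
Hypothesis polar_cos_sym : forall x, polar_cos (a + b * x) = (-1) ^+ s1 * polar_cos x.
Hypothesis polar_sin_sym : forall x, polar_sin (a + b * x) = (-1) ^+ s2 * polar_sin x.

Lemma sign_sub : (-1) ^+ (s1 - s2) = (-1) ^+ s1 * (-1) ^+ s2 :> R.
Proof. by rewrite -exprD -[in RHS](subnK s21) -addnA exprD addnn -mul2n exprM sqrrN expr1n expr1n mulr1. Qed.

Lemma sign_sq d : (-1) ^+ d * (-1) ^+ d = 1 :> R.
Proof. by rewrite -expr2 -exprM mulnC exprM sqrrN expr1n expr1n. Qed.

(** The polar coordinates (- L, x) and (L, a + b x) designate the same point of the plane. So the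
    vector field takes the same values there, and only the polar prefactors change sign. *)
Lemma radial_field_symmetric eps x L : fieldv weight_bound base_weight k radial0 radial_coef eps x (- L) =
  (-1) ^+ s1 * fieldv weight_bound base_weight k radial0 radial_coef eps (a + b * x) L.
Proof.
rewrite !radial_field_eval polar_cos_sym polar_sin_sym ![(- L) ^+ _]exprNn.
have -> : (-1) ^+ s1 * L ^+ s1 * polar_cos x = L ^+ s1 * ((-1) ^+ s1 * polar_cos x) by ring.
have -> : (-1) ^+ s2 * L ^+ s2 * polar_sin x = L ^+ s2 * ((-1) ^+ s2 * polar_sin x) by ring.
rewrite sign_sub; set tp := trunc_field P _ _ _ _; set tq := trunc_field Q _ _ _ _.
transitivity (((-1) ^+ s1 * (-1) ^+ s1) * (polar_cos x * tp) +
   (-1) ^+ s1 * (-1) ^+ s2 * (polar_sin x * (L ^+ (s1 - s2) * tq))); last by ring.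
rewrite sign_sq; ring.
Qed.

Lemma angular_field_symmetric eps x L : fieldv weight_bound base_weight k angular0 angular_coef eps x (- L) =
  (-1) ^+ s2 * fieldv weight_bound base_weight k angular0 angular_coef eps (a + b * x) L.
Proof.
rewrite !angular_field_eval polar_cos_sym polar_sin_sym ![(- L) ^+ _]exprNn.
have -> : (-1) ^+ s1 * L ^+ s1 * polar_cos x = L ^+ s1 * ((-1) ^+ s1 * polar_cos x) by ring.
have -> : (-1) ^+ s2 * L ^+ s2 * polar_sin x = L ^+ s2 * ((-1) ^+ s2 * polar_sin x) by ring.
rewrite sign_sub; set tp := trunc_field P _ _ _ _; set tq := trunc_field Q _ _ _ _.
transitivity (sg * ((-1) ^+ s1 * (-1) ^+ s2 * (s1%:R * polar_cos x * (L ^+ (s1 - s2) * tq))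
   - ((-1) ^+ s2 * (-1) ^+ s2) * (s2%:R * polar_sin x * tp))); last by ring.
rewrite sign_sq; ring.
Qed.
End Reflection.

End PolynomialField.

(** * Power series in the parameter *)

Section PowerSeries.
Variable R : realType.

Lemma cvgn_sum (I : Type) (s : seq I) (u : I -> nat -> R) (l : I -> R) :
  (forall i, u i n @[n --> \oo] --> l i) ->
  \sum_(i <- s) u i n @[n --> \oo] --> \sum_(i <- s) l i.
Proof.
move=> H; elim: s => [|i s IH].
  rewrite big_nil; under eq_fun do rewrite big_nil; exact: cvg_cst.
rewrite big_cons; under eq_fun do rewrite big_cons; exact: cvgD.
Qed.

Lemma cvgn_scale (c : R) (u : nat -> R) (l : R) : u n @[n --> \oo] --> l ->
  c * u n @[n --> \oo] --> c * l.
Proof. by move=> H; apply: cvgM => //; exact: cvg_cst. Qed.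

Lemma geometric_tail (t : R) (k N : nat) : 0 <= t -> 2 * t <= 1 -> (k <= N)%N ->
  \sum_(k <= i < N) t ^+ i <= 2 * t ^+ k - 2 * t ^+ N.
Proof.
move=> t0 t1 /subnK <-; elim: (N - k)%N => [|d IH].
  by rewrite add0n big_geq // subrr.
rewrite addSn big_nat_recr ?leq_addl //=.
have : 2 * t ^+ (d + k).+1 <= t ^+ (d + k).
  by rewrite exprS mulrA ler_piMl // exprn_ge0.
lra.
Qed.

(** Convergence at the single point rho / 2 bounds the partial sums there, hence the terms r^i a_i;
    closer to 0 the tail is dominated by a geometric series. *)
Lemma power_series_tail (a : nat -> R) (rho : R) (k : nat) : 0 < rho ->
  (forall eps, `|eps| < rho -> cvgn (fun N => \sum_(1 <= i < N) eps ^+ i * a i)) ->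
  exists2 C, 0 < C & exists2 r, 0 < r & forall eps l, `|eps| < r ->
    \sum_(1 <= i < N) eps ^+ i * a i @[N --> \oo] --> l ->
    `|l - \sum_(i < k) eps ^+ i.+1 * a i.+1| <= C * `|eps| ^+ k.+1.
Proof.
move=> rho0 H; pose r := rho / 2.
have r0 : 0 < r by rewrite divr_gt0.
have rr : `|r| < rho by rewrite gtr0_norm // /r; lra.
have [M [_ HM]] := cvg_seq_bounded (H r rr).
have {}HM : forall N, `|\sum_(1 <= i < N) r ^+ i * a i| <= `|M| + 1.
  by move=> N; apply: (HM (`|M| + 1)) => //; rewrite ltr_pwDr // ler_norm.
pose M' := `|M| + 1.
have M0 : 0 < M' by rewrite ltr_wpDl.
have ra i : (0 < i)%N -> `|r ^+ i * a i| <= 2 * M'.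
  move=> i0; have := HM i.+1; have := HM i; rewrite big_nat_recr //=.
  set s := \sum_(1 <= _ < _) _ => s1 s2.
  have -> : r ^+ i * a i = (s + r ^+ i * a i) - s by ring.
  by apply: le_trans (ler_normB _ _) _; rewrite -/M' in s1 s2 *; lra.
(* A term is the difference of two partial sums, hence at most 2 M'; a geometric tail of ratio at
   most 1/2 contributes another factor 2. *)
exists (4 * M' * (r^-1) ^+ k.+1); first by rewrite !mulr_gt0 ?exprn_gt0 ?invr_gt0.
exists (r / 2); first by rewrite divr_gt0.
move=> eps l er cl; pose t := `|eps| / r.
have t0 : 0 <= t by rewrite divr_ge0 // ltW.
have t1 : 2 * t <= 1 by rewrite /t mulrA ler_pdivrMr // mul1r; lra.
have ea i : (0 < i)%N -> `|eps ^+ i * a i| <= 2 * M' * t ^+ i.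
  move=> i0; have -> : eps ^+ i * a i = (eps / r) ^+ i * (r ^+ i * a i).
    by rewrite mulrA -exprMn divfK // gt_eqF.
  rewrite normrM normrX mulrC normf_div (gtr0_norm r0) ler_wpM2r ?exprn_ge0 //; exact: ra.
have -> : 4 * M' * (r^-1) ^+ k.+1 * `|eps| ^+ k.+1 = 4 * M' * t ^+ k.+1.
  by rewrite -mulrA -exprMn /t mulrC [r^-1 * _]mulrC mulrC.
have bnd N : (k.+1 <= N)%N ->
   `|\sum_(1 <= i < N) eps ^+ i * a i - \sum_(i < k) eps ^+ i.+1 * a i.+1| <= 4 * M' * t ^+ k.+1.
  move=> kN; rewrite (big_cat_nat (n := k.+1)) //=.
  rewrite big_add1 /= big_mkord addrAC subrr add0r.
  apply: le_trans (ler_norm_sum _ _ _) _.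
  apply: le_trans (_ : \sum_(k.+1 <= i < N) 2 * M' * t ^+ i <= _).
    rewrite big_nat_cond [X in _ <= X]big_nat_cond; apply: ler_sum => i /andP[/andP[ki _] _].
    by apply: ea; apply: leq_trans ki.
  rewrite -mulr_sumr.
  apply: le_trans (ler_wpM2l _ (geometric_tail t0 t1 kN)) _; first by rewrite mulr_ge0 // ltW.
  have : 0 <= M' * t ^+ N by rewrite mulr_ge0 ?exprn_ge0 // ltW.
  lra.
set c := \sum_(i < k) _ in bnd *.
have cl' : (\sum_(1 <= i < N) eps ^+ i * a i - c) @[N --> \oo] --> l - c.
  by apply: cvgB => //; exact: cvg_cst.
apply: (cvgr_to_le (cvg_norm cl')); near=> N; apply: bnd.
by near: N; exact: nbhs_infty_ge.
Unshelve. all: by end_near. Qed.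

Lemma vandermonde_dual (n : nat) : exists w : nat -> nat -> R,
  forall i j, (i < n)%N -> (j < n)%N -> \sum_(c < n) c%:R ^+ j * w c i = (j == i)%:R.
Proof.
pose V := Vandermonde n (\row_(j < n) (j%:R : R)).
have Vu : V \in unitmx.
  rewrite unitmxE det_Vandermonde unitfE; apply/prodf_neq0 => i _.
  apply/prodf_neq0 => j ij; rewrite !mxE subr_eq0 eqr_nat.
  by rewrite gtn_eqF.
exists (fun c i => if insub c is Some c' then if insub i is Some i' then invmx V c' i' else 0 else 0).
move=> i j ii jj.
have := congr1 (fun M : 'M[R]_n => M (Ordinal jj) (Ordinal ii)) (mulmxV Vu).
rewrite !mxE -val_eqE /= => <-; apply: eq_bigr => c _.
by rewrite !mxE valK (insubT (fun i => i < n)%N ii).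
Qed.

(** Inversion of a Vandermonde matrix in each variable recovers the coefficients from the values on
    an integer grid. It transfers the convergence assumed at the points (x, y) to the series of each
    coefficient. *)
Lemma coef_interpolation (n : nat) : exists w : nat -> nat -> R, forall u : {poly {poly R}},
  deg_le n u -> forall i j, (i < n.+1)%N -> (j < n.+1)%N ->
  u`_i`_j = \sum_(c < n.+1) \sum_(d < n.+1) w c i * w d j * u.[c%:R, d%:R].
Proof.
have [w Hw] := vandermonde_dual n.+1; exists w => u du i j ii jj.
have uE x y : u.[x, y] = \sum_(a < n.+1) \sum_(b < n.+1) u`_a`_b * x ^+ a * y ^+ b.
  apply: hornerXY_coef => [a na|a b _ nb].
    apply/polyP => b; rewrite coef0; apply/eqP; apply: contraT => /du ab.
    by move: na; rewrite ltnNge (leq_trans _ ab) // leq_addr.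
  apply/eqP; apply: contraT => /du ab.
  by move: nb; rewrite ltnNge (leq_trans _ ab) // leq_addl.
transitivity (\sum_(a < n.+1) \sum_(b < n.+1) u`_a`_b *
    (\sum_(c < n.+1) c%:R ^+ a * w c i) * (\sum_(d < n.+1) d%:R ^+ b * w d j)).
  rewrite (bigD1 (Ordinal ii)) //= (bigD1 (Ordinal jj)) //= !Hw // !eqxx !mulr1.
  rewrite big1 => [|b bj]; last first.
    by rewrite !Hw // [(b == j :> nat)](negbTE bj) mulr0.
  rewrite addr0 big1 ?addr0 // => a ai; rewrite big1 // => b _.
  by rewrite !Hw // [(a == i :> nat)](negbTE ai) mulr0 mul0r.
under [RHS]eq_bigr do under eq_bigr do rewrite uE mulr_sumr.
under [RHS]eq_bigr do rewrite exchange_big /=.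
rewrite [RHS]exchange_big /=; apply: eq_bigr => a _.
under [RHS]eq_bigr do under eq_bigr do rewrite mulr_sumr.
under [RHS]eq_bigr do rewrite exchange_big /=.
rewrite [RHS]exchange_big /=; apply: eq_bigr => b _.
rewrite -mulrA mulr_suml mulr_sumr; apply: eq_bigr => c _.
by rewrite !mulr_sumr; apply: eq_bigr => d _; ring.
Qed.

Variables (n k : nat) (p : nat -> {poly {poly R}}).
Hypothesis pdeg : forall i, deg_le n (p i.+1).
Hypothesis hp : analytic_perturbation p.

Definition pert_lim (eps x y : R) :=
  limn (fun N => \sum_(1 <= i < N) eps ^+ i * (p i).[x, y]).

(** The limit is a polynomial in x and y whose finitely many coefficients are power series in eps.
    Hence it is continuous along curves, its truncation error is uniform on boxes, and the radius
    [r] can be chosen before the size [X] of the box. *)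
Lemma perturbation_expansion : exists2 r, 0 < r &
  (forall eps (f g : R -> R) t, `|eps| < r -> {for t, continuous f} -> {for t, continuous g} ->
    {for t, continuous (fun t => pert_lim eps (f t) (g t))}) /\
  (forall X, exists2 C, 0 < C & forall eps x y, `|eps| < r -> `|x| <= X -> `|y| <= X ->
    `|pert_lim eps x y - \sum_(i < k) eps ^+ i.+1 * (p i.+1).[x, y]| <= C * `|eps| ^+ k.+1).
Proof.
have [rho rho0 Hrho] := hp.
have [w Hw] := coef_interpolation n.
(* The value at index 0 is set to 0 because the degree bound covers only the positive indices. *)
pose cf i j (l : nat) : R := if l is l'.+1 then (p l'.+1)`_i`_j else 0.
have cfE l : (0 < l)%N -> forall i j, cf i j l = (p l)`_i`_j by case: l.
have pE l x y : (0 < l)%N ->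
   (p l).[x, y] = \sum_(i < n.+1) \sum_(j < n.+1) cf i j l * x ^+ i * y ^+ j.
  case: l => // l _; apply: hornerXY_coef => [a na|a b _ nb].
    apply/polyP => b; rewrite coef0; apply/eqP; apply: contraT => /pdeg ab.
    by move: na; rewrite ltnNge (leq_trans _ ab) // leq_addr.
  apply/eqP; apply: contraT => /pdeg ab.
  by move: nb; rewrite ltnNge (leq_trans _ ab) // leq_addl.
have ccf i j eps : (i < n.+1)%N -> (j < n.+1)%N -> `|eps| < rho ->
    cvgn (fun N => \sum_(1 <= l < N) eps ^+ l * cf i j l).
  move=> ii jj er.
  have -> : (fun N => \sum_(1 <= l < N) eps ^+ l * cf i j l) =
     (fun N => \sum_(c < n.+1) \sum_(d < n.+1) w c i * w d j *
         \sum_(1 <= l < N) eps ^+ l * (p l).[c%:R, d%:R]).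
    apply/funext => N.
    transitivity (\sum_(1 <= l < N) \sum_(c < n.+1) \sum_(d < n.+1)
        w c i * w d j * (eps ^+ l * (p l).[c%:R, d%:R])).
      rewrite big_nat_cond [RHS]big_nat_cond; apply: eq_bigr => l /andP[/andP[l0 _] _].
      rewrite cfE // (Hw (p l)) //; last by case: (l) l0.
      rewrite mulr_sumr; apply: eq_bigr => c _; rewrite mulr_sumr; apply: eq_bigr => d _; ring.
    rewrite exchange_big; apply: eq_bigr => c _ /=; rewrite exchange_big.
    by apply: eq_bigr => d _ /=; rewrite mulr_sumr.
  apply/cvg_ex; eexists; apply: cvgn_sum => c; apply: cvgn_sum => d.
  apply: cvgn_scale; exact: (Hrho eps c%:R d%:R er).
pose G i j eps := limn (fun N => \sum_(1 <= l < N) eps ^+ l * cf i j l).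
have limE eps x y : `|eps| < rho -> pert_lim eps x y =
    \sum_(i < n.+1) \sum_(j < n.+1) x ^+ i * y ^+ j * G i j eps.
  move=> er; apply/cvg_lim => //.
  have -> : (fun N => \sum_(1 <= i < N) eps ^+ i * (p i).[x, y]) =
     (fun N => \sum_(i < n.+1) \sum_(j < n.+1) x ^+ i * y ^+ j *
        \sum_(1 <= l < N) eps ^+ l * cf i j l).
    apply/funext => N.
    transitivity (\sum_(1 <= l < N) \sum_(i < n.+1) \sum_(j < n.+1)
        x ^+ i * y ^+ j * (eps ^+ l * cf i j l)).
      rewrite big_nat_cond [RHS]big_nat_cond; apply: eq_bigr => l /andP[/andP[l0 _] _].
      rewrite pE // mulr_sumr; apply: eq_bigr => c _; rewrite mulr_sumr; apply: eq_bigr => d _; ring.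
    rewrite exchange_big; apply: eq_bigr => c _ /=; rewrite exchange_big.
    by apply: eq_bigr => d _ /=; rewrite mulr_sumr.
  apply: cvgn_sum => i; apply: cvgn_sum => j; apply: cvgn_scale; exact: ccf.
have /choice[C HC] : forall ij : 'I_n.+1 * 'I_n.+1, exists C, 0 < C /\ exists r, 0 < r /\
   forall eps, `|eps| < r -> `|eps| < rho ->
   `|G ij.1 ij.2 eps - \sum_(l < k) eps ^+ l.+1 * cf ij.1 ij.2 l.+1| <= C * `|eps| ^+ k.+1.
  move=> [i j] /=.
  have [C C0 [r r0 H]] := power_series_tail k rho0 (fun eps => @ccf i j eps (ltn_ord i) (ltn_ord j)).
  exists C; split => //; exists r; split => // eps er erho; apply: H => //; exact: ccf.
have /choice[r Hr] : forall ij : 'I_n.+1 * 'I_n.+1, exists r, 0 < r /\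
   forall eps, `|eps| < r -> `|eps| < rho ->
   `|G ij.1 ij.2 eps - \sum_(l < k) eps ^+ l.+1 * cf ij.1 ij.2 l.+1| <= C ij * `|eps| ^+ k.+1.
  by move=> ij; have [_ [r]] := HC ij; exists r.
pose rm' := \big[Num.min/rho]_ij r ij.
have rm'0 : 0 < rm'.
  by apply: (big_ind (fun z => 0 < z)) => // [x y x0 y0|ij _]; [rewrite lt_min x0 | exact: (Hr ij).1].
have rmle ij : rm' <= r ij by rewrite /rm' (bigD1 ij) //= ge_min lexx.
exists (Num.min rho rm'); first by rewrite lt_min rho0.
split.
  move=> eps f g t; rewrite lt_min => /andP[er _] cf' cg'.
  have -> : (fun t => pert_lim eps (f t) (g t)) = (fun t =>
      \sum_(i < n.+1) \sum_(j < n.+1) f t ^+ i * g t ^+ j * G i j eps).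
    by apply/funext => z; rewrite limE.
  apply: (@cont_sumf R _ _ (fun (i : 'I_n.+1) t => \sum_(j < n.+1) f t ^+ i * g t ^+ j * G i j eps)) => i.
  apply: (@cont_sumf R _ _ (fun (j : 'I_n.+1) t => f t ^+ i * g t ^+ j * G i j eps)) => j.
  by apply: cont_mulf; [apply: cont_mulf; exact: cont_expf|exact: cont_cstf].
move=> X; exists (1 + \sum_(i < n.+1) \sum_(j < n.+1) `|X| ^+ i * `|X| ^+ j * C (i, j)).
  rewrite ltr_pwDl // sumr_ge0 // => i _; rewrite sumr_ge0 // => j _.
  by rewrite !mulr_ge0 ?exprn_ge0 // ltW // (HC (i, j)).1.
move=> eps x y; rewrite lt_min => /andP[er er'] xX yX.
rewrite limE //.
have -> : \sum_(i < n.+1) \sum_(j < n.+1) x ^+ i * y ^+ j * G i j eps -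
   \sum_(i < k) eps ^+ i.+1 * (p i.+1).[x, y] =
   \sum_(i < n.+1) \sum_(j < n.+1) x ^+ i * y ^+ j *
     (G i j eps - \sum_(l < k) eps ^+ l.+1 * cf i j l.+1).
  transitivity (\sum_(i < n.+1) \sum_(j < n.+1) x ^+ i * y ^+ j * G i j eps -
    \sum_(l < k) \sum_(i < n.+1) \sum_(j < n.+1) x ^+ i * y ^+ j * (eps ^+ l.+1 * cf i j l.+1)).
    congr (_ - _); apply: eq_bigr => l _; rewrite pE // mulr_sumr; apply: eq_bigr => i _.
    by rewrite mulr_sumr; apply: eq_bigr => j _; ring.
  rewrite [X in _ - X]exchange_big /= -sumrB; apply: eq_bigr => i _ /=.
  rewrite [X in _ - X]exchange_big /= -sumrB; apply: eq_bigr => j _ /=.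
  by rewrite mulrBr mulr_sumr.
rewrite mulrDl mul1r; apply: ler_wpDl; first by rewrite exprn_ge0.
apply: le_trans (ler_norm_sum _ _ _) _; rewrite mulr_suml; apply: ler_sum => i _.
apply: le_trans (ler_norm_sum _ _ _) _; rewrite mulr_suml; apply: ler_sum => j _.
rewrite normrM -[leRHS]mulrA; apply: ler_pM => //.
  have X0 : 0 <= `|X| by [].
  rewrite normrM !normrX; apply: ler_pM; rewrite ?exprn_ge0 //; apply: lerXn2r; rewrite ?nnegrE //;
    exact: le_trans (ler_norm X).
by apply: (Hr (i, j)).2 => //; apply: lt_le_trans er' (rmle _).
Qed.
End PowerSeries.

(** * The unperturbed center *)

Section Center.
Variable R : realType.
Local Notation S := {poly {poly R}}.

(** Boundedness makes the class closed under products. It serves to obtain a global Lipschitz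
    constant for [angular], and thus uniqueness for the angular equation. *)
Definition bounded_lipschitz (f : R -> R) := exists M K, [/\ 0 <= M, 0 <= K,
  forall x, `|f x| <= M & forall x y, `|f x - f y| <= K * `|x - y|].

Lemma bounded_lipschitz_cst (a : R) : bounded_lipschitz (fun=> a).
Proof.
exists `|a|, 0; split => // x y; by rewrite subrr normr0 mul0r.
Qed.

Lemma bounded_lipschitzD f g : bounded_lipschitz f -> bounded_lipschitz g ->
  bounded_lipschitz (fun x => f x + g x).
Proof.
move=> [M [K [M0 K0 fM fK]]] [N [L [N0 L0 gN gL]]].
exists (M + N), (K + L); split => [||x|x y]; rewrite ?addr_ge0 //.
  exact: le_trans (ler_normD _ _) (lerD (fM x) (gN x)).
rewrite opprD addrACA mulrDl; exact: le_trans (ler_normD _ _) (lerD (fK x y) (gL x y)).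
Qed.

Lemma bounded_lipschitzM f g : bounded_lipschitz f -> bounded_lipschitz g ->
  bounded_lipschitz (fun x => f x * g x).
Proof.
move=> [M [K [M0 K0 fM fK]]] [N [L [N0 L0 gN gL]]].
exists (M * N), (M * L + K * N); split => [||x|x y]; rewrite ?addr_ge0 ?mulr_ge0 //.
  by rewrite normrM ler_pM.
have -> : f x * g x - f y * g y = f x * (g x - g y) + (f x - f y) * g y by ring.
rewrite [leRHS]mulrDl; apply: le_trans (ler_normD _ _) _; rewrite !normrM; apply: lerD.
  by rewrite -mulrA ler_pM.
by rewrite mulrAC ler_pM.
Qed.

Lemma bounded_lipschitzX f n : bounded_lipschitz f -> bounded_lipschitz (fun x => f x ^+ n).
Proof.
move=> H; elim: n => [|n IH].
  by under eq_fun do rewrite expr0; exact: bounded_lipschitz_cst.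
by under eq_fun do rewrite exprS; exact: bounded_lipschitzM.
Qed.

Lemma bounded_lipschitz_sum (I : Type) (r : seq I) (f : I -> R -> R) :
  (forall i, bounded_lipschitz (f i)) -> bounded_lipschitz (fun x => \sum_(i <- r) f i x).
Proof.
move=> H; elim: r => [|i r IH].
  by under eq_fun do rewrite big_nil; exact: bounded_lipschitz_cst.
by under eq_fun do rewrite big_cons; exact: bounded_lipschitzD.
Qed.

Lemma bounded_lipschitz_derive f df : (forall x : R, is_derive x 1 f (df x)) ->
  (forall x, `|f x| <= 1) -> (forall x, `|df x| <= 1) -> bounded_lipschitz f.
Proof.
move=> Hd f1 df1; exists 1, 1; split => // x y; rewrite mul1r.
wlog xy : x y / y <= x.
  move=> H; have [/H//|/ltW/H] := leP y x; by rewrite distrC (distrC y).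
have [c _ ->] := derive_MVT xy (fun t _ => Hd t).
by rewrite normrM ler_piMl.
Qed.

Lemma bounded_lipschitz_cos : bounded_lipschitz (@cos R).
Proof.
apply: (bounded_lipschitz_derive (fun x => is_derive_cos x)) => x; first exact: cos_max.
by rewrite normrN sin_max.
Qed.

Lemma bounded_lipschitz_sin : bounded_lipschitz (@sin R).
Proof.
by apply: (bounded_lipschitz_derive (fun x => is_derive_sin x)) => x; [exact: sin_max|exact: cos_max].
Qed.

Lemma bounded_lipschitz_hornerXY (p : S) :
  bounded_lipschitz (fun x => p.[cos x, sin x]).
Proof.
have [N HN] := hornerXY_exists_coef p.
under eq_fun do rewrite HN.
apply: bounded_lipschitz_sum => i; apply: bounded_lipschitz_sum => j.
apply: bounded_lipschitzM; first apply: bounded_lipschitzM.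
- exact: bounded_lipschitz_cst.
- exact: bounded_lipschitzX bounded_lipschitz_cos.
- exact: bounded_lipschitzX bounded_lipschitz_sin.
Qed.

Variables (s1 s2 m : nat) (P Q : S).
Hypothesis s2_gt0 : (0 < s2)%N.
Hypothesis s21 : (s2 <= s1)%N.
Hypothesis hqh : quasi_homogeneous s1 s2 m P Q.
Hypothesis hcenter : center_at_origin (fun x y => P.[x, y]) (fun x y => Q.[x, y]).

Definition angular (x : R) :=
  s1%:R * cos x * Q.[cos x, sin x] - s2%:R * sin x * P.[cos x, sin x].
Definition radial (x : R) := cos x * P.[cos x, sin x] + sin x * Q.[cos x, sin x].

Lemma bounded_lipschitz_angular : bounded_lipschitz angular.
Proof.
rewrite /angular; apply: bounded_lipschitzD.
  apply: bounded_lipschitzM; last exact: bounded_lipschitz_hornerXY.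
  by apply: bounded_lipschitzM; [exact: bounded_lipschitz_cst|exact: bounded_lipschitz_cos].
under eq_fun do rewrite -mulNr.
apply: bounded_lipschitzM; last exact: bounded_lipschitz_hornerXY.
under eq_fun do rewrite -mulNr.
by apply: bounded_lipschitzM; [exact: bounded_lipschitz_cst|exact: bounded_lipschitz_sin].
Qed.

Lemma s1_gt0 : (0 < s1)%N. Proof. exact: leq_trans s2_gt0 s21. Qed.

Lemma periodicX (x : R -> R) T N t : (forall t, x (t + T) = x t) -> x (t + N%:R * T) = x t.
Proof.
move=> H; elim: N => [|N IH]; first by rewrite mul0r addr0.
by rewrite -natr1 mulrDl mul1r addrA H.
Qed.

(* A zero of the angular speed makes the weighted ray through it invariant; the
   motion on a ray is monotone, hence not periodic. *)
Lemma angular_neq0 th0 : angular th0 != 0.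
Proof.
apply/eqP => ang0.
have [F0 G0 [U [oU U0] HU]] := hcenter.
have [r r0 Hr] : exists2 r, 0 < r & forall a b, `|a| < r -> `|b| < r -> U (a, b).
  have := open_nbhs_nbhs (conj oU U0); rewrite nbhsE => -[V [oV V0] VU].
  have /nbhs_ballP[r /= r0 Hr] : nbhs (0 : R * R) V by exact: open_nbhs_nbhs.
  exists r => // a b ar br; apply: VU; apply: Hr; split; rewrite /= -ball_normE /=.
    by rewrite sub0r normrN.
  by rewrite sub0r normrN.
have s1p := s1_gt0.
pose mu := Num.min 1 (r / 2).
have mu0 : 0 < mu by rewrite lt_min ltr01 divr_gt0.
have mur : mu < r by rewrite gt_min; apply/orP; right; rewrite ltr_pdivrMr // mulr_natr mulr2n ltrDl.
have muX n : (0 < n)%N -> mu ^+ n < r.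
  case: n => // n _; apply: le_lt_trans mur; rewrite exprS ler_piMr ?(ltW mu0) //.
  by rewrite exprn_ile1 ?(ltW mu0) // ge_min lexx.
pose a := mu ^+ s1 * cos th0; pose b := mu ^+ s2 * sin th0.
have Uab : U (a, b).
  apply: Hr; rewrite normrM normrX (gtr0_norm mu0).
    by apply: le_lt_trans (muX s1 s1p); rewrite ler_piMr ?exprn_ge0 ?(ltW mu0) ?cos_max.
  by apply: le_lt_trans (muX s2 s2_gt0); rewrite ler_piMr ?exprn_ge0 ?(ltW mu0) ?sin_max.
have cs0 : (cos th0, sin th0) <> (0, 0).
  by move=> [c s]; have := cos2Dsin2 th0; rewrite c s expr0n /= addr0 => /eqP; rewrite eq_sym oner_eq0.
have ab0 : (a, b) <> (0, 0).
  move=> [/eqP]; rewrite mulf_eq0 expf_eq0 s1p (gt_eqF mu0) /= => /eqP c /eqP.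
  rewrite mulf_eq0 expf_eq0 s2_gt0 (gt_eqF mu0) /= => /eqP s.
  by apply: cs0; rewrite c s.
have [x [y [T T0 [sol [x0 y0] per [t1 nt1] stay]]]] := HU a b Uab ab0.
(* Whole periods are added to reach a nonnegative time, since the polar lift starts at time 0. *)
have [t2 t20 nt2] : exists2 t2, 0 <= t2 & (x t2, y t2) <> (a, b).
  exists (t1 + (Num.truncn (`|t1| / T)).+1%:R * T).
    have := Num.Theory.truncnS_gt (`|t1| / T); rewrite ltr_pdivrMr // => H.
    by have := ler_norm (- t1); rewrite normrN; lra.
  by rewrite !periodicX => [//|t|t]; case: (per t).
pose T1 := (Num.truncn (t2 / T)).+1%:R * T.
have t2T1 : t2 <= T1.
  by have := Num.Theory.truncnS_gt (t2 / T); rewrite ltr_pdivrMr // => H; apply: ltW.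
have T10 : 0 <= T1 := le_trans t20 t2T1.
have zT1 : x T1 = a /\ y T1 = b.
  rewrite -x0 -y0 /T1 -[_ * T]add0r !periodicX => [//|t|t]; by case: (per t).
have sol' (t : R) : is_derive t 1 x (P.[x t, y t]) /\ is_derive t 1 y (Q.[x t, y t]) := sol t I.
have cx t : {for t, continuous x} := derive_continuous (sol' t).1.
have cy t : {for t, continuous y} := derive_continuous (sol' t).2.
have [||||||L [th [dL [dth [L0 th00 Hpol]]]]] :=
  @polar_lift R s1 s2 x y (fun t => P.[x t, y t]) (fun t => Q.[x t, y t]) T1 th0 mu s2_gt0 s21 T10.
- by move=> t _.
- by move=> t _; split; apply: hornerXY_continuous.
- by move=> t _; have [_] := stay t.
- exact: mu0.
- exact: x0.
- exact: y0.
have Ps l x' : P.[l ^+ s1 * cos x', l ^+ s2 * sin x'] = l ^+ (s1 + m - 1) * P.[cos x', sin x'].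
  by apply: quasi_homogeneous_all => z z0; exact: (hqh _ _ z0).1.
have Qs l x' : l ^+ (s1 - s2) * Q.[l ^+ s1 * cos x', l ^+ s2 * sin x'] =
    l ^+ (s1 + m - 1) * Q.[cos x', sin x'].
  rewrite (@quasi_homogeneous_all R Q s1 s2 (s2 + m - 1)) => [|z z0]; last exact: (hqh _ _ z0).2.
  by rewrite mulrA -exprD; congr (_ ^+ _ * _); lia.
pose kap t := s1%:R * cos (th t) ^+ 2 + s2%:R * sin (th t) ^+ 2.
have kap0 t : 0 < kap t by apply: weight_gt0 => //; exact: cos2Dsin2.
pose q t := L t ^+ (s1 + m - 1) / (kap t * L t ^+ s1).
have q0 t : 0 <= t <= T1 -> 0 < q t.
  by move=> /Hpol[Lt _ _ _ _]; rewrite divr_gt0 ?mulr_gt0 ?exprn_gt0.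
have dthE t : 0 <= t <= T1 -> dth t = q t * angular (th t).
  move=> tT; have [Lt _ [xE yE] _ E] := Hpol t tT.
  have kn : kap t * L t ^+ s1 != 0 by rewrite mulf_neq0 ?gt_eqF ?exprn_gt0.
  apply: (mulfI kn); rewrite E xE yE Ps Qs /q /angular; field.
  by rewrite !gt_eqF ?exprn_gt0.
have dLE t : 0 <= t <= T1 -> dL t = L t * q t * radial (th t).
  move=> tT; have [Lt _ [xE yE] E _] := Hpol t tT.
  have kn : kap t * L t ^+ s1 != 0 by rewrite mulf_neq0 ?gt_eqF ?exprn_gt0.
  apply: (mulfI kn); rewrite E xE yE Ps Qs /q /radial; field.
  by rewrite !gt_eqF ?exprn_gt0.
have cq t : 0 <= t <= T1 -> {for t, continuous q}.
  move=> tT; have [Lt [dLt dtht] _ _ _] := Hpol t tT.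
  have cL := derive_continuous dLt; have cth := derive_continuous dtht.
  have cc : {for t, continuous (fun t => cos (th t))}.
    by apply: cont_compf => //; exact: continuous_cos.
  have cs : {for t, continuous (fun t => sin (th t))}.
    by apply: cont_compf => //; exact: continuous_sin.
  apply: cont_mulf; first exact: cont_expf.
  apply: cont_invf; first by rewrite mulf_neq0 ?gt_eqF ?exprn_gt0.
  apply: cont_mulf; last exact: cont_expf.
  apply: cont_addf; apply: cont_mulf; first [exact: cont_cstf|exact: cont_expf].
have [p [p0 dp]] : exists p, p 0 = 0 /\ forall t : R, is_derive t 1 p (q (clamp T1 t)).
  apply: primitive_exists => t; apply: (@cont_compf R q (clamp T1)).
    exact: continuous_clamp.
  by apply: cq; exact: clamp_in.
have [M [K [M0 K0 _ angL]]] := bounded_lipschitz_angular.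
(* The constant [th0] solves the angular equation because [angular th0] vanishes. Gronwall with eta
   = 0 leaves no other solution; the clock is a primitive of the positive factor [q]. *)
have thc t : 0 <= t <= T1 -> th t = th0.
  move=> /andP[t0 tT].
  have H := @gronwall R (fun t => th t - th0) dth p (fun t => q (clamp T1 t)) K 0 t t0 K0 (lexx _).
  apply/eqP; rewrite -subr_eq0 -normr_le0; have := H _ _ _ _ _; rewrite mul0r; apply.
  - move=> u /andP[u0 ut]; have uT : 0 <= u <= T1 by rewrite u0 (le_trans ut).
    have [_ [_ dtht] _ _ _] := Hpol u uT.
    exact: (derive_eqf (derive_addf dtht (derive_cstf (- th0) u)) (addr0 _)).
  - by move=> u _; apply/ltW/q0/clamp_in.
  - move=> u /andP[u0 ut]; have uT : 0 <= u <= T1 by rewrite u0 (le_trans ut).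
    rewrite addr0 clamp_id // dthE // normrM (gtr0_norm (q0 u uT)) ler_wpM2l ?(ltW (q0 u uT)) //.
    by rewrite -[angular (th u)]subr0 -ang0.
  - by rewrite th00 subrr.
have dL0 t : 0 <= t <= T1 -> is_derive t 1 L (L t * q t * radial th0).
  move=> tT; have [_ [dLt _] _ _ _] := Hpol t tT.
  by rewrite -(thc t tT) -dLE.
have T1T : 0 <= T1 <= T1 by rewrite T10 lexx.
have LT1 : L T1 = mu.
  have [LT _ [xE yE] _ _] := Hpol T1 T1T.
  move: zT1; rewrite xE yE thc // => -[e1 e2].
  have [c0|c0] := eqVneq (cos th0) 0; last first.
    by move: e1; rewrite /a => /(mulIf c0) /eqP; rewrite eqrXn2 ?ltW // => /eqP.
  have sn0 : sin th0 != 0 by apply/eqP => sn0; apply: cs0; rewrite c0 sn0.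
  by move: e2; rewrite /b => /(mulIf sn0) /eqP; rewrite eqrXn2 ?ltW // => /eqP.
have T1p : 0 < T1 by rewrite mulr_gt0.
have rad0 : radial th0 = 0.
  apply/eqP; case: ltgtP => // rad; exfalso.
  - have : - L 0 < - L T1.
      apply: (@derive_gt0_lt R (fun t => - L t) (fun t => - (L t * q t * radial th0))) => // t tT.
        exact: (derive_oppf (dL0 t tT)).
      have [Lt _ _ _ _] := Hpol t tT.
      by rewrite -mulrN mulr_gt0 ?oppr_gt0 // mulr_gt0 // q0.
    by rewrite L0 LT1 ltxx.
  - have : L 0 < L T1.
      apply: (@derive_gt0_lt R L (fun t => L t * q t * radial th0)) => // t tT.
      have [Lt _ _ _ _] := Hpol t tT.
      by rewrite mulr_gt0 // mulr_gt0 // q0.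
    by rewrite L0 LT1 ltxx.
have t2T : 0 <= t2 <= T1 by rewrite t20.
apply: nt2; have [_ _ [-> ->] _ _] := Hpol t2 t2T.
rewrite thc // (_ : L t2 = mu) // -L0; apply: derive_eq0_cst => // t /andP[t0 tt2].
have tT : 0 <= t <= T1 by rewrite t0 (le_trans tt2).
by apply: (derive_eqf (dL0 t tT)); rewrite rad0 mulr0.
Qed.

Lemma angular_sign : exists2 sg : R, sg = 1 \/ sg = -1 & forall x, 0 < sg * angular x.
Proof.
have ca : continuous angular.
  move=> x.
  have c : {for x, continuous (@cos R)} := @continuous_cos R x.
  have s : {for x, continuous (@sin R)} := @continuous_sin R x.
  apply: (@cont_addf R (fun x => s1%:R * cos x * Q.[cos x, sin x])
    (fun x => - (s2%:R * sin x * P.[cos x, sin x]))).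
    by apply: cont_mulf; [apply: cont_mulf => //; exact: cont_cstf|exact: hornerXY_continuous].
  apply: (@cont_oppf R (fun x => s2%:R * sin x * P.[cos x, sin x])).
  by apply: cont_mulf; [apply: cont_mulf => //; exact: cont_cstf|exact: hornerXY_continuous].
have H x y : angular x < 0 -> 0 < angular y -> False.
  move=> ax ay.
  have X a b : a <= b -> angular a < 0 /\ 0 < angular b \/ angular b < 0 /\ 0 < angular a -> False.
    move=> ab Hab.
    have [||c _ c0] := @IVT R angular a b 0 ab.
    - exact: continuous_subspaceT.
    - by case: Hab => -[u v]; rewrite ge_min le_max !(ltW u) !(ltW v) ?orbT.
    by have := angular_neq0 c; rewrite c0 eqxx.
  have [xy|yx] := leP x y; first by apply: (X _ _ xy); left.
  by apply: (X _ _ (ltW yx)); right.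
have [a0|a0] := ltP 0 (angular 0).
  exists 1; first by left.
  move=> x; rewrite mul1r ltNge le_eqVlt (negbTE (angular_neq0 x)) /=.
  by apply/negP => ax; exact: H ax a0.
exists (-1); first by right.
move=> x; rewrite mulN1r oppr_gt0 ltNge le_eqVlt eq_sym (negbTE (angular_neq0 x)) /=.
apply/negP => ax; apply: (H 0 x) => //.
by rewrite lt_neqAle a0 angular_neq0.
Qed.

(** If m were 0, then Q(l^s1, 0) would be Q(1, 0) l^(s2 - 1). As Q vanishes at the origin, Q(l^s1,
    0) is divisible by l^s1, and s2 - 1 < s1 forces Q(1, 0) = 0, against the nonvanishing of the
    angular speed at angle 0. *)
Lemma weight_degree_gt0 : (0 < m)%N.
Proof.
have [_ Q0 _] := hcenter.
have Q1 : Q.[1, 0] != 0.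
  by have := angular_neq0 0; rewrite /angular cos0 sin0 mulr0 mul0r subr0 mulf_eq0 negb_or => /andP[].
have [N HN] := hornerXY_exists_coef Q.
pose u : {poly R} := \sum_(i < N) Q`_i`_0 *: 'X^i.
have uE z : u.[z] = Q.[z, 0].
  rewrite HN horner_sum; apply: eq_bigr => i _; rewrite hornerZ hornerXn.
  case: (N) i => [[]//|N' i]; rewrite big_ord_recl expr0 mulr1 big1 ?addr0 // => j _.
  by rewrite expr0n /= mulr0.
have /factor_theorem[v uv] : root u 0 by rewrite rootE uE Q0.
rewrite subr0 in uv.
have H : Q.[1, 0] *: 'X^(s2 + m - 1) - (v \Po 'X^s1) * 'X^s1 = 0.
  apply: poly_eq0_pos => l l0; rewrite !hornerE horner_comp !hornerE.
  have E := (hqh 1 0 l0).2; rewrite mulr1 mulr0 in E.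
  have -> : v.[l ^+ s1] * l ^+ s1 = Q.[l ^+ s1, 0] by rewrite -uE uv !hornerE.
  by rewrite E mulrC subrr.
rewrite lt0n; apply/eqP => m0; rewrite m0 addn0 in H.
have := congr1 (fun w : {poly R} => w`_(s2 - 1)) H.
rewrite coefB coefZ coefXn eqxx mulr1 coefMXn.
have -> : (s2 - 1 < s1)%N by rewrite (leq_trans _ s21) // subn1 prednK.
by rewrite subr0 coef0 => /eqP; rewrite (negbTE Q1).
Qed.
End Center.

(** * The first return map *)

Section TrueOrbit.
Variable R : realType.
Local Notation S := {poly {poly R}}.
Variables (s1 s2 m n k : nat) (P Q : S) (p q : nat -> S) (sg : R).
Hypothesis s2_gt0 : (0 < s2)%N.
Hypothesis s21 : (s2 <= s1)%N.
Hypothesis hqh : quasi_homogeneous s1 s2 m P Q.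
Hypothesis pdeg : forall i, deg_le n (p i.+1).
Hypothesis qdeg : forall i, deg_le n (q i.+1).
Hypothesis hp : analytic_perturbation p.
Hypothesis hq : analytic_perturbation q.
Hypothesis sg1 : sg = 1 \/ sg = -1.
Local Notation W := (weight_bound s1 s2 n).
Local Notation e0 := (base_weight s1 m).
Local Notation al0 := (radial0 P Q sg).
Local Notation be0 := (angular0 s1 s2 P Q sg).
Local Notation al := (radial_coef s1 s2 n p q sg).
Local Notation be := (angular_coef s1 s2 n p q sg).
Hypothesis be0_gt0 : forall x, 0 < be0 x.
Hypothesis e0W : (e0 <= W)%N.
Local Notation A := (fieldv W e0 k al0 al).
Local Notation B := (fieldv W e0 k be0 be).
Variable r0 : R -> R.
Hypothesis r0_0 : r0 0 = 1.
Hypothesis r0_gt0 : forall x, 0 < r0 x.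
Hypothesis r0_derive : forall x : R, is_derive x 1 r0 (r0 x * radial_rate al0 be0 x).
Variables F G : R -> S.
Hypothesis tF : tame W F.
Hypothesis tG : tame W G.
Hypothesis FG : coef_derive F G.
Hypothesis F0 : F 0 = 1.
Hypothesis F1 : forall x, divXn 1 (F x - 1).
Hypothesis FGres : forall x, divXn k.+1 (approx_resid W e0 k al0 be0 r0 al be x (F x) (G x)).
Local Notation Z := (approx_orbit e0 r0 F).
Local Notation Pe := (perturbed P p).
Local Notation Qe := (perturbed Q q).

Lemma sin0_cos_gt0_lt2pi (x : R) : 0 < x < 2 * pi -> sin x = 0 -> 0 < cos x -> False.
Proof.
move=> /andP[x0 x2] sx cx; have [xp|xp|xp] := ltgtP x pi.
- by have := sin_gt0_pi (x := x); rewrite x0 xp sx ltxx => /(_ isT).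
- have := sin_gt0_pi (x := x - pi); rewrite subr_gt0 xp /= ltrBlDr -[pi + pi]mulr2n -mulr_natl x2.
  by rewrite sinB sx cospi sinpi mul0r mulr0 subrr ltxx => /(_ isT).
- by move: cx; rewrite xp cospi ltr0N1.
Qed.

Lemma perturbed_near_trunc (X : R) : exists2 C, 0 < C & exists2 r, 0 < r &
  (forall eps (f g : R -> R) t, `|eps| < r -> {for t, continuous f} -> {for t, continuous g} ->
    {for t, continuous (fun t => Pe eps (f t) (g t))} /\
    {for t, continuous (fun t => Qe eps (f t) (g t))}) /\
  (forall eps x y, `|eps| < r -> `|x| <= X -> `|y| <= X ->
    `|Pe eps x y - trunc_field k P p eps x y| <= C * `|eps| ^+ k.+1 /\
    `|Qe eps x y - trunc_field k Q q eps x y| <= C * `|eps| ^+ k.+1).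
Proof.
have [rp rp0 [cp /(_ X)[Cp Cp0 Hp]]] := perturbation_expansion k pdeg hp.
have [rq rq0 [cq /(_ X)[Cq Cq0 Hq]]] := perturbation_expansion k qdeg hq.
exists (Cp + Cq); first exact: addr_gt0.
exists (Num.min rp rq); first by rewrite lt_min rp0.
split=> [eps f g t|eps x y]; rewrite lt_min => /andP[ep eq].
  move=> cf cg; split.
    by apply: cont_addf; [exact: hornerXY_continuous|exact: cp].
  by apply: cont_addf; [exact: hornerXY_continuous|exact: cq].
move=> xX yX; have ek : 0 <= `|eps| ^+ k.+1 by rewrite exprn_ge0.
have H1 := Hp eps x y ep xX yX; have H2 := Hq eps x y eq xX yX.
have E (u : S) (v : nat -> S) : perturbed u v eps x y - trunc_field k u v eps x y =
    pert_lim v eps x y - \sum_(i < k) eps ^+ i.+1 * (v i.+1).[x, y].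
  by rewrite /perturbed /trunc_field /pert_lim; ring.
by rewrite !E; split; [apply: le_trans H1 _|apply: le_trans H2 _];
  rewrite ler_wpM2r // ?lerDl ?lerDr ltW.
Qed.

Lemma sg_sq : sg * sg = 1. Proof. by case: sg1 => ->; ring. Qed.

Lemma sin_sg_mul x : sin (sg * x) = polar_sin sg x.
Proof. by rewrite /polar_sin; case: sg1 => ->; rewrite ?mul1r // !mulN1r sinN. Qed.

Lemma cos_sg_mul x : cos (sg * x) = polar_cos x.
Proof. by rewrite /polar_cos; case: sg1 => ->; rewrite ?mul1r // mulN1r cosN. Qed.

Lemma perturbed_polar_lift (eps T l : R) (x y : R -> R) : 0 < l -> 0 <= T ->
  (forall (f g : R -> R) t, {for t, continuous f} -> {for t, continuous g} ->
    {for t, continuous (fun t => Pe eps (f t) (g t))} /\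
    {for t, continuous (fun t => Qe eps (f t) (g t))}) ->
  solution_on `[0, T] (Pe eps) (Qe eps) x y ->
  (forall t, 0 <= t <= T -> (x t, y t) <> (0, 0)) ->
  x 0 = l ^+ s1 -> y 0 = 0 ->
  exists L ph dL dph : R -> R, [/\ L 0 = l, ph 0 = 0 & forall t, 0 <= t <= T ->
   [/\ 0 < L t, is_derive t 1 L (dL t) /\ is_derive t 1 ph (dph t),
       x t = L t ^+ s1 * polar_cos (ph t) /\ y t = L t ^+ s2 * polar_sin sg (ph t),
       (s1%:R * polar_cos (ph t) ^+ 2 + s2%:R * polar_sin sg (ph t) ^+ 2) * L t ^+ s1 * dL t =
         L t * (polar_cos (ph t) * Pe eps (x t) (y t) +
           polar_sin sg (ph t) * (L t ^+ (s1 - s2) * Qe eps (x t) (y t))) &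
       (s1%:R * polar_cos (ph t) ^+ 2 + s2%:R * polar_sin sg (ph t) ^+ 2) * L t ^+ s1 * dph t =
         sg * (s1%:R * polar_cos (ph t) * (L t ^+ (s1 - s2) * Qe eps (x t) (y t)) -
           s2%:R * polar_sin sg (ph t) * Pe eps (x t) (y t))]].
Proof.
move=> l0 T0 hc sol nz x0 y0.
have sol' (t : R) : 0 <= t <= T -> is_derive t 1 x (Pe eps (x t) (y t)) /\
    is_derive t 1 y (Qe eps (x t) (y t)).
  by move=> tT; apply: sol; rewrite /= in_itv.
have [||||||L [th [dL [dth [L0 th0 H]]]]] := @polar_lift R s1 s2 x y
  (fun t => Pe eps (x t) (y t)) (fun t => Qe eps (x t) (y t)) T 0 l s2_gt0 s21 T0.
- exact: sol'.
- move=> t tT; have [dx dy] := sol' t tT.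
  by apply: hc; apply: derive_continuous; eassumption.
- exact: nz.
- exact: l0.
- by rewrite cos0 mulr1.
- by rewrite sin0 mulr0.
exists L, (fun t => sg * th t), dL, (fun t => sg * dth t).
split => // [|t tT]; first by rewrite th0 mulr0.
have thE : th t = sg * (sg * th t) by rewrite mulrA sg_sq mul1r.
have [Lt [dLt dtht] [xE yE] E1 E2] := H t tT.
have c : cos (th t) = polar_cos (sg * th t) by rewrite {1}thE cos_sg_mul.
have s : sin (th t) = polar_sin sg (sg * th t) by rewrite {1}thE sin_sg_mul.
rewrite c s in xE yE E1 E2.
split => //.
- split => //; apply: (derive_eqf (derive_mulf (derive_cstf sg t) dtht)); ring.
- by rewrite mulrCA E2.
Qed.

(** A lower bound on the weighted radius keeps the orbit at a definite distance from the origin,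
    which is what prevents it from leaving the domain of the polar lift. *)
Lemma weighted_norm_bound (L lam a b : R) (i j : nat) : 0 < lam -> lam <= L ->
  a ^+ 2 + b ^+ 2 = 1 ->
  Num.min (lam ^+ i ^+ 2) (lam ^+ j ^+ 2) <= (L ^+ i * a) ^+ 2 + (L ^+ j * b) ^+ 2.
Proof.
move=> l0 lL ab; set mm := Num.min _ _.
have H d : lam ^+ d ^+ 2 <= L ^+ d ^+ 2.
  by rewrite -!exprM lerXn2r ?nnegrE // ?ltW // (lt_le_trans l0).
have m1 : mm <= L ^+ i ^+ 2 by rewrite ge_min H.
have m2 : mm <= L ^+ j ^+ 2 by rewrite ge_min H orbT.
rewrite -[mm]mulr1 -ab mulrDr !exprMn.
by apply: lerD; rewrite ler_wpM2r ?sqr_ge0.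
Qed.

Lemma polar_error (Lam E dd cph sph tp tq pe qe L : R) : 0 < L <= Lam -> 0 <= E ->
  `|cph| <= 1 -> `|sph| <= 1 -> 0 <= dd -> L ^+ (s1 - s2) <= dd ->
  `|pe - tp| <= E -> `|qe - tq| <= E ->
  `|L * (cph * pe + sph * (L ^+ (s1 - s2) * qe)) - L * (cph * tp + sph * (L ^+ (s1 - s2) * tq))|
     <= Lam * (1 + dd) * E /\
  `|sg * (s1%:R * cph * (L ^+ (s1 - s2) * qe) - s2%:R * sph * pe) -
    sg * (s1%:R * cph * (L ^+ (s1 - s2) * tq) - s2%:R * sph * tp)| <= (s1%:R * dd + s2%:R) * E.
Proof.
move=> /andP[L0 LL] E0 c1 s1' d0 Ld Hp Hq.
have Ld0 : 0 <= L ^+ (s1 - s2) by rewrite exprn_ge0 // ltW.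
have A1 : `|cph * (pe - tp)| <= E.
  by rewrite normrM; apply: le_trans (ler_wpM2r _ c1) _; rewrite ?mul1r.
have A2 : `|sph * (pe - tp)| <= E.
  by rewrite normrM; apply: le_trans (ler_wpM2r _ s1') _; rewrite ?mul1r.
have D1 : `|L ^+ (s1 - s2) * (qe - tq)| <= dd * E.
  by rewrite normrM (ger0_norm Ld0) ler_pM.
have A3 : `|sph * (L ^+ (s1 - s2) * (qe - tq))| <= dd * E.
  by rewrite normrM; apply: le_trans (ler_wpM2r _ s1') _; rewrite ?mul1r.
have A4 : `|cph * (L ^+ (s1 - s2) * (qe - tq))| <= dd * E.
  by rewrite normrM; apply: le_trans (ler_wpM2r _ c1) _; rewrite ?mul1r.
split.
  have -> : L * (cph * pe + sph * (L ^+ (s1 - s2) * qe)) -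
      L * (cph * tp + sph * (L ^+ (s1 - s2) * tq)) =
      L * (cph * (pe - tp) + sph * (L ^+ (s1 - s2) * (qe - tq))) by ring.
  rewrite normrM (gtr0_norm L0) -mulrA; apply: ler_pM => //; first exact: ltW.
  by rewrite mulrDl mul1r; apply: le_trans (ler_normD _ _) (lerD A1 A3).
have -> : sg * (s1%:R * cph * (L ^+ (s1 - s2) * qe) - s2%:R * sph * pe) -
    sg * (s1%:R * cph * (L ^+ (s1 - s2) * tq) - s2%:R * sph * tp) =
    sg * (s1%:R * (cph * (L ^+ (s1 - s2) * (qe - tq))) - s2%:R * (sph * (pe - tp))) by ring.
have -> : `|sg * (s1%:R * (cph * (L ^+ (s1 - s2) * (qe - tq))) - s2%:R * (sph * (pe - tp)))| =
   `|s1%:R * (cph * (L ^+ (s1 - s2) * (qe - tq))) - s2%:R * (sph * (pe - tp))|.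
  by rewrite normrM; case: sg1 => ->; rewrite ?normrN normr1 mul1r.
apply: le_trans (ler_normB _ _) _; rewrite mulrDl; apply: lerD.
  by rewrite normrM normr_nat -mulrA ler_wpM2l.
by rewrite normrM normr_nat ler_wpM2l.
Qed.

(** A given return orbit might a priori meet the origin or stray from the approximate one. It is
    followed up to a first exit; the Gronwall bound, being smaller than the allowed deviation,
    excludes every exit except the completion of a turn, and the first return condition identifies
    that moment with [T]. *)
Lemma first_return_expansion (l : R) : 0 < l ->
  exists2 C, 0 < C & exists2 eps1, 0 < eps1 & forall eps T l' (x y : R -> R),
    `|eps| < eps1 -> 0 < T -> 0 < l' ->
    solution_on `[0, T] (Pe eps) (Qe eps) x y ->
    x 0 = l ^+ s1 /\ y 0 = 0 -> x T = l' ^+ s1 /\ y T = 0 ->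
    (forall t, 0 < t < T -> ~ (0 < x t /\ y t = 0)) ->
    `|l' - Z (2 * pi) l eps| <= C * `|eps| ^+ k.+1.
Proof.
move=> l0.
have s1p : (0 < s1)%N := leq_trans s2_gt0 s21.
have al0c := @radial0_continuous R P Q sg.
have be0c := @angular0_continuous R s1 s2 P Q sg.
have alc := @radial_coef_continuous R s1 s2 n p q sg.
have bec := @angular_coef_continuous R s1 s2 n p q sg.
have pp := twopi_gt0 R.
have ln : l != 0 by rewrite gt_eqF.
have [lamZ [LamZ [e1 [lamZ0 e10 HZ]]]] := approx_orbit_range al0c be0c alc bec be0_gt0 e0W
  r0_gt0 r0_derive tF tG F1 FGres (2 * pi) 0 ln.
(* Half of the minimal approximate radius: a deviation of at most [rho] leaves the true radius
   between [lam] and [Lam]. *)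
pose rho := lamZ / 2; have rho0 : 0 < rho by rewrite divr_gt0.
have lamlamZ : lamZ / 2 <= lamZ by rewrite ger_pMr // invf_le1 // ler1n.
pose lam := lamZ / 2; pose Lam := LamZ + rho.
have lam0 : 0 < lam by [].
have [C3 C30 [e3 e30 H3]] := approx_orbit_compare al0c be0c alc bec be0_gt0 e0W r0_derive
  tF tG FG F1 FGres (-1) (2 * pi) l Lam l0 lam0.
have [c7 c70 [e7 e70 H7]] := angular_lower_bound W e0 k be0c bec be0_gt0 (-1) (2 * pi) Lam lam0.
pose X := Num.max (`|Lam| ^+ s1) (`|Lam| ^+ s2).
have [C4 C40 [e4 e40 [Hc Hpert]]] := perturbed_near_trunc X.
pose dd := `|Lam| ^+ (s1 - s2).
have dd0 : 0 <= dd by rewrite exprn_ge0.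
pose C5 := `|Lam| * (1 + dd) + (s1%:R * dd + s2%:R).
have C50 : 0 < C5.
  rewrite /C5 ltr_wpDl ?mulr_ge0 ?addr_ge0 // ltr_wpDl ?mulr_ge0 //.
  by rewrite ltr0n.
pose C6 := C5 * C4; have C60 : 0 < C6 by rewrite mulr_gt0.
pose e5 := e3 / C6; have e50 : 0 < e5 by rewrite divr_gt0.
pose e6 := rho / (C3 * (C6 + 1)).
have C7 : 0 < C3 * (C6 + 1) by rewrite mulr_gt0 // addr_gt0.
have e60 : 0 < e6 by rewrite divr_gt0.
exists (C3 * (C6 + 1)) => //.
exists (Num.min (Num.min e1 e3) (Num.min (Num.min e4 1) (Num.min (Num.min e5 e7) e6))).
  by rewrite !lt_min e10 e30 e40 e50 e60 e70 ltr01.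
move=> eps T l' x y; rewrite !lt_min => /andP[/andP[E1 E3] /andP[/andP[E4 E8] /andP[/andP[E5 E7] E6]]].
move=> T0 l'0 sol [x0 y0] [xT yT] hret.
have epsX : `|eps| ^+ k.+1 <= `|eps| by rewrite exprS ler_piMr // exprn_ile1 // ltW.
have ek0 : 0 <= `|eps| ^+ k.+1 by rewrite exprn_ge0.
pose eta := C6 * `|eps| ^+ k.+1.
have eta_in : 0 <= eta < e3.
  rewrite /eta mulr_ge0 ?(ltW C60) //= mulrC -ltr_pdivlMr //; exact: le_lt_trans epsX E5.
have small : C3 * (eta + `|eps| ^+ k.+1) < rho.
  have -> : C3 * (eta + `|eps| ^+ k.+1) = `|eps| ^+ k.+1 * (C3 * (C6 + 1)) by rewrite /eta; ring.
  by rewrite -ltr_pdivlMr //; exact: le_lt_trans epsX E6.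
pose mm := Num.min (lam ^+ s1 ^+ 2) (lam ^+ s2 ^+ 2).
have mm0 : 0 < mm by rewrite lt_min !exprn_gt0.
have lamlel : lam <= l.
  have /andP[H _] : lamZ <= `|Z 0 l eps| <= LamZ by apply: HZ; rewrite ?E1 // (ltW pp) (le_trans (lerN10 _)) ?ler01.
  by move: H; rewrite approx_orbit_at0 // gtr0_norm //; exact: le_trans lamlamZ.
have solT (t : R) : 0 <= t <= T -> is_derive t 1 x (Pe eps (x t) (y t)) /\
    is_derive t 1 y (Qe eps (x t) (y t)).
  by move=> tT; apply: sol; rewrite /= in_itv.
(* A radius of at least [lam] gives a squared norm of at least [mm], and the threshold mm / 2 leaves
   a margin. Until it is reached the orbit avoids the origin, so the polar lift exists. *)
pose g t := mm / 2 - (x t ^+ 2 + y t ^+ 2).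
have cg t : 0 <= t <= T -> {for t, continuous g}.
  move=> tT; have [dx dy] := solT t tT.
  have cx := derive_continuous dx; have cy := derive_continuous dy.
  apply: (@cont_addf R (fun=> mm / 2) (fun t => - (x t ^+ 2 + y t ^+ 2))); first exact: cont_cstf.
  by apply: cont_oppf; apply: cont_addf; exact: cont_expf.
have g0 : g 0 < 0.
  have := weighted_norm_bound s1 s2 lam0 lamlel (a := 1) (b := 0).
  rewrite expr1n expr0n addr0 mulr1 mulr0 expr0n addr0 => /(_ erefl).
  rewrite /g x0 y0 expr0n addr0 -/mm subr_lt0; apply: lt_le_trans.
  by rewrite gtr_pMr // invf_lt1 // ltr1n.
have [T1 [T10 T1T g1 T1e]] : exists T1, [/\ 0 < T1, T1 <= T,
    forall t, 0 <= t <= T1 -> g t <= 0 & T1 = T \/ g T1 = 0].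
  have [H|[T1 [T10 T1T g1 H]]] := first_zero cg g0.
    by exists T; split => //; [move=> t /H/ltW|left].
  exists T1; split => //; last by right.
  move=> t /andP[t0]; rewrite le_eqVlt => /orP[/eqP ->|tT1]; first by rewrite g1.
  by apply/ltW/H; rewrite t0.
have nz t : 0 <= t <= T1 -> (x t, y t) <> (0, 0).
  by move=> /g1 + [xt yt]; rewrite /g xt yt expr0n addr0 subr0 leNgt divr_gt0.
have sol1 : solution_on `[0, T1] (Pe eps) (Qe eps) x y.
  move=> t; rewrite /= in_itv /= => /andP[t0 tT1]; apply: sol.
  by rewrite /= in_itv /= t0 (le_trans tT1).
have [L [ph [dL [dph [L0 ph0 Hpol]]]]] := perturbed_polar_lift l0 (ltW T10)
  (fun f g t => Hc eps f g t E4) sol1 nz x0 y0.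
pose E t := L t - Z (ph t) l eps.
(* [f] is negative as long as the deviation is below [rho] and the angle lies strictly between -1
   and 2 pi; the bound -1 leaves room below the initial angle 0. *)
pose f t := Num.max (Num.max (`|E t| - rho) (ph t - 2 * pi)) (-1 - ph t).
have cf t : 0 <= t <= T1 -> {for t, continuous f}.
  move=> tT; have [_ [dLt dpht] _ _ _] := Hpol t tT.
  have cL := derive_continuous dLt; have cph := derive_continuous dpht.
  have cZ : {for t, continuous (fun t => Z (ph t) l eps)}.
    by apply: (@cont_compf R (fun x => Z x l eps) ph) => //;
      exact: derive_continuous (approx_orbit_is_derive e0 r0_derive tF tG FG l eps (ph t)).
  have cE : {for t, continuous (fun t => `|E t|)}.
    apply: (@cont_compf R _ E); last exact: norm_continuous.
    by apply: cont_addf => //; exact: cont_oppf.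
  apply: (@continuous_max _ R (fun t => Num.max (`|E t| - rho) (ph t - 2 * pi)) (fun t => -1 - ph t)).
    apply: (@continuous_max _ R (fun t => `|E t| - rho) (fun t => ph t - 2 * pi)).
      by apply: (@cont_addf R (fun t => `|E t|) (fun=> - rho)); [|exact: cont_cstf].
    by apply: (@cont_addf R ph (fun=> - (2 * pi))); [|exact: cont_cstf].
  by apply: (@cont_addf R (fun=> -1) (fun t => - ph t)); [exact: cont_cstf|exact: cont_oppf].
have E00 : E 0 = 0 by rewrite /E L0 ph0 approx_orbit_at0 // subrr.
have f0 : f 0 < 0.
  by rewrite /f E00 ph0 normr0 subr0 !gt_max !sub0r !oppr_lt0 rho0 pp ltr01.
have fle t : f t <= 0 -> [/\ `|E t| <= rho, ph t <= 2 * pi & -1 <= ph t].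
  by rewrite /f !ge_max !subr_le0 => /andP[/andP[]].
pose qq t := ((s1%:R * polar_cos (ph t) ^+ 2 + s2%:R * polar_sin sg (ph t) ^+ 2) * L t ^+ s1)^-1.
have csE t : polar_cos (ph t) ^+ 2 + polar_sin sg (ph t) ^+ 2 = 1.
  by rewrite -cos_sg_mul -sin_sg_mul cos2Dsin2.
have good t : 0 <= t <= T1 -> f t <= 0 -> -1 <= ph t <= 2 * pi /\ lam <= `|L t| <= Lam.
  move=> tT /fle[H1 H2 H4]; have pr : -1 <= ph t <= 2 * pi by rewrite H4.
  split => //; have /andP[Z1 Z2] := HZ (ph t) eps pr E1.
  by apply: (norm_near_range H1 _ Z2); rewrite /rho /lam -splitr.
(* The continuation step: while the orbit has not left the region, the comparison improves the
   deviation bound from [rho] to a quantity of order eps^(k+1). *)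
have core T2 : 0 <= T2 <= T1 -> (forall t, 0 <= t <= T2 -> f t <= 0) ->
    `|E T2| <= C3 * (eta + `|eps| ^+ k.+1) /\ (forall t, 0 <= t <= T2 -> 0 < dph t).
  move=> /andP[T20 T21] fT2.
  have inT t : 0 <= t <= T2 -> 0 <= t <= T1.
    by move=> /andP[t0 tT2]; rewrite t0 (le_trans tT2).
  have qq0 t : 0 <= t <= T2 -> 0 < qq t.
    move=> /inT tT; have [Lt _ _ _ _] := Hpol t tT.
    by rewrite invr_gt0 mulr_gt0 ?exprn_gt0 // weight_gt0.
  have cs1 t : `|polar_cos (ph t)| <= 1 /\ `|polar_sin sg (ph t)| <= 1.
    by rewrite -cos_sg_mul -sin_sg_mul cos_max sin_max.
  have err t : 0 <= t <= T2 ->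
      `|dL t - qq t * (L t * A eps (ph t) (L t))| <= `|qq t| * eta /\
      `|dph t - qq t * B eps (ph t) (L t)| <= `|qq t| * eta.
    move=> tT2; have tT := inT t tT2.
    have [Lt _ [xE yE] EL Eph] := Hpol t tT.
    have [_ /andP[_ LLam]] := good t tT (fT2 t tT2).
    have LLam' : `|L t| <= `|Lam| := le_trans LLam (ler_norm _).
    have [c1 s1'] := cs1 t.
    have xX : `|x t| <= X.
      rewrite xE normrM; apply: le_trans (ler_piMr _ c1) _ => //.
      by rewrite normrX le_max lerXn2r ?nnegrE.
    have yX : `|y t| <= X.
      rewrite yE normrM; apply: le_trans (ler_piMr _ s1') _ => //.
      by rewrite normrX le_max [X in _ || X]lerXn2r ?orbT ?nnegrE.
    have [P1 P2] := Hpert eps _ _ E4 xX yX.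
    have Lr : 0 < L t <= `|Lam| by rewrite Lt -(gtr0_norm Lt).
    have Ld : L t ^+ (s1 - s2) <= dd by rewrite lerXn2r ?nnegrE ?(ltW Lt) // -(gtr0_norm Lt).
    have CE0 : 0 <= C4 * `|eps| ^+ k.+1 by rewrite mulr_ge0 // ltW.
    have [Q1 Q2] := polar_error Lr CE0 c1 s1' dd0 Ld P1 P2.
    have kn : (s1%:R * polar_cos (ph t) ^+ 2 + s2%:R * polar_sin sg (ph t) ^+ 2) * L t ^+ s1 != 0.
      by have := qq0 t tT2; rewrite /qq invr_gt0 => /lt0r_neq0.
    have dLE : dL t = qq t * (L t * (polar_cos (ph t) * Pe eps (x t) (y t) +
           polar_sin sg (ph t) * (L t ^+ (s1 - s2) * Qe eps (x t) (y t)))).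
      by rewrite -EL /qq mulKf.
    have dphE : dph t = qq t * (sg * (s1%:R * polar_cos (ph t) * (L t ^+ (s1 - s2) * Qe eps (x t) (y t)) -
           s2%:R * polar_sin sg (ph t) * Pe eps (x t) (y t))).
      by rewrite -Eph /qq mulKf.
    have AE := radial_field_eval k sg s2_gt0 s21 hqh pdeg qdeg eps (ph t) (L t).
    have BE := angular_field_eval k sg s2_gt0 s21 hqh pdeg qdeg eps (ph t) (L t).
    rewrite -xE -yE in AE BE.
    rewrite dLE dphE AE BE -!mulrBr.
    split; rewrite normrM ler_wpM2l //.
      rewrite mulrBr; apply: le_trans Q1 _.
      by rewrite /eta /C6 -[leRHS]mulrA ler_wpM2r // /C5 lerDl addr_ge0 ?mulr_ge0.
    rewrite mulrBr; apply: le_trans Q2 _.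
    by rewrite /eta /C6 -[leRHS]mulrA ler_wpM2r // /C5 lerDr mulr_ge0 ?addr_ge0.
  have [] := H3 l eps eta T2 L ph dL dph qq _ E3 T20 eta_in.
  - by rewrite (gtr0_norm l0) lexx.
  - by move=> t /inT /Hpol[_ [? _]].
  - by move=> t /inT /Hpol[_ [_ ?]].
  - by move=> t tT; apply: good; [exact: inT|exact: fT2].
  - by move=> t /err[].
  - by move=> t /err[].
  - move=> t tT; have [pr Lr] := good t (inT t tT) (fT2 t tT).
    have [_ /(_ _) Bp] := H7 _ _ _ pr Lr E7; have [Lt _ _ _ _] := Hpol t (inT t tT).
    by rewrite mulr_ge0 ?(ltW (qq0 t tT)) // ltW // Bp.
  - by rewrite L0 ph0 approx_orbit_at0.
  move=> HE Hd; split => // t tT; apply: Hd => //; exact/lt0r_neq0/qq0.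
have ph_gt0 T2 : 0 < T2 <= T1 -> (forall t, 0 <= t <= T2 -> 0 < dph t) -> 0 < ph T2.
  move=> /andP[T20 T21] Hd; rewrite -ph0; apply: (derive_gt0_lt T20 _ Hd) => t /andP[t0 tT2].
  by have /Hpol[_ [_ ?]] : 0 <= t <= T1 by rewrite t0 (le_trans tT2).
have T11 : 0 <= T1 <= T1 by rewrite lexx ltW.
(* If [f] stays negative up to [T1], the radius is still at least [lam], so the norm threshold was
   not reached and T1 = T. But a return to the positive half-axis at an angle strictly between 0 and
   2 pi is impossible. *)
have [Hf|[T2 [T20 T21 fT2 Hf]]] := first_zero cf f0.
  have [_ Hd] := core T1 T11 (fun t tT => ltW (Hf t tT)).
  have php : 0 < ph T1 by apply: ph_gt0 Hd; rewrite T10 lexx.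
  have [LT _ [xE yE] _ _] := Hpol T1 T11.
  have [_ /andP[LTlam _]] := good T1 T11 (ltW (Hf T1 T11)).
  rewrite (gtr0_norm LT) in LTlam.
  have nb := weighted_norm_bound s1 s2 lam0 LTlam (csE T1).
  rewrite -xE -yE -/mm in nb.
  case: T1e => [T1e|/subr0_eq gT1]; last first.
    by exfalso; move: nb; rewrite -gT1 leNgt gtr_pMr // invf_lt1 // ltr1n.
  exfalso; apply: (@sin0_cos_gt0_lt2pi (ph T1)).
  - have := Hf T1 T11; rewrite /f !gt_max php => /andP[/andP[_ H] _] /=.
    by rewrite -subr_lt0.
  - move: yE; rewrite T1e yT => /esym/eqP; rewrite mulf_eq0 expf_eq0 (gt_eqF (_ : 0 < L T)).
      rewrite andbF /= /polar_sin mulf_eq0 => /orP[/eqP sg0|/eqP //].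
      by move: sg_sq; rewrite sg0 mul0r => /eqP; rewrite eq_sym oner_eq0.
    by rewrite -T1e.
  - have : 0 < x T1 by rewrite T1e xT exprn_gt0.
    by rewrite xE pmulr_rgt0 // exprn_gt0.
have T2T1 : 0 <= T2 <= T1 by rewrite ltW.
have [ET2 Hd] : `|E T2| <= C3 * (eta + `|eps| ^+ k.+1) /\ (forall t, 0 <= t <= T2 -> 0 < dph t).
  apply: core => // t /andP[t0]; rewrite le_eqVlt => /orP[/eqP ->|tT2]; first by rewrite fT2.
  by apply/ltW/Hf; rewrite t0.
have php : 0 < ph T2 by apply: ph_gt0 Hd; rewrite T20.
(* At the exit the deviation is strictly below [rho] and the angle is positive, so the only
   constraint that can be saturated is the one at 2 pi. *)
have ph2 : ph T2 = 2 * pi.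
  apply/eqP; rewrite -subr_eq0 eq_le.
  have := fT2; rewrite /f => fT2'.
  have : ph T2 - 2 * pi <= 0 by rewrite -fT2' !le_max lexx orbT.
  move=> ->; rewrite leNgt; apply/negP => Hlt.
  have : f T2 < 0.
    rewrite /f !gt_max Hlt !subr_lt0 (le_lt_trans ET2 small) andbT /=.
    by apply: lt_trans php; rewrite oppr_lt0 ltr01.
  by rewrite fT2 ltxx.
have [LT _ [xE yE] _ _] := Hpol T2 T2T1.
have c1 : polar_cos (ph T2) = 1 by rewrite ph2 /polar_cos mulr_natl cos2pi.
have s0 : polar_sin sg (ph T2) = 0 by rewrite ph2 /polar_sin mulr_natl sin2pi mulr0.
rewrite c1 mulr1 in xE; rewrite s0 mulr0 in yE.
(* A full turn completed before [T] would be an earlier return to the half-axis. *)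
have T2T : T2 = T.
  apply/eqP; rewrite eq_le (le_trans T21 T1T) leNgt; apply/negP => T2T.
  by apply: (hret T2); rewrite ?T20 ?T2T // xE yE exprn_gt0.
have LT' : L T2 = l'.
  apply/eqP; rewrite -(@eqrXn2 _ s1) ?ltW //.
  by rewrite -xE T2T xT.
rewrite -LT' -ph2; apply: le_trans ET2 _; rewrite /eta le_eqVlt; apply/orP; left; apply/eqP; ring.
Qed.

End TrueOrbit.

(** * Counting zeros *)

Section Counting.
Variable R : realType.

(** Letting eps tend to 0 kills [c 0]; division by eps then lowers the order by one. *)
Lemma poly_small_coef_eq0 (k : nat) (c : nat -> R) (C r : R) : 0 < r ->
  (forall eps, 0 < eps < r -> `|\sum_(i < k.+1) eps ^+ i * c i| <= C * eps ^+ k.+1) ->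
  forall i, (i <= k)%N -> c i = 0.
Proof.
elim: k c C r => [|k IH] c C r r0 H.
  move=> i; rewrite leqn0 => /eqP ->; apply: (small_le_eq0 r0 (C := C)) => eps er.
  by have := H eps er; rewrite big_ord_recl big_ord0 expr0 mul1r addr0 expr1.
have c0 : c 0%N = 0.
  pose D := `|C| + \sum_(i < k.+1) `|c i.+1|.
  have r1 : 0 < Num.min r 1 by rewrite lt_min r0 ltr01.
  apply: (small_le_eq0 r1 (C := D)) => eps /andP[e0]; rewrite lt_min => /andP[er e1].
  have := H eps; rewrite e0 er => /(_ isT); rewrite big_ord_recl expr0 mul1r.
  set s := \sum_(i < k.+1) _ => Hs.
  have -> : c 0%N = (c 0%N + s) - s by ring.
  apply: le_trans (ler_normB _ _) _; rewrite mulrDl; apply: lerD.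
    apply: le_trans Hs _; apply: le_trans (ler_wpM2r _ (ler_norm C)) _.
      by rewrite exprn_ge0 // ltW.
    by rewrite ler_wpM2l // exprS ler_piMr ?(ltW e0) // exprn_ile1 // ltW.
  apply: le_trans (ler_norm_sum _ _ _) _; rewrite mulr_suml; apply: ler_sum => i _.
  rewrite lift0 normrM mulrC ler_wpM2l // normrX gtr0_norm // exprS ler_piMr ?(ltW e0) //.
  by rewrite exprn_ile1 // ltW.
case=> [//|i]; rewrite ltnS => ik.
apply: (IH (fun i => c i.+1) C r r0 _ i ik) => eps er.
have /andP[e0 _] := er.
have := H eps er; rewrite big_ord_recl c0 mulr0 add0r.
have -> : \sum_(i < k.+1) eps ^+ lift ord0 i * c (lift ord0 i) =
    eps * \sum_(i < k.+1) eps ^+ i * c i.+1.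
  by rewrite mulr_sumr; apply: eq_bigr => j _; rewrite lift0 exprS mulrA.
by rewrite normrM (gtr0_norm e0) exprS mulrCA ler_pM2l.
Qed.

Lemma finite_poly_roots (p : {poly R}) : p != 0 -> finite_set [set x | p.[x] = 0].
Proof.
have [N] := ubnP (size p); elim: N p => // N IH p pN p0.
have [[a pa]|npa] := pselect (exists a, p.[a] = 0); last first.
  by rewrite (_ : [set _ | _] = set0) // -subset0 => x /= px; apply: npa; exists x.
have /factor_theorem[q pq] : root p a by rewrite rootE pa.
have q0 : q != 0 by apply: contraNneq p0 => q0; rewrite pq q0 mul0r.
have qN : (size q < N)%N.
  by move: pN; rewrite pq size_Mmonic ?monicXsubC // size_XsubC addn2 /= ltnS.
apply: (@sub_finite_set _ _ ([set a] `|` [set x | q.[x] = 0])).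
  move=> x /=; rewrite pq hornerM hornerXsubC => /eqP; rewrite mulf_eq0 subr_eq0.
  by move=> /orP[/eqP|/eqP]; [right|left].
by rewrite finite_setU; split; [exact: finite_set1|exact: IH].
Qed.

(* A polynomial all of whose exponents have the same parity is [g(X^2)] or
   [X g(X^2)], and positive roots are determined by their squares. *)
Lemma parity_positive_roots (f : {poly R}) (N : nat) (d : bool) (s : seq R) : f != 0 ->
  (size f <= N.+1)%N -> (forall e, f`_e != 0 -> odd e = d) ->
  uniq s -> (forall x, x \in s -> 0 < x /\ f.[x] = 0) -> (2 * size s + d <= N)%N.
Proof.
move=> f0 fN fd us fs.
have count (g : {poly R}) : g != 0 -> (forall x, 0 < x -> f.[x] = 0 -> g.[x ^+ 2] = 0) ->
    (size s < size g)%N.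
  move=> g0 gf; rewrite -(size_map (fun x => x ^+ 2) s); apply: max_poly_roots => //.
    by apply/allP => _ /mapP[x /fs[x0 fx] ->]; rewrite rootE gf.
  rewrite map_inj_in_uniq // => x y /fs[x0 _] /fs[y0 _] /eqP.
  by rewrite eqrXn2 ?ltW // => /eqP.
have fE x : f.[x] = (even_poly f).[x ^+ 2] + (odd_poly f).[x ^+ 2] * x.
  by rewrite -{1}(poly_even_odd f) hornerD hornerMX !horner_comp hornerXn.
case: d fd => fd.
  have e0 : even_poly f = 0.
    apply/polyP => i; rewrite coef_even_poly coef0; apply/eqP; apply: contraT => /fd.
    by rewrite odd_double.
  have o0 : odd_poly f != 0.
    by apply: contraNneq f0 => o0; rewrite -(poly_even_odd f) e0 o0 !comp_poly0 mul0r addr0.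
  have := count _ o0; have := size_odd_poly f => H1 /(_ _)H2.
  have {}H2 : (size s < size (odd_poly f))%N.
    apply: H2 => x x0; rewrite fE e0 horner0 add0r => /eqP.
    by rewrite mulf_eq0 (gt_eqF x0) orbF => /eqP.
  by have := leq_trans H2 H1; lia.
have o0 : odd_poly f = 0.
  apply/polyP => i; rewrite coef_odd_poly coef0; apply/eqP; apply: contraT => /fd.
  by rewrite /= odd_double.
have e0 : even_poly f != 0.
  by apply: contraNneq f0 => e0; rewrite -(poly_even_odd f) e0 o0 !comp_poly0 mul0r addr0.
have H1 := size_even_poly f.
have H2 : (size s < size (even_poly f))%N.
  by apply: count => // x x0; rewrite fE o0 horner0 mul0r addr0.
by have := leq_trans H2 H1; lia.
Qed.

(** With N = W k and d the parity of the exponents, the three cases of [Kbound] are N even with d =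
    1, N even with d = 0, and N odd. Since 2 c is even, 2 c + d <= N improves to 2 c + 2 <= N in the
    first case and to 2 c + 1 <= N in the last. Coprimality excludes that s1 and s2 are both
    even. *)
Lemma Kbound_parity (k n s1 s2 c : nat) : (s2 <= s1)%N -> coprime s1 s2 ->
  (2 * c + odd (k * s2 + s1 + s2) <= (n * s1 + (s1 - s2)) * k)%N ->
  c%:R <= Kbound k n s1 s2.
Proof.
move=> s21 cop; set d := odd (k * s2 + s1 + s2); set N := ((n * s1 + (s1 - s2)) * k)%N => H.
have nee : ~~ (~~ odd s1 && ~~ odd s2).
  apply/negP => /andP[ev1 ev2].
  have : (2 %| gcdn s1 s2)%N by rewrite dvdn_gcd !dvdn2 ev1 ev2.
  by rewrite (eqP cop).
have wE : k%:R * ((n + 1)%N%:R * s1%:R - s2%:R) = N%:R :> rat.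
  by rewrite /N !(natrM rat) !(natrD rat) !(natrM rat) (natrB rat s21); ring.
have oN : odd N = odd k && (odd n && odd s1 (+) odd s1 (+) odd s2).
  by rewrite /N oddM oddD oddM oddB // andbC addbA.
have dE : d = (odd k && odd s2) (+) odd s1 (+) odd s2 by rewrite /d !oddD oddM.
have step0 : (2 * c <= N)%N by apply: leq_trans H; rewrite leq_addr.
have step1 : odd N || d -> (2 * c + 1 <= N)%N.
  case/orP => [od|dd]; last by rewrite dd in H.
  rewrite addn1 ltn_neqAle step0 andbT; apply/eqP => e.
  by move: od; rewrite -e oddM.
have step2 : ~~ odd N -> d -> (2 * c + 2 <= N)%N.
  move=> od dd; have : (2 * c + 1 <= N)%N by rewrite dd in H.
  rewrite leq_eqVlt => /orP[/eqP e|]; last by rewrite addn1 addn2.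
  by move: od; rewrite -e oddD oddM.
have toR (a : nat) : (2 * c + a <= N)%N -> 2 * c%:R + a%:R <= N%:R :> rat.
  by rewrite -(ler_nat rat) (natrD rat) (natrM rat).
rewrite /Kbound wE oddD.
case: ifP => [case1|/negbT case1].
  suff /toR : (2 * c + 2 <= N)%N by lra.
  apply: step2; rewrite ?oN ?dE; move: case1 nee;
    by case: (odd k); case: (odd n); case: (odd s1); case: (odd s2).
case: ifP => [case2|/negbT case2].
  have /toR : (2 * c + 0 <= N)%N by rewrite addn0.
  lra.
suff /toR : (2 * c + 1 <= N)%N by lra.
apply: step1; rewrite oN dE; move: case1 case2 nee;
  by case: (odd k); case: (odd n); case: (odd s1); case: (odd s2).
Qed.

End Counting.

(** * Matching the two expansions, the section and the reflection of angles *)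

Section Final.
Variable R : realType.
Local Notation S := {poly {poly R}}.

(** The same return point is expanded once in the parameter [h] and once in the radius [kap * h].
    The convergence of the first series controls its tail, so both truncations differ by
    O(eps^(k+1)) and their coefficients agree. *)
Lemma expansion_unique (k : nat) (h kap C eps0 : R) (Mh z : nat -> R) : 0 < kap -> 0 < eps0 ->
  (forall eps, `|eps| < eps0 -> exists2 h',
     h + \sum_(1 <= i < N) eps ^+ i * Mh i @[N --> \oo] --> h' &
     `|kap * h' - \sum_(i < k.+1) eps ^+ i * z i| <= C * `|eps| ^+ k.+1) ->
  kap * h = z 0%N /\ forall i, (i < k)%N -> kap * Mh i.+1 = z i.+1.
Proof.
move=> kap0 e0 H.
have cs eps h' : h + \sum_(1 <= i < N) eps ^+ i * Mh i @[N --> \oo] --> h' ->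
    \sum_(1 <= i < N) eps ^+ i * Mh i @[N --> \oo] --> h' - h.
  move=> c.
  have : (h + \sum_(1 <= i < N) eps ^+ i * Mh i) - h @[N --> \oo] --> h' - h.
    by apply: cvgB c _; exact: cvg_cst.
  by apply: cvg_trans; apply: near_eq_cvg; near=> N; rewrite addrC addKr.
have [|C1 C10 [r r0 Htail]] := @power_series_tail R Mh eps0 k e0.
  by move=> eps /H[h' /cs c _]; apply/cvg_ex; exists (h' - h).
pose c i := kap * (if i is i'.+1 then Mh i else h) - z i.
have c0 : forall i, (i <= k)%N -> c i = 0.
  apply: (@poly_small_coef_eq0 R k c (C + kap * C1) (Num.min eps0 r)).
    by rewrite lt_min e0.
  move=> eps /andP[ep]; rewrite lt_min -{1 2}(gtr0_norm ep) => /andP[ee er].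
  have [h' ch Hh] := H eps ee.
  have T := Htail eps _ er (cs _ _ ch).
  have -> : \sum_(i < k.+1) eps ^+ i * c i =
     (kap * h' - \sum_(i < k.+1) eps ^+ i * z i)
     - kap * (h' - h - \sum_(i < k) eps ^+ i.+1 * Mh i.+1).
    have E : \sum_(i < k.+1) eps ^+ i * (kap * (if i : nat is i'.+1 then Mh i else h)) =
       kap * (h + \sum_(i < k) eps ^+ i.+1 * Mh i.+1).
      rewrite big_ord_recl mulrDr expr0 mul1r; congr (_ + _).
      by rewrite mulr_sumr; apply: eq_bigr => i _; rewrite lift0 mulrCA.
    transitivity (\sum_(i < k.+1) eps ^+ i * (kap * (if i : nat is i'.+1 then Mh i else h))
      - \sum_(i < k.+1) eps ^+ i * z i).
      by rewrite -sumrB; apply: eq_bigr => i _; rewrite -mulrBr.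
    by rewrite E; ring.
  apply: le_trans (ler_normB _ _) _; rewrite mulrDl -{3 4}(gtr0_norm ep); apply: lerD => //.
  by rewrite normrM (gtr0_norm kap0) -mulrA ler_wpM2l // ltW.
split; first by apply/eqP; rewrite -subr_eq0; apply/eqP; exact: (c0 0%N).
by move=> i ik; apply/eqP; rewrite -subr_eq0; apply/eqP; exact: (c0 i.+1).
Unshelve. all: by end_near. Qed.

(** The weighted radius of the section point is proportional to [h], so positive zeros in [h] and in
    the radius correspond one to one. *)
Lemma section_scale (s1 s2 : nat) : (0 < s1)%N ->
  exists2 kap : R, 0 < kap & forall h, section_x s1 s2 h = (kap * h) ^+ s1.
Proof.
move=> s1p; set c := s1%:R `^ (- (2 * s2)%N%:R^-1) : R.
have c0 : 0 < c by rewrite powR_gt0 // ltr0n.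
exists (c `^ s1%:R^-1); first by rewrite powR_gt0.
move=> h; rewrite /section_x -/c exprMn; congr (_ * _).
by rewrite -powR_mulrn ?powR_ge0 // -powRrM mulVf ?powRr1 ?ltW // pnatr_eq0 -lt0n.
Qed.

Lemma base_weight_le_bound (s1 s2 m n : nat) : (0 < s2)%N -> (s2 <= s1)%N -> (0 < m)%N -> (m <= n)%N ->
  (base_weight s1 m <= weight_bound s1 s2 n)%N.
Proof.
move=> s2p s21 m0 mn; rewrite /base_weight /weight_bound.
have n0 : (0 < n)%N := leq_trans m0 mn.
have : (n + s1 <= n * s1 + 1)%N.
  case: n n0 {mn} => // n' _; case: s1 s21 => [|s1' _]; first by case: s2 s2p.
  by rewrite mulSn mulnS; lia.
lia.
Qed.

(* Reflection of the angle under [(x, y) |-> ((-1)^s1 x, (-1)^s2 y)]. *)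
Lemma angle_reflection (s1 s2 : nat) (sg : R) : coprime s1 s2 ->
  exists a b x1 : R, [/\ 0 <= x1 <= 2 * pi,
    (b = 1 /\ a = x1) \/ (b = -1 /\ a = x1 + 2 * pi), b = (-1) ^+ (s1 + s2),
    forall x, polar_cos (a + b * x) = (-1) ^+ s1 * polar_cos x &
    forall x, polar_sin sg (a + b * x) = (-1) ^+ s2 * polar_sin sg x].
Proof.
move=> cop.
have pp := pi_ge0 R.
have Es : forall d, (-1) ^+ d = (-1) ^+ odd d :> R by move=> d; rewrite signr_odd.
have [od1|ev1] := boolP (odd s1); have [od2|ev2] := boolP (odd s2).
- exists pi, 1, pi; split.
  + by rewrite pp; lra.
  + by left.
  + by rewrite Es oddD od1 od2.
  + by move=> x; rewrite Es od1 /polar_cos mul1r cosD cospi sinpi; ring.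
  + by move=> x; rewrite Es od2 /polar_sin mul1r sinD cospi sinpi; ring.
- exists (pi + 2 * pi), (-1), pi; split.
  + by rewrite pp; lra.
  + by right.
  + by rewrite Es oddD od1 (negbTE ev2).
  + move=> x; rewrite Es od1 /polar_cos mulN1r addrAC [2 * pi]mulr_natl cosD2pi cosB cospi sinpi /=; ring.
  + move=> x; rewrite Es (negbTE ev2) /polar_sin mulN1r addrAC [2 * pi]mulr_natl sinD2pi sinB cospi sinpi /=; ring.
- exists (0 + 2 * pi), (-1), 0; split.
  + by rewrite lexx; lra.
  + by right.
  + by rewrite Es oddD od2 (negbTE ev1).
  + move=> x; rewrite Es (negbTE ev1) /polar_cos mulN1r addrAC [2 * pi]mulr_natl cosD2pi add0r cosN /=; ring.
  + move=> x; rewrite Es od2 /polar_sin mulN1r addrAC [2 * pi]mulr_natl sinD2pi add0r sinN /=; ring.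
- exfalso; have : (2 %| gcdn s1 s2)%N by rewrite dvdn_gcd !dvdn2 ev1 ev2.
  by rewrite (eqP cop).
Qed.

End Final.

Theorem theorem4p8 (R : realType) (s1 s2 m n k : nat)
    (P Q : {poly {poly R}}) (p q : nat -> {poly {poly R}})
    (M : nat -> R -> R)
    (hs2 : (1 <= s2)%N) (hs : (s2 <= s1)%N) (hcop : coprime s1 s2)
    (hqh : quasi_homogeneous s1 s2 m P Q)
    (hcenter : center_at_origin (fun x y => P.[x, y]) (fun x y => Q.[x, y]))
    (hp : analytic_perturbation p) (hq : analytic_perturbation q)
    (hdeg : forall i : nat, (1 <= i)%N -> deg_le n (p i) /\ deg_le n (q i))
    (hmn : (m <= n)%N)
    (hM : melnikov_functions s1 s2 P Q p q M)
    (hk : first_nonvanishing M k) :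
  finite_set [set h : R | 0 < h /\ M k h = 0] /\
  (#|` fset_set [set h : R | 0 < h /\ M k h = 0] |)%:R <= Kbound k n s1 s2.
Proof.
have s1p : (0 < s1)%N := leq_trans hs2 hs.
have pdeg i : deg_le n (p i.+1) := (hdeg i.+1 isT).1.
have qdeg i : deg_le n (q i.+1) := (hdeg i.+1 isT).2.
have [k0 Mlow [h0 h00 Mh0]] := hk.
have m0 := weight_degree_gt0 hs2 hs hqh hcenter.
have e0W := base_weight_le_bound hs2 hs m0 hmn.
have [sg sg1 ang] := angular_sign hs2 hs hqh hcenter.
pose W := weight_bound s1 s2 n; pose e0 := base_weight s1 m.
pose al0 := radial0 P Q sg; pose be0 := angular0 s1 s2 P Q sg.
pose al := radial_coef s1 s2 n p q sg; pose be := angular_coef s1 s2 n p q sg.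
have be0_gt0 x : 0 < be0 x.
  by have := ang (sg * x); rewrite /angular cos_sg_mul // sin_sg_mul.
have al0c : continuous al0 := @radial0_continuous R P Q sg.
have be0c : continuous be0 := @angular0_continuous R s1 s2 P Q sg.
have alc : forall i e, continuous (al i e) := @radial_coef_continuous R s1 s2 n p q sg.
have bec : forall i e, continuous (be i e) := @angular_coef_continuous R s1 s2 n p q sg.
have [r0 [r0_0 r0_gt0 r0_d]] := integrating_factor_exists al0c be0c be0_gt0.
have b0c : continuous (den0 e0 be0 r0) by apply: den0_continuous; eassumption.
have bbc i e : continuous (den_coef r0 be i e) by apply: den_coef_continuous; eassumption.
have nnc i e : continuous (num_coef al0 be0 r0 al be i e) by apply: num_coef_continuous; eassumption.
have [F [G [[tF tG] FG F0 [F1 G1] [Fres Fk]]]] :=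
  formal_solution k b0c (den0_neq0 e0 be0_gt0 r0_gt0) bbc nnc e0W k.
have [kap kap0 sec] := @section_scale R s1 s2 s1p.
pose f i := (F (2 * pi))`_i.
(* Order 0 of the comparison is part of the result: the expansion of the return map starts with h,
   which forces the unperturbed factor [r0] to close up after one turn. *)
have key h : 0 < h -> r0 (2 * pi) = 1 /\ forall i, (i < k)%N ->
    kap * M i.+1 h = kap * h * ((kap * h) ^+ e0)^-1 ^+ i.+1 * (f i.+1).[kap * h].
  move=> h_gt0; set l := kap * h; have l0 : 0 < l by rewrite mulr_gt0.
  have [C C0 [eps1 eps10 Hret]] := first_return_expansion hs2 hs hqh pdeg qdeg hp hq sg1
    be0_gt0 e0W r0_0 r0_gt0 r0_d tF tG FG F0 F1 Fres l0.
  (* The compact interval is reduced to one point, since coefficients are compared for each [h]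
     separately. *)
  have [eps2 eps20 Hmel] := hM h h h_gt0 (lexx h).
  pose z i := r0 (2 * pi) * (if i is i'.+1 then l * (l ^+ e0)^-1 ^+ i * (f i).[l] else l).
  have em0 : 0 < Num.min eps1 eps2 by rewrite lt_min eps10.
  have [|z0 zi] := @expansion_unique R k h kap C _ (fun i => M i h) z kap0 em0.
    move=> eps; rewrite lt_min => /andP[ee1 ee2].
    have hh : h <= h <= h by rewrite lexx.
    have [h' [h'0 [x [y [T T0 [sol [x0 y0] [xT yT] hfirst]]]]] ch] := Hmel h eps hh ee2.
    exists h' => //.
    have -> : \sum_(i < k.+1) eps ^+ i * z i = approx_orbit e0 r0 F (2 * pi) l eps.
      rewrite (approx_orbit_expansion e0 r0 F1 Fk) big_ord_recl expr0 mul1r; congr (_ + _).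
    apply: (Hret eps T _ x y ee1 T0 _ sol); rewrite ?mulr_gt0 //; first by rewrite x0 sec.
    by rewrite xT sec.
  have r1 : r0 (2 * pi) = 1.
    by apply: (mulIf (lt0r_neq0 l0)); rewrite mul1r; exact: esym z0.
  split => // i ik; rewrite zi // /z r1 mul1r //.
have r2pi : r0 (2 * pi) = 1 := (key 1 ltr01).1.
have F2pi i : (0 < i < k)%N -> (F (2 * pi))`_i = 0.
  case: i => // i /andP[_ ik]; apply: poly_eq0_pos => l l0.
  have h_gt0 : 0 < kap^-1 * l by rewrite mulr_gt0 // invr_gt0.
  have [_ /(_ i (ltnW ik))] := key _ h_gt0.
  rewrite mulrA divff ?gt_eqF // mul1r Mlow ?h_gt0 ?ik // mulr0 => /esym/eqP.
  rewrite mulf_eq0 => /orP[|/eqP //].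
  by rewrite mulf_eq0 (gt_eqF l0) expf_eq0 invr_eq0 expf_eq0 (gt_eqF l0) !andbF.
have Mf h : 0 < h -> (M k h == 0) = ((f k).[kap * h] == 0).
  move=> h_gt0; have [k' kE] : exists k', k = k'.+1 by case: (k) k0 => // k' _; exists k'.
  have [_ /(_ k')] := key h h_gt0; rewrite kE => /(_ (ltnSn _)) E.
  have l0 : kap * h != 0 by rewrite gt_eqF ?mulr_gt0.
  rewrite -(mulrI_eq0 _ (lregP (lt0r_neq0 kap0))) E mulrI_eq0 //; apply/lregP.
  by rewrite mulf_neq0 // expf_neq0 // invr_neq0 // expf_neq0.
have f0 : f k != 0.
  apply/eqP => fk0; apply: Mh0; apply/eqP; rewrite Mf //.
  by rewrite fk0 horner0.
have [a [b [x1 [x1_in ab bE ccs sss]]]] := @angle_reflection R s1 s2 sg hcop.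
have Bsym := angular_field_symmetric k hs2 hs hqh pdeg qdeg ccs sss.
have par e : (f k)`_e != 0 -> b = (-1) ^+ (e + e0 * k).
  apply: (@jump_coef_parity R W e0 k al0 be0 r0 al be al0c be0c alc bec be0_gt0 e0W k0 r0_0
    r0_gt0 r0_d F G tF tG FG F0 F1 Fres Fk _ _ r2pi F2pi a b x1 ((-1) ^+ s1) ((-1) ^+ s2)) => //.
  - exact: radial_field_periodic.
  - exact: angular_field_periodic.
  - by rewrite bE exprD -mulrA sign_sq mulr1.
  - by rewrite normrX normrN1 expr1n.
  - exact: radial_field_symmetric.
(* At eps = 0 and L = 1 the angular symmetry reads (-1)^e0 be0(0) = (-1)^s2 be0(a), and both values
   of [be0] are positive. *)
have e0par : odd e0 = odd s2.
  have := Bsym 0 0 1; rewrite /fieldv !big1 => [|i _|i _]; last 2 first.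
  - by rewrite big1 // => e _; rewrite expr0n !mul0r.
  - by rewrite big1 // => e _; rewrite expr0n !mul0r.
  rewrite !addr0 expr1n mulr1 => E.
  have b1 := be0_gt0 0; have b2 := be0_gt0 (a + b * 0).
  move: E; rewrite -/be0 -/e0 -(signr_odd R e0) -(signr_odd R s2).
  by case: (odd e0); case: (odd s2) => //= E; exfalso; move: E; lra.
have fpar e : (f k)`_e != 0 -> odd e = odd (k * s2 + s1 + s2).
  move=> /par; rewrite bE -(signr_odd R (s1 + s2)) -(signr_odd R (e + e0 * k)).
  have -> : odd (e + e0 * k) = odd e (+) odd (k * s2) by rewrite oddD !oddM e0par andbC.
  have -> : odd (k * s2 + s1 + s2) = odd (k * s2) (+) odd (s1 + s2) by rewrite -addnA oddD.
  case: (odd (s1 + s2)); case: (odd e); case: (odd (k * s2)) => //=;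
    by rewrite ?expr0 ?expr1 => E; exfalso; move: E; lra.
pose Z0 := [set h : R | 0 < h /\ M k h = 0].
have kapi : injective (fun h => kap * h) by move=> u v /(mulfI (lt0r_neq0 kap0)).
have finZ : finite_set Z0.
  apply: (@sub_finite_set _ _ ((fun l => kap^-1 * l) @` [set l | (f k).[l] = 0])).
    move=> h [h_gt0 /eqP]; rewrite Mf // => /eqP fh /=.
    by exists (kap * h) => //; rewrite mulrA mulVf ?mul1r // gt_eqF.
  by apply: finite_image; exact: finite_poly_roots.
split => //; apply: Kbound_parity => //.
have [_ Ftame _] := tF.
have := @parity_positive_roots R (f k) (W * k) (odd (k * s2 + s1 + s2))
  [seq kap * h | h <- enum_fset (fset_set Z0)] f0 _ fpar.
rewrite size_map; apply.
- by apply/leq_sizeP => j jk; exact: Ftame.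
- by rewrite map_inj_uniq ?fset_uniq.
- move=> _ /mapP[h + ->]; rewrite in_fset_set // inE => -[h_gt0 /eqP].
  by rewrite Mf // => /eqP ->; rewrite mulr_gt0.
Qed.
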